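(* Fix $1\le p<\infty$ with $p\ne2$ and $k\in\mathbb N$. For $n\ge k$ let $X^{(n)}$ be uniformly distributed on $n^{1/p}\mathbb B_p^n$, for $V\in\mathbb V_{k,n}$ let $\mu_V$ be the distribution of $VX^{(n)}$ on $\mathbb R^k$, and let $V_{k,n}$ be a random matrix uniformly distributed on the Stiefel manifold $\mathbb V_{k,n}$, where the random matrices $V_{k,n}$, $n\ge k$, are defined on a common probability space. Then, with probability $1$, the sequence $\mu_{V_{k,n}}$ converges as $n\to\infty$ to the Gaussian law $\mathcal N(0,\sigma_p^2\,\mathrm{Id}_{k\times k})$ in the weak topology of $\mathcal M_1(\mathbb R^k)$, where $\sigma_p^2=p^{2/p}\,\Gamma(3/p)/\Gamma(1/p)$.
   Context: $\mathbb B_p^n=\{x\in\mathbb R^n:\sum_{i=1}^n|x_i|^p\le1\}$. For $k\le n$, $\mathbb V_{k,n}=\{V\in\mathbb R^{k\times n}: VV^*=\mathrm{Id}_{k\times k}\}$, viewed as linear maps $\mathbb R^n\to\mathbb R^k$; the uniform distribution on $\mathbb V_{k,n}$ is the unique Borel probability measure invariant under $V\mapsto UVW$ for all $U\in\mathcal O(k)$, $W\in\mathcal O(n)$. The random measure $\mu_{V_{k,n}}$ is obtained by substituting the random matrix $V_{k,n}$ into the map $V\mapsto\mu_V$, where $\mu_V(B)=\mathbb P[VX^{(n)}\in B]$ for Borel $B\subset\mathbb R^k$. $\mathcal M_1(\mathbb R^k)$ is the space of Borel probability measures on $\mathbb R^k$ with the topology of weak convergence. *)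

(* Defs.v *)
From HB Require Import structures.
From mathcomp Require Import all_boot all_order all_algebra.
From mathcomp Require Import all_classical all_reals all_analysis.
From mathcomp Require Import measurable_realfun.

Set Implicit Arguments.
Unset Strict Implicit.
Unset Printing Implicit Defensive.

Import Order.TTheory GRing.Theory Num.Theory.
Import numFieldNormedType.Exports.

Local Open Scope classical_set_scope.
Local Open Scope ring_scope.

HB.instance Definition _ (R : realType) (m n : nat) :=
  @isMeasurable.Build (sigma_display (@open 'M[R]_(m, n))) 'M[R]_(m, n)
    <<s @open 'M[R]_(m, n) >> (@sigma_algebra0 _ setT _) (@sigma_algebraC _ _)
    (@sigma_algebra_bigcup _ setT _).

Section borel_matrices.
Context (R : realType).

Lemma open_measurable_mx m n (A : set 'M[R]_(m, n)) : open A -> measurable A.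
Proof. exact: sub_sigma_algebra. Qed.

Lemma continuous_measurable_mx m n m' n' (f : 'M[R]_(m, n) -> 'M[R]_(m', n')) :
  continuous f -> measurable_fun setT f.
Proof.
move=> cf; apply: (measurability (@open 'M[R]_(m', n'))) => // _ [B oB <-].
by rewrite setTI; apply: open_measurable_mx; move/continuousP: cf; exact.
Qed.

Lemma continuous_measurable_mxR m n (f : 'M[R]_(m, n) -> R) :
  continuous f -> measurable_fun setT f.
Proof.
move=> cf; apply: (measurability _ (RGenOInfty.measurableE R)) => _ [B [x ->] <-].
by rewrite setTI; apply: open_measurable_mx; move/continuousP: cf; apply.
Qed.

Lemma measurable_fun_coord m n i j :
  measurable_fun setT (fun M : 'M[R]_(m, n) => M i j).
Proof. by apply: continuous_measurable_mxR; exact: coord_continuous. Qed.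

Lemma measurable_fun_mxP d (T : measurableType d) m n (f : T -> 'M[R]_(m, n)) :
  measurable_fun setT f <-> forall i j, measurable_fun setT (fun x => f x i j).
Proof.
split=> [mf i j|mf].
  exact: (measurableT_comp (measurable_fun_coord i j)).
apply: (measurability (@open 'M[R]_(m, n))) => // _ [A oA <-]; rewrite setTI.
pose B (q : 'M[rat]_(m, n) * rat) :=
  [set M : 'M[R]_(m, n) | forall i j, `|ratr (q.1 i j) - M i j| < ratr q.2].
have -> : A = \bigcup_(q in [set q | B q `<=` A]) B q.
  apply/seteqP; split=> [M AM|M [q qA]]; last exact: qA.
  have [e /= e0 eA] : exists2 e : R, 0 < e & ball M e `<=` A.
    by have /nbhs_ballP[e e0 eA] := open_nbhs_nbhs (conj oA AM); exists e.
  have e20 : 0 < e / 2 by rewrite divr_gt0.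
  have [r] := rat_in_itvoo e20; rewrite in_itv/= => /andP[r0 re].
  have ex_q i j : exists q : rat, `|ratr q - M i j| < ratr r.
    have : M i j - ratr r < M i j + ratr r.
      by rewrite ltrBlDr -addrA ltrDl addr_gt0.
    move=> /rat_in_itvoo[q]; rewrite in_itv/= => qP.
    by exists q; rewrite ltr_distl.
  exists (\matrix_(i, j) sval (cid (ex_q i j)), r).
    move=> N /= BN; apply: eA; split=> // i j; rewrite /ball/=.
    have := BN i j; rewrite mxE; case: cid => q/= qM qN.
    rewrite (le_lt_trans (ler_distD (ratr q) _ _))//.
    rewrite [e]splitr ltrD// ?(lt_trans _ re)//.
    by rewrite distrC.
  by move=> i j /=; rewrite mxE; case: cid.
rewrite preimage_bigcup bigcup_mkcond.
apply: countable_bigcupT_measurable => [|q]; first exact: countableP.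
case: ifPn => // _.
rewrite (_ : _ @^-1` _ = \bigcap_(i in [set: 'I_m]) \bigcap_(j in [set: 'I_n])
  (fun x => `|ratr (q.1 i j) - f x i j|) @^-1` `]-oo, ratr q.2[); last first.
  apply/seteqP; split=> x /=.
    by move=> Bx i _ j _ /=; rewrite in_itv/=; exact: Bx.
  by move=> Bx i j; have := Bx i I j I; rewrite /= in_itv.
apply: fin_bigcap_measurable => // i _; apply: fin_bigcap_measurable => // j _.
rewrite -[X in measurable X]setTI.
suff mfij : measurable_fun setT (fun x => `|ratr (q.1 i j) - f x i j|) by exact: mfij.
by apply: measurableT_comp => //; apply: measurable_funB.
Qed.

Lemma measurable_mulmx m n p (V : 'M[R]_(m, n)) :
  measurable_fun setT (fun x : 'M[R]_(n, p) => V *m x).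
Proof.
apply/measurable_fun_mxP => i j; under eq_fun do rewrite mxE.
apply: measurable_sum => k; apply: measurable_funM => //.
exact: measurable_fun_coord.
Qed.

HB.instance Definition _ m n p (V : 'M[R]_(m, n)) :=
  isMeasurableFun.Build _ _ _ _ (@mulmx R m n p V) (measurable_mulmx V).

(* [lebesgue_measure] and [normal_prob] are measures on [measurableTypeR R], which
   has the same measurable sets as [R] but a different display. *)
Definition mx_cons n (z : measurableTypeR R * 'cV[R]_n) : 'cV[R]_n.+1 :=
  col_mx (const_mx z.1 : 'M[R]_1) z.2.

Lemma mx_cons0 n z : @mx_cons n z ord0 0 = z.1.
Proof.
rewrite [ord0](_ : _ = lshift n (0 : 'I_1)); last exact: val_inj.
by rewrite [LHS]col_mxEu mxE.
Qed.

Lemma mx_consS n z i : @mx_cons n z (lift ord0 i) 0 = z.2 i 0.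
Proof.
rewrite [lift _ _](_ : _ = rshift 1 i); last exact: val_inj.
by rewrite [LHS]col_mxEd.
Qed.

Lemma measurable_mx_cons n : measurable_fun setT (@mx_cons n).
Proof.
apply/measurable_fun_mxP => i j; rewrite /mx_cons.
under eq_fun do rewrite mxE.
case: (@splitP 1 n i) => k _.
  under eq_fun do rewrite mxE.
  exact: measurable_fst.
exact: (measurableT_comp (measurable_fun_coord k j) measurable_snd).
Qed.

Definition mx_uncons n (v : 'cV[R]_n.+1) : measurableTypeR R * 'cV[R]_n :=
  ((v : 'M[R]_(1 + n, 1)) 0 0, dsubmx (v : 'M[R]_(1 + n, 1))).

Lemma mx_consK n : cancel (@mx_cons n) (@mx_uncons n).
Proof.
move=> [x v]; rewrite /mx_cons /mx_uncons/= col_mxKd; congr (_, _).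
by rewrite (_ : 0 = lshift n (0 : 'I_1)) ?col_mxEu ?mxE//; exact: val_inj.
Qed.

Lemma measurable_mx_uncons n : measurable_fun setT (@mx_uncons n).
Proof.
apply: measurable_fun_pair; first exact: measurable_fun_coord.
apply/measurable_fun_mxP => i j; under eq_fun do rewrite mxE.
exact: measurable_fun_coord.
Qed.

End borel_matrices.

Section power_measure.
Context (R : realType) (mu : {sigma_finite_measure set (measurableTypeR R) -> \bar R}).

(* mu^n on R^n = R * R^(n-1); see mpow_box *)
Fixpoint mpow n : set 'cV[R]_n -> \bar R :=
  match n return set 'cV[R]_n -> \bar R with
  | 0%N => \d_(0 : 'cV[R]_0)
  | m.+1 => pushforward (mu \x @mpow m)%E (@mx_cons R m)
  end.
Arguments mpow : clear implicits.

Lemma mpow_sigma_finite_measure n :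
  exists M : {sigma_finite_measure set 'cV[R]_n -> \bar R},
    mpow n = M :> (set _ -> _).
Proof.
elim: n => [|n [M IH]]; first by exists \d_(0 : 'cV[R]_0).
pose N : {measure set _ -> \bar R} :=
  measure_function_pushforward__canonical__measure_function_Measure
  (mu \x M)%E (@measurable_mx_cons R n).
have Nfin : sigma_finite setT N.
  have /sigma_finiteP[F [TF ndF Foo]] := sigma_finiteT mu.
  have /sigma_finiteP[G [TG ndG Goo]] := sigma_finiteT M.
  exists (fun k => (@mx_uncons R n) @^-1` (F k `*` G k)).
    rewrite -preimage_bigcup -[LHS](preimage_setT (@mx_uncons R n)).
    congr (_ @^-1` _); rewrite -setXTT TF TG; apply/seteqP; split=> -[x y].
      move=> [/= [i _ Fx] [j _ Gy]]; exists (maxn i j) => //; split.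
        by move: x Fx; exact/subsetPset/ndF/leq_maxl.
      by move: y Gy; exact/subsetPset/ndG/leq_maxr.
    by move=> [i _ []/= ? ?]; split; exists i.
  move=> k; have [mF Fk] := Foo k; have [mG Gk] := Goo k; split.
    rewrite -[X in measurable X]setTI; apply: measurable_mx_uncons => //.
    exact: measurableX.
  rewrite /N/= /pushforward -comp_preimage.
  rewrite (_ : _ \o _ = id); last by apply/funext=> z; exact: mx_consK.
  by rewrite preimage_id product_measure1E// lte_mul_pinfty// ge0_fin_numE.
pose Nm := Measure_isSigmaFinite.Build _ _ _ N Nfin.
pose S : {sigma_finite_measure set 'cV[R]_n.+1 -> \bar R} :=
  HB.pack (Measure.sort N) (Measure.class N) Nm.
by exists S; rewrite /= IH.
Qed.

Let mpow0 n : mpow n set0 = 0%E.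
Proof. by have [M ->] := mpow_sigma_finite_measure n; exact: measure0. Qed.

Let mpow_ge0 n A : (0 <= mpow n A)%E.
Proof. by have [M ->] := mpow_sigma_finite_measure n; exact: measure_ge0. Qed.

Let mpow_sigma_additive n : semi_sigma_additive (mpow n).
Proof.
have [M ->] := mpow_sigma_finite_measure n.
exact: measure_semi_sigma_additive.
Qed.

HB.instance Definition _ n := isMeasure.Build _ _ _ (mpow n)
  (mpow0 n) (@mpow_ge0 n) (@mpow_sigma_additive n).

Let mpow_sigma_finite n : sigma_finite setT (mpow n).
Proof. by have [M ->] := mpow_sigma_finite_measure n; exact: sigma_finiteT. Qed.

HB.instance Definition _ n := Measure_isSigmaFinite.Build _ _ _ (mpow n)
  (@mpow_sigma_finite n).

Lemma mpow_box n (A : 'I_n -> set R) : (forall i, measurable (A i)) ->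
  mpow n [set v | forall i, A i (v i 0)] = (\prod_(i < n) mu (A i))%E.
Proof.
elim: n A => [|n IH] A mA.
  rewrite big_ord0 /= diracE mem_set//=; by case.
rewrite big_ord_recl /= /pushforward.
pose B : set 'cV[R]_n := [set v | forall i, A (lift ord0 i) (v i 0)].
have mB : measurable B.
  rewrite (_ : B = \bigcap_(i in [set: 'I_n])
      (fun v : 'cV[R]_n => v i 0) @^-1` A (lift ord0 i)); last first.
    by apply/seteqP; split=> v /= Bv i; [move=> _; exact: Bv|exact: Bv].
  apply: fin_bigcap_measurable => // i _; rewrite -[X in measurable X]setTI.
  by apply: measurable_fun_coord.
rewrite (_ : _ @^-1` _ = A ord0 `*` B); last first.
  apply/seteqP; split=> -[x v] /=.
    move=> Axv; split=> [|i]/=; first by have := Axv ord0; rewrite mx_cons0.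
    by have := Axv (lift ord0 i); rewrite mx_consS.
  move=> [/= Ax Bv] i; have [j|] := unliftP ord0 i => ->.
    by rewrite mx_consS; exact: Bv.
  by rewrite mx_cons0.
have [M ME] := mpow_sigma_finite_measure n.
rewrite ME product_measure1E//; last exact: mA.
rewrite -ME; congr (_ * _)%E.
by apply: (IH (fun i => A (lift ord0 i))).
Qed.

End power_measure.
Arguments mpow {R} mu n.

Definition lebesgue_cV (R : realType) (n : nat) : set 'cV[R]_n -> \bar R :=
  mpow lebesgue_measure n.
HB.instance Definition _ (R : realType) (n : nat) :=
  SigmaFiniteMeasure.on (@lebesgue_cV R n).

(* N(0, s^2 Id): the law of a vector with independent N(0, s^2) coordinates;
   the second argument of normal_prob is the standard deviation. *)
Definition gaussian_cV (R : realType) (k : nat) (s : R) : set 'cV[R]_k -> \bar R :=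
  mpow (normal_prob 0 s) k.
HB.instance Definition _ (R : realType) (k : nat) (s : R) :=
  Measure.on (@gaussian_cV R k s).

Lemma gaussian_cV_setT (R : realType) (k : nat) (s : R) :
  @gaussian_cV R k s setT = 1%E.
Proof.
have -> : setT = [set v : 'cV[R]_k | forall i, [set: R] (v i 0)].
  by apply/seteqP; split.
rewrite [LHS](@mpow_box R (normal_prob 0 s) k (fun=> setT)) // big1// => i _.
exact: probability_setT.
Qed.
HB.instance Definition _ (R : realType) (k : nat) (s : R) :=
  Measure_isProbability.Build _ _ _ (@gaussian_cV R k s)
    (gaussian_cV_setT k s).

Lemma initial_cvgP (S : choiceType) (T : topologicalType) (f : S -> T)
    (F : set_system S) (s : S) : Filter F ->
  F --> (s : initial_topology f) <-> f @ F --> f s.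
Proof.
move=> FF; split=> [Fs|fFs].
  by move=> A /(@initial_continuous _ _ f s) /Fs.
move=> A; rewrite nbhsE => -[_ [[U oU <-] Us] UA]; rewrite nbhs_filterE.
have : nbhs (f s) U by exact: open_nbhs_nbhs.
by move=> /fFs FU; exact: (@filterS _ F _ (f @^-1` U)).
Qed.

Definition bcfun (R : realType) (k : nat) :=
  {f : 'cV[R]_k -> R | continuous f /\ bounded_fun f}.

Definition bcfun_int (R : realType) (k : nat) (mu : probability 'cV[R]_k R) :
  {ptws bcfun R k -> R} := fun f => (\int[mu]_x sval f x)%R.

(* M_1(R^k) with the weak topology: the coarsest topology that makes
   mu |-> \int f dmu continuous for every bounded continuous f. *)
Definition M1 (R : realType) (k : nat) := initial_topology (@bcfun_int R k).
HB.instance Definition _ R k := Topological.on (M1 R k).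

Lemma M1_cvgP (R : realType) (k : nat) (mu_ : nat -> M1 R k) (mu : M1 R k) :
  mu_ @ \oo --> mu <->
  forall f : 'cV[R]_k -> R, continuous f -> bounded_fun f ->
    (\int[mu_ n]_x f x)%R @[n --> \oo] --> (\int[mu]_x f x)%R.
Proof.
rewrite initial_cvgP cvg_sup; split=> [cvg_mu f cf bf|cvg_int [f [cf bf]]].
  by have /initial_cvgP := cvg_mu (exist _ f (conj cf bf)).
by apply/initial_cvgP; exact: cvg_int.
Qed.

Definition Gamma (R : realType) (x : R) : R :=
  (\int[lebesgue_measure]_(t in `]0, +oo[) (t `^ (x - 1) * expR (- t)))%R.

Definition sigma2 (R : realType) (p : R) : R :=
  p `^ (2 / p) * Gamma (3 / p) / Gamma (1 / p).

Definition lp_ball (R : realType) (p : R) (n : nat) : set 'cV[R]_n :=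
  [set x | \sum_(i < n) `|x i 0| `^ p <= 1].

(* Normalized Lebesgue measure on K; the quotient is meaningful when K has
   positive finite volume. *)
Definition uniform_on (R : realType) (n : nat) (K : set 'cV[R]_n)
    (mu : probability 'cV[R]_n R) :=
  forall A, measurable A ->
    mu A = (fine (lebesgue_cV (A `&` K)) / fine (lebesgue_cV K))%:E.

Definition stiefel (R : realType) (k n : nat) : set 'M[R]_(k, n) :=
  [set V | V *m V^T = 1%:M].

Definition orthogonal_mx (R : realType) (n : nat) : set 'M[R]_n :=
  [set U | U *m U^T = 1%:M].

(* A measure on all k x n matrices; by uniqueness of the invariant probability
   measure on the Stiefel manifold, at most one mu satisfies this. *)
Definition stiefel_uniform (R : realType) (k n : nat)
    (mu : probability 'M[R]_(k, n) R) :=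
  mu (@stiefel R k n) = 1%E /\
  forall (U : 'M[R]_k) (W : 'M[R]_n), orthogonal_mx U -> orthogonal_mx W ->
    forall A, measurable A -> mu ((fun V => U *m V *m W) @^-1` A) = mu A.

Definition proj_law (R : realType) (k n : nat) d (T : measurableType d)
    (P : probability T R) (X : {mfun T >-> 'cV[R]_n}) (V : 'M[R]_(k, n)) :
    M1 R k :=
  distribution P (mulmx V \o X).

(* Main.v *)
Require Import Defs.
From mathcomp Require Import all_boot all_order all_algebra.
From mathcomp Require Import all_classical all_reals all_analysis.
From mathcomp Require Import measurable_realfun ring lra.

Set Implicit Arguments.
Unset Strict Implicit.
Unset Printing Implicit Defensive.

Import Order.TTheory GRing.Theory Num.Theory.
Import numFieldNormedType.Exports.

Local Open Scope classical_set_scope.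
Local Open Scope ring_scope.

(** Almost surely the matrices [V n] have orthonormal rows and entries that tend to
    zero; for every deterministic sequence of matrices with these two properties
    the projected laws converge to the Gaussian one.

    The random part is [stiefel_entries_cvg0]. Invariance under orthogonal
    matrices determines the sixth moments of the entries, and the expected sum of
    the sixth powers of the entries of a row is 15 / ((n + 2) (n + 4)). This is
    summable, so the sums of sixth powers tend to zero almost surely.

    The deterministic part is [proj_law_cvg]. By a form of Levy's theorem,
    [cvg_from_trigonometric_integrals], it is enough to prove tightness, which
    follows from a bound on second moments, and the convergence of the integrals
    of [cos (dot t x + c)]. For [x = V *m y] the argument of the cosine is
    [dot s y + c] with [s = V^T *m t]: the vector [s] has the norm of [t], and the
    sum of the fourth powers of its coordinates tends to zero.

    The law of density proportional to [exp (- lp_sum p y / p)] on [R^n] is a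
    mixture of the uniform laws on the balls [r n^(1/p) B_p^n], in which [r^p] is
    [p / n] times a gamma variable of parameter [n / p + 1]
    ([integral_lp_mixture]). As [r] concentrates at 1, the uniform law on
    [n^(1/p) B_p^n] and this product law give integrals of [cos (dot s y + c)]
    that differ by a multiple of [n^(-1/2)] ([lipschitz_transform_uniform]).

    For the product law, whose coordinates are symmetric of variance
    [sigma2 p], the integral of [cos (dot s y)] is the product over j of
    [1 - sigma2 p * s_j^2 / 2 + O(s_j^4)], while the product of the
    [exp (- sigma2 p * s_j^2 / 2)] is the Gaussian value, which depends only on
    the norm of [t]. The difference is at most a multiple of the sum of the
    [s_j^4] ([uniform_transform_gaussian]). *)

(** * Binomial probabilities *)

(** The probabilities of the binomial law of parameters [N] and [u], whose first
    two moments are computed below. *)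
Definition bern (R : realType) (N m : nat) (u : R) : R :=
  'C(N, m)%:R * u ^+ m * (1 - u) ^+ (N - m).

Section bernstein.
Context (R : realType).
Implicit Types (u : R) (h : nat -> R).

Lemma bern_ge0 N m u : 0 <= u <= 1 -> 0 <= bern N m u.
Proof.
move=> /andP[u0 u1]; rewrite /bern !mulr_ge0 ?exprn_ge0//.
by rewrite subr_ge0.
Qed.

(** The Pascal recursion: conditioning on the outcome of one trial. *)
Lemma bern_rec N u h :
  \sum_(m < N.+2) bern N.+1 m u * h m =
  u * (\sum_(m < N.+1) bern N m u * h m.+1) +
  (1 - u) * (\sum_(m < N.+1) bern N m u * h m).
Proof.
have -> : (1 - u) * (\sum_(m < N.+1) bern N m u * h m) =
    (1 - u) ^+ N.+1 * h 0%N +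
    \sum_(m < N.+1) ('C(N, m.+1)%:R * u ^+ m.+1 * (1 - u) ^+ (N - m)) * h m.+1.
  rewrite big_ord_recl [in RHS]big_ord_recr /= bin_small// !mul0r addr0 mulrDr.
  congr (_ + _).
    by rewrite /bern bin0 subn0 expr0 !mul1r mulrA -exprS.
  rewrite mulr_sumr; apply: eq_bigr => i _; rewrite /bern/= /bump/= add1n.
  rewrite -[(N - i)%N](@prednK _) ?subn_gt0// -subnS (exprS (1 - u)) (exprS u); ring.
rewrite addrCA big_ord_recl; congr (_ + _).
  by rewrite /bern bin0 expr0 subn0 !mul1r.
rewrite mulr_sumr -big_split; apply: eq_bigr => i _ /=.
rewrite /bern /bump/= add1n binS natrD subSS exprS; ring.
Qed.

Lemma bern_sum N u : \sum_(m < N.+1) bern N m u = 1.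
Proof.
elim: N => [|N IH]; first by rewrite big_ord1 /bern bin0 !expr0 !mulr1.
have := bern_rec N u (fun=> 1).
under eq_bigr do rewrite mulr1.
move=> ->.
have -> : \sum_(m < N.+1) bern N m u * 1 = 1 by rewrite -[RHS]IH; apply: eq_bigr => ? _; rewrite mulr1.
by ring.
Qed.

Lemma bern_mean N u : \sum_(m < N.+1) bern N m u * m%:R = N%:R * u.
Proof.
elim: N => [|N IH]; first by rewrite big_ord1 mulr0 mul0r.
rewrite (bern_rec N u (fun m => m%:R)) IH.
under eq_bigr do rewrite -natr1 mulrDr mulr1.
by rewrite big_split/= IH bern_sum -natr1; ring.
Qed.

Lemma bern_second_moment N u :
  \sum_(m < N.+1) bern N m u * m%:R ^+ 2 = N%:R * u * (1 - u) + (N%:R * u) ^+ 2.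
Proof.
elim: N => [|N IH]; first by rewrite big_ord1 expr0n mulr0 !mul0r expr0n addr0.
rewrite (bern_rec N u (fun m => m%:R ^+ 2)) IH.
under eq_bigr do rewrite -natr1 sqrrD expr1n mulr1 mulr2n !mulrDr mulr1.
by rewrite !big_split/= IH bern_mean bern_sum -natr1; ring.
Qed.

Lemma bern_variance N u : (0 < N)%N ->
  \sum_(m < N.+1) bern N m u * (m%:R / N%:R - u) ^+ 2 = u * (1 - u) / N%:R.
Proof.
move=> N0; have NN : N%:R != 0 :> R by rewrite pnatr_eq0 -lt0n.
have -> : \sum_(m < N.+1) bern N m u * (m%:R / N%:R - u) ^+ 2 =
   (\sum_(m < N.+1) bern N m u * m%:R ^+ 2) * N%:R^-1 ^+ 2 +
   ((\sum_(m < N.+1) bern N m u * m%:R) * (- (2 * u / N%:R)) +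
   (\sum_(m < N.+1) bern N m u) * u ^+ 2).
  by rewrite !mulr_suml -!big_split/=; apply: eq_bigr => m _; field.
by rewrite bern_second_moment bern_mean bern_sum; field.
Qed.

End bernstein.

(** * Trigonometric polynomials *)

Definition dot (R : realType) k (t x : 'cV[R]_k) : R :=
  \sum_(j < k) t j 0 * x j 0.

(** The phase [c] makes the class stable under products. *)
Inductive trigpoly (R : realType) k : ('cV[R]_k -> R) -> Prop :=
| trigpoly_cos a t c : trigpoly (fun x => a * cos (dot t x + c))
| trigpolyD F G : trigpoly F -> trigpoly G -> trigpoly (fun x => F x + G x).

Section trigonometric_polynomials.
Context (R : realType) (k : nat).
Implicit Types (F G : 'cV[R]_k -> R) (t x : 'cV[R]_k).

Lemma dotDl t s x : dot (t + s) x = dot t x + dot s x.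
Proof. by rewrite -big_split/=; apply: eq_bigr => j _; rewrite mxE mulrDl. Qed.

Lemma dotNl t x : dot (- t) x = - dot t x.
Proof. by rewrite -sumrN/=; apply: eq_bigr => j _; rewrite mxE mulNr. Qed.

Lemma dot0l x : dot 0 x = 0.
Proof. by rewrite /dot big1// => j _; rewrite mxE mul0r. Qed.

Lemma dot_delta j x (a : R) : dot (a *: delta_mx j 0) x = a * x j 0.
Proof.
rewrite /dot (bigD1 j)//= big1 => [|i ij]; last by rewrite !mxE (negbTE ij) !(mulr0,mul0r).
by rewrite !mxE !eqxx mulr1 addr0.
Qed.

Lemma continuous_dot t : continuous (dot t).
Proof.
apply: (@continuous_big R 'I_k +%R 0) => [|j _]; first exact: add_continuous.
move=> x; apply: (@continuousM _ _ (fun=> t j 0) (fun x : 'cV[R]_k => x j 0)).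
  exact: cst_continuous.
exact: coord_continuous.
Qed.

Lemma trigpoly_cst a : trigpoly (fun _ : 'cV[R]_k => a).
Proof.
rewrite (_ : (fun _ => a) = (fun x : 'cV[R]_k => a * cos (dot 0 x + 0))); first exact: trigpoly_cos.
by apply/funext => x; rewrite dot0l addr0 cos0 mulr1.
Qed.

Lemma trigpolyM F G : trigpoly F -> trigpoly G -> trigpoly (fun x => F x * G x).
Proof.
move=> TF TG; elim: TF => [a t c|F1 F2 _ IH1 _ IH2]; last first.
  rewrite (_ : (fun _ => _) = (fun x => F1 x * G x + F2 x * G x)).
    exact: trigpolyD.
  by apply/funext => x; rewrite mulrDl.
elim: TG => [b s e|G1 G2 _ IH1 _ IH2]; last first.
  rewrite (_ : (fun _ => _) = (fun x => a * cos (dot t x + c) * G1 x +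
       a * cos (dot t x + c) * G2 x)).
    exact: trigpolyD.
  by apply/funext => x; rewrite mulrDr.
rewrite (_ : (fun _ => _) =
   (fun x => a * b / 2 * cos (dot (t + s) x + (c + e)) +
             a * b / 2 * cos (dot (t - s) x + (c - e)))).
  by apply: trigpolyD; exact: trigpoly_cos.
apply/funext => x; rewrite !dotDl dotNl.
have -> : dot t x + dot s x + (c + e) = (dot t x + c) + (dot s x + e) by ring.
have -> : dot t x - dot s x + (c - e) = (dot t x + c) - (dot s x + e) by ring.
by rewrite (cosD (dot t x + c)) (cosB (dot t x + c)); field.
Qed.

Lemma trigpoly_sum (I : Type) (r : seq I) (P : pred I) (F : I -> 'cV[R]_k -> R) :
  (forall i, P i -> trigpoly (F i)) -> trigpoly (fun x => \sum_(i <- r | P i) F i x).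
Proof.
move=> TF; elim: r => [|i r IH].
  by under eq_fun do rewrite big_nil; exact: trigpoly_cst.
under eq_fun do rewrite big_cons.
by have [Pi|//] := boolP (P i); apply: trigpolyD => //; exact: TF.
Qed.

Lemma trigpoly_prod (I : Type) (r : seq I) (P : pred I) (F : I -> 'cV[R]_k -> R) :
  (forall i, P i -> trigpoly (F i)) -> trigpoly (fun x => \prod_(i <- r | P i) F i x).
Proof.
move=> TF; elim: r => [|i r IH].
  by under eq_fun do rewrite big_nil; exact: trigpoly_cst.
under eq_fun do rewrite big_cons.
by have [Pi|//] := boolP (P i); apply: trigpolyM => //; exact: TF.
Qed.

Lemma trigpolyX F n : trigpoly F -> trigpoly (fun x => F x ^+ n).
Proof.
move=> TF; elim: n => [|n IH].
  by under eq_fun do rewrite expr0; exact: trigpoly_cst.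
by under eq_fun do rewrite exprS; exact: trigpolyM.
Qed.

Lemma continuous_trigpoly F : trigpoly F -> continuous F.
Proof.
elim=> [a t c|F1 F2 _ c1 _ c2] x; last exact: (continuousD (c1 x) (c2 x)).
have ct := @continuousD _ _ _ (dot t) (fun=> c) x (@continuous_dot t x)
  (@cst_continuous _ _ c x).
have cc := @continuous_comp _ _ _ (fun x => dot t x + c) cos x ct
  (@continuous_cos R _).
exact: (@continuousM _ _ (fun=> a) _ x (@cst_continuous _ _ a x) cc).
Qed.

Lemma bounded_trigpoly F : trigpoly F -> exists M, forall x, `|F x| <= M.
Proof.
elim=> [a t c|F1 F2 _ [M1 b1] _ [M2 b2]]; last first.
  by exists (M1 + M2) => x; rewrite (le_trans (ler_normD _ _))// lerD.
by exists `|a| => x; rewrite normrM ler_piMr// cos_max.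
Qed.

End trigonometric_polynomials.

(** * Approximation by trigonometric polynomials on boxes *)

Definition box (R : realType) k (L : R) : set 'cV[R]_k :=
  [set x | forall j, `|x j 0| <= L].

Section trigonometric_approximation.
Context (R : realType).

Lemma compact_box k (L : R) : compact (@box R k L).
Proof.
have cr : compact [set v : 'rV[R]_k | forall j, `[(- L), L]%classic (v ord0 j)].
  by apply: (@rV_compact _ _ (fun=> `[(- L), L]%classic)) => _; exact: segment_compact.
rewrite (_ : box _ = trmx @` [set v : 'rV[R]_k | forall j, `[(- L), L]%classic (v ord0 j)]).
  apply: continuous_compact => //; apply: continuous_subspaceT => v.
  move=> A /nbhs_ballP[e e0 eA]; apply/nbhs_ballP; exists e => // w [_ vw].
  by apply: eA; split=> // i j; rewrite !mxE; exact: vw.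
apply/seteqP; split=> [x bx|_ [v /= bv <-] j].
  by exists x^T; rewrite ?trmxK// => j /=; rewrite in_itv/= mxE -ler_norml; exact: bx.
by rewrite mxE ler_norml; have := bv j; rewrite /= in_itv/= (_ : ord0 = 0).
Qed.

Lemma box_uniformly_continuous k (f : 'cV[R]_k -> R) (L e : R) :
  continuous f -> 0 < e ->
  exists2 eta : R, 0 < eta & forall x y : 'cV[R]_k, box L x -> box L y ->
    (forall j, `|y j 0 - x j 0| < eta) -> `|f y - f x| < e.
Proof.
move=> cf e0.
have /compact_near_coveringP cov := @compact_box k L.
pose P (d : R) (x : 'cV[R]_k) := forall y : 'cV[R]_k, (forall j, `|y j 0 - x j 0| < d) -> `|f y - f x| < e.
have : \forall d \near (0 : R)^'+, @box R k L `<=` P d.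
  apply: cov => x _.
  have e20 : 0 < e / 2 by rewrite divr_gt0.
  have /nbhs_ballP[r /= r0 xr] : \forall y \near x, `|f x - f y| < e / 2.
    by have /cvgrPdist_lt /(_ _ e20) := cf x.
  have r20 : 0 < r / 2 by rewrite divr_gt0.
  exists (ball x (r / 2), [set d : R | d < r / 2]) => /=.
    by split; [exact: nbhsx_ballx|exact: nbhs_right_lt].
  move=> [x' d] /= [[_ xx'] dr] y yx'.
  have h1 : `|f x - f x'| < e / 2.
    apply: xr; split=> // i j; apply: le_ball (xx' i j).
    by rewrite ler_pdivrMr// ler_peMr ?ler1n// ltW.
  have h2 : `|f x - f y| < e / 2.
    apply: xr; split=> // i j; rewrite (splitr r).
    apply: (ball_triangle (xx' i j)); rewrite /ball/= distrC ord1.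
    by rewrite (lt_trans (yx' i)).
  rewrite (_ : f y - f x' = (f x - f x') - (f x - f y)); last by ring.
  by rewrite (le_lt_trans (ler_normB _ _))// [e]splitr ltrD.
move=> /(nbhs_ballP 0)[d /= d0 dP].
exists (d / 2); first by rewrite divr_gt0.
move=> x y bx _; apply: (dP (d / 2)) => //=; last by rewrite divr_gt0.
rewrite /ball/= sub0r normrN ger0_norm ?divr_ge0 ?ltW//.
by rewrite ltr_pdivrMr// ltr_pMr ?ltr1n.
Qed.

(** On the half-period the cosine separates points uniformly. *)
Lemma cos_separated (a b : R) : 0 <= a -> a <= b -> b <= pi ->
  1 - cos (b - a) <= cos a - cos b.
Proof.
move=> a0 ab bpi; set h := (b - a) / 2; set m := (a + b) / 2.
have -> : b - a = h *+ 2 by rewrite /h mulr2n; field.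
have -> : a = m - h by rewrite /h /m; field.
have -> : b = m + h by rewrite /h /m; field.
rewrite cos_mulr2n cosB cosD cos2sin2 opprB.
rewrite [leRHS](_ : _ = 2 * (sin m * sin h)); last by ring.
rewrite [leLHS](_ : _ = 2 * (sin h * sin h)); last by ring.
have h0 : 0 <= h by rewrite /h; lra.
have hpi : h <= pi / 2 by rewrite /h; lra.
rewrite ler_pM2l// ler_wpM2r//.
  by apply: sin_ge0_pi; rewrite h0/= (le_trans hpi)//; have := pi_ge0 R; lra.
rewrite -!cosBpihalf -(cos_norm (m - _)) -(cosN (h - _)) opprB.
have mh : `|m - pi / 2| <= pi / 2 - h.
  by rewrite ler_norml /m /h; apply/andP; split; lra.
have pi0 := pi_ge0 R.
rewrite leNgt ltr_cos ?in_itv/= -?leNgt//.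
- by rewrite subr_ge0 hpi/=; lra.
- by rewrite normr_ge0/= (le_trans mh)//; lra.
Qed.

End trigonometric_approximation.

Section bernstein_in_cosines.
Context (R : realType) (L : R) (L0 : 0 < L).

(** [u] maps the interval from -L to L increasingly onto that from 0 to 1 and is
    affine in a cosine; [node N m] is the preimage of [m / N]. *)
Let theta (x : R) : R := pi * (x + L) / (2 * L).
Let u (x : R) : R := (1 - cos (theta x)) / 2.
Let node (N m : nat) : R := 2 * L / pi * acos (1 - 2 * m%:R / N%:R) - L.

Let Ln0 : L != 0. Proof. by rewrite gt_eqF. Qed.
Let pi0 : (pi : R) != 0. Proof. by rewrite gt_eqF// pi_gt0. Qed.

Let u01 x : 0 <= u x <= 1.
Proof.
rewrite /u; have := cos_le1 (theta x); have := cos_geN1 (theta x) => h1 h2.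
by apply/andP; split; lra.
Qed.

Let arg_bound N m : (0 < N)%N -> (m <= N)%N -> -1 <= (1 - 2 * m%:R / N%:R : R) <= 1.
Proof.
move=> N0 mN; have h : m%:R / N%:R <= 1 :> R.
  by rewrite ler_pdivrMr ?ltr0n// mul1r ler_nat.
have h0 : 0 <= m%:R / N%:R :> R by rewrite divr_ge0.
by apply/andP; split; lra.
Qed.

Let theta_node N m : theta (node N m) = acos (1 - 2 * m%:R / N%:R).
Proof.
rewrite /theta /node; move: (acos _) (pi : R) pi0 => z c c0.
by field; rewrite Ln0 c0.
Qed.

Let theta_bound x : `|x| <= L -> 0 <= theta x <= pi.
Proof.
rewrite ler_norml => /andP[xL Lx]; rewrite /theta.
have xL0 : 0 <= x + L by lra.
have xL2 : x + L <= 2 * L by lra.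
have pi00 := pi_ge0 R.
rewrite divr_ge0 ?mulr_ge0 ?(ltW L0)//= ler_pdivrMr ?mulr_gt0//.
by rewrite ler_wpM2l.
Qed.

Let node_box N m : (0 < N)%N -> (m <= N)%N -> `|node N m| <= L.
Proof.
move=> N0 mN; have h := arg_bound N0 mN.
have a0 := acos_ge0 h; have api := acos_lepi h.
rewrite /node ler_norml; apply/andP; split.
  by rewrite lerBrDr addNr mulr_ge0// divr_ge0 ?pi_ge0// mulr_ge0// ltW.
rewrite lerBlDr mulrAC ler_pdivrMr ?pi_gt0//.
have -> : L + L = 2 * L by ring.
by rewrite ler_wpM2l// mulr_ge0// ltW.
Qed.

Let node_separated N m (x eta : R) : (0 < N)%N -> (m <= N)%N -> `|x| <= L ->
  0 < eta -> eta <= 2 * L -> eta <= `|node N m - x| ->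
  (1 - cos (pi * eta / (2 * L))) / 2 <= `|m%:R / N%:R - u x|.
Proof.
move=> N0 mN xL eta0 eta2L etax; have h := arg_bound N0 mN.
have NN : N%:R != 0 :> R by rewrite pnatr_eq0 -lt0n.
set a := theta x; set b := theta (node N m).
have cb : cos b = 1 - 2 * m%:R / N%:R.
  by rewrite /b theta_node acosK// in_itv.
have -> : m%:R / N%:R - u x = (cos a - cos b) / 2.
  by rewrite cb /u -/a; move: (N%:R : R) NN => c c0; field.
rewrite normrM [X in _ <= _ * X]ger0_norm ?invr_ge0// ler_pM2r ?invr_gt0//.
have /andP[a0 api] := theta_bound xL.
have /andP[b0 bpi] := theta_bound (node_box N0 mN).
have ab : `|b - a| = pi * `|node N m - x| / (2 * L).
  rewrite /a /b /theta.
  rewrite (_ : _ - _ = pi / (2 * L) * (node N m - x)); last by move: (pi : R) => c; field.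
  rewrite normrM ger0_norm; first by ring.
  by rewrite divr_ge0 ?mulr_ge0 ?pi_ge0 ?ltW.
apply: (@le_trans _ _ (1 - cos `|b - a|)).
  rewrite lerB// ab leNgt ltr_cos ?in_itv/= -?leNgt//.
  - by rewrite ler_pM2r ?invr_gt0 ?mulr_gt0// ler_pM2l ?pi_gt0.
  - rewrite -ab normr_ge0/= ler_norml lerBrDr lerBlDr; apply/andP; split.
      by rewrite (le_trans _ b0)// addrC subr_le0.
    by rewrite ler_wpDr.
  - apply/andP; split; first by rewrite divr_ge0 ?mulr_ge0 ?pi_ge0 ?(ltW L0) ?(ltW eta0).
    by rewrite ler_pdivrMr ?mulr_gt0// ler_wpM2l// pi_ge0.
have [lab|lba] := leP a b.
  rewrite (@ger0_norm _ (b - a)) ?subr_ge0//.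
  exact: (le_trans (cos_separated a0 lab bpi) (ler_norm _)).
rewrite (@ler0_norm _ (b - a)) ?subr_le0 ?(ltW lba)// opprB.
rewrite distrC.
exact: (le_trans (cos_separated b0 (ltW lba) api) (ler_norm _)).
Qed.

Let trigpoly_u k (j : 'I_k) : trigpoly (fun x : 'cV[R]_k => u (x j 0)).
Proof.
pose t : 'cV[R]_k := (pi / (2 * L)) *: delta_mx j 0.
rewrite (_ : (fun _ => _) = (fun x => 2^-1 + - 2^-1 * cos (dot t x + pi / 2))).
  by apply: trigpolyD; [exact: trigpoly_cst|exact: trigpoly_cos].
apply/funext => x; rewrite /u dot_delta /theta.
rewrite [X in cos X](_ : _ = pi / (2 * L) * x j 0 + pi / 2); last by move: (pi : R) => c; field.
by field.
Qed.

Let trigpoly_bern k (j : 'I_k) N m :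
  trigpoly (fun x : 'cV[R]_k => bern N m (u (x j 0))).
Proof.
apply: trigpolyM.
  by apply: trigpolyM; [exact: trigpoly_cst|apply: trigpolyX; exact: trigpoly_u].
apply: trigpolyX.
rewrite (_ : (fun _ => _) = (fun x : 'cV[R]_k => 1 + -1 * u (x j 0))).
  by apply: trigpolyD; [|apply: trigpolyM; [|exact: trigpoly_u]]; exact: trigpoly_cst.
by apply/funext => x; ring.
Qed.

(** The joint law of [k] independent binomial variables; the approximation
    below is an expectation under it. *)
Let weight k N (x : 'cV[R]_k) (m : {ffun 'I_k -> 'I_N.+1}) : R :=
  \prod_j bern N (m j) (u (x j 0)).

Let weight_ge0 k N (x : 'cV[R]_k) m : 0 <= @weight k N x m.
Proof. by rewrite prodr_ge0// => j _; exact: bern_ge0. Qed.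

Let weight_sum k N (x : 'cV[R]_k) : \sum_m @weight k N x m = 1.
Proof.
rewrite -(bigA_distr_bigA (fun j (a : 'I_N.+1) => bern N a (u (x j 0)))).
by rewrite big1// => j _; exact: bern_sum.
Qed.

Let weight_variance k N (x : 'cV[R]_k) j : (0 < N)%N ->
  \sum_m @weight k N x m * ((m j)%:R / N%:R - u (x j 0)) ^+ 2 <= N%:R^-1.
Proof.
move=> N0.
pose g i (a : 'I_N.+1) := bern N a (u (x i 0)) *
  (if i == j then (a%:R / N%:R - u (x j 0)) ^+ 2 else 1).
have -> : \sum_m @weight k N x m * ((m j)%:R / N%:R - u (x j 0)) ^+ 2 =
    \sum_(m : {ffun 'I_k -> 'I_N.+1}) \prod_i g i (m i).
  apply: eq_bigr => m _; rewrite /g big_split/=; congr (_ * _).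
  by rewrite -big_mkcond/= big_pred1_eq.
rewrite -(bigA_distr_bigA g) (bigD1 j)//= [X in _ * X]big1 ?mulr1 => [|i ij].
  rewrite /g; under eq_bigr do rewrite eqxx.
  rewrite bern_variance//; have /andP[u0 u1] := u01 (x j 0).
  rewrite ler_piMl ?invr_ge0// mulr_ile1// ?subr_ge0//.
  by rewrite lerBlDr lerDl.
rewrite /g (negbTE ij); under eq_bigr do rewrite mulr1.
exact: bern_sum.
Qed.

(** Bernstein's probabilistic proof of the Weierstrass theorem, run in the
    variables [u (x j 0)]. A polynomial in these is a trigonometric polynomial,
    and as an average of values of [f] it keeps the bound [M] off the box. *)
Lemma trigpoly_approximation k (f : 'cV[R]_k -> R) (M e : R) :
  continuous f -> (forall x, `|f x| <= M) -> 0 < e ->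
  exists T, [/\ trigpoly T, forall x, `|T x| <= M &
    forall x, box L x -> `|T x - f x| <= e].
Proof.
move=> cf fM e0.
have M0 : 0 <= M by rewrite (le_trans _ (fM 0)).
have e20 : 0 < e / 2 by rewrite divr_gt0.
have [eta' eta'0 fe] := @box_uniformly_continuous _ k f L (e / 2) cf e20.
pose eta := Num.min eta' (2 * L).
have eta0 : 0 < eta by rewrite lt_min eta'0/= mulr_gt0.
have eta2L : eta <= 2 * L by rewrite ge_min lexx orbT.
pose delta := (1 - cos (pi * eta / (2 * L))) / 2.
have delta0 : 0 < delta.
  rewrite divr_gt0// subr_gt0 -[ltRHS]cos0 ltr_cos ?in_itv/= ?lexx ?pi_ge0//.
    by rewrite divr_gt0 ?mulr_gt0 ?pi_gt0.
  apply/andP; split; first by rewrite divr_ge0 ?mulr_ge0 ?pi_ge0 ?(ltW L0) ?(ltW eta0).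
  by rewrite ler_pdivrMr ?mulr_gt0// ler_wpM2l// pi_ge0.
pose C := 2 * M * (k%:R / delta ^+ 2).
have C0 : 0 <= C by rewrite !mulr_ge0 ?invr_ge0 ?sqr_ge0.
have [N N0 CN] : exists2 N, (0 < N)%N & C / N%:R <= e / 2.
  have [N CN] : exists N, C / (e / 2) < N%:R.
    exists (Num.truncn (C / (e / 2))).+1.
    by rewrite truncnS_gt.
  have N0 : (0 < N)%N.
    by rewrite -(ltr_nat R) (le_lt_trans _ CN)// divr_ge0// ltW.
  exists N => //; rewrite ler_pdivrMr ?ltr0n// mulrC -ler_pdivrMr//.
  exact: ltW.
pose y (m : {ffun 'I_k -> 'I_N.+1}) : 'cV[R]_k := \col_j node N (m j).
have by_ m : box L (y m).
  by move=> j; rewrite mxE node_box// -ltnS.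
pose T x := \sum_m f (y m) * weight x m.
exists T; split.
- apply: trigpoly_sum => m _; apply: trigpolyM; first exact: trigpoly_cst.
  by apply: trigpoly_prod => j _; exact: trigpoly_bern.
- move=> x; rewrite (le_trans (ler_norm_sum _ _ _))//.
  rewrite -[leRHS]mulr1 -(weight_sum N x) mulr_sumr ler_sum// => m _.
  by rewrite normrM [X in _ * X]ger0_norm// ler_wpM2r.
move=> x bx.
have -> : T x - f x = \sum_m (f (y m) - f x) * weight x m.
  under [RHS]eq_bigr do rewrite mulrBl.
  by rewrite sumrB -mulr_sumr weight_sum mulr1.
rewrite (le_trans (ler_norm_sum _ _ _))//.
pose q (m : {ffun 'I_k -> 'I_N.+1}) := \sum_j ((m j)%:R / N%:R - u (x j 0)) ^+ 2.
(* Chebyshev: off the eta-neighbourhood of x some coordinate of m / N is at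
   distance at least delta from u. *)
have bound m : `|f (y m) - f x| <= e / 2 + 2 * M / delta ^+ 2 * q m.
  have q0 : 0 <= 2 * M / delta ^+ 2 * q m.
    rewrite mulr_ge0 ?divr_ge0 ?mulr_ge0 ?sqr_ge0//.
    by rewrite sumr_ge0// => j _; exact: sqr_ge0.
  have [near_x|] := pselect (forall j, `|y m j 0 - x j 0| < eta).
    rewrite ler_wpDr// ltW// fe// => j.
    by rewrite (lt_le_trans (near_x j))// ge_min lexx.
  move=> /existsNP[j /negP]; rewrite -leNgt => far.
  rewrite ler_wpDl ?(ltW e20)//.
  apply: (@le_trans _ _ (2 * M)).
    by rewrite (le_trans (ler_normB _ _))// mulr2n mulrDl mul1r lerD.
  rewrite -mulrA ler_peMr ?mulr_ge0// mulrC ler_pdivlMr ?exprn_gt0// mul1r.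
  rewrite /q (bigD1 j)//= ler_wpDr//.
    by rewrite sumr_ge0// => i _; exact: sqr_ge0.
  have sep : delta <= `|(m j)%:R / N%:R - u (x j 0)|.
    have mN : (m j <= N)%N by rewrite -ltnS.
    have {}far : eta <= `|node N (m j) - x j 0| by move: far; rewrite mxE.
    exact: (node_separated N0 mN (bx j) eta0 eta2L far).
  rewrite -[leRHS]real_normK ?num_real// lerXn2r// nnegrE//.
  exact: ltW.
apply: (@le_trans _ _ (\sum_m (e / 2 + 2 * M / delta ^+ 2 * q m) * @weight k N x m)).
  by apply: ler_sum => m _; rewrite normrM [X in _ * X]ger0_norm// ler_wpM2r.
under eq_bigr do rewrite mulrDl.
rewrite big_split/= -mulr_sumr weight_sum mulr1 [leRHS]splitr lerD2l.
apply: le_trans CN.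
under eq_bigr do rewrite -mulrA.
rewrite -mulr_sumr.
have -> : C / N%:R = 2 * M / delta ^+ 2 * (k%:R / N%:R) by rewrite /C; ring.
rewrite ler_wpM2l ?divr_ge0 ?mulr_ge0 ?sqr_ge0//.
have -> : \sum_m q m * weight x m =
    \sum_j \sum_m @weight k N x m * ((m j)%:R / N%:R - u (x j 0)) ^+ 2.
  rewrite exchange_big; apply: eq_bigr => m _; rewrite /q mulr_suml.
  by apply: eq_bigr => j _; rewrite mulrC.
apply: (@le_trans _ _ (\sum_(j < k) N%:R^-1)).
  by apply: ler_sum => j _; exact: weight_variance.
by rewrite sumr_const card_ord mulr_natl.
Qed.

End bernstein_in_cosines.

(** * Weak convergence from trigonometric integrals *)

Lemma integrable_bounded d (T : measurableType d) (R : realType)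
    (P : {finite_measure set T -> \bar R}) (f : T -> R) (M : R) :
  measurable_fun setT f -> (forall x, `|f x| <= M) ->
  P.-integrable setT (EFin \o f).
Proof.
move=> mf fM; apply: measurable_bounded_integrable => //.
  by rewrite -ge0_fin_numE// fin_num_measure.
by exists M; split=> [|N MN x _ /=]; rewrite ?num_real// (le_trans (fM x))// ltW.
Qed.

Section weak_convergence.
Context (R : realType) (k : nat).
Implicit Type mu : probability 'cV[R]_k R.

Lemma integrable_continuous mu (f : 'cV[R]_k -> R) M :
  continuous f -> (forall x, `|f x| <= M) -> mu.-integrable setT (EFin \o f).
Proof. by move=> cf; apply: integrable_bounded; exact: continuous_measurable_mxR. Qed.

Lemma measurable_box L : measurable (@box R k L).
Proof.
rewrite (_ : box L = \bigcap_(j in [set: 'I_k]) (fun x : 'cV[R]_k => `|x j 0|) @^-1` `]-oo, L]); last first.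
  apply/seteqP; split=> x /= bx j; first by move=> _ /=; rewrite in_itv/=; exact: bx.
  by have := bx j I; rewrite /= in_itv.
apply: fin_bigcap_measurable => // j _; rewrite -[X in measurable X]setTI.
have m : measurable_fun setT (fun x : 'cV[R]_k => `|x j 0|).
  apply: measurableT_comp => //; exact: measurable_fun_coord.
exact: m.
Qed.

Lemma Rintegral_box_approximation mu (f T : 'cV[R]_k -> R) (L M e : R) :
  continuous f -> continuous T -> (forall x, `|f x| <= M) ->
  (forall x, `|T x| <= M) -> 0 <= e -> (forall x, box L x -> `|T x - f x| <= e) ->
  `|\int[mu]_x T x - \int[mu]_x f x| <= e + 2 * M * fine (mu (~` box L)).
Proof.
move=> cf cT fM TM e0 Tf.
have mB : measurable (~` @box R k L) by apply: measurableC; exact: measurable_box.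
have M0 : 0 <= M by rewrite (le_trans _ (fM 0)).
have iT := integrable_continuous mu cT TM.
have i_f := integrable_continuous mu cf fM.
rewrite -RintegralB//.
have TfM x : `|T x - f x| <= 2 * M.
  by rewrite (le_trans (ler_normB _ _))// mulrDl mul1r lerD.
have cTf : continuous (fun x => T x - f x).
  by move=> x; exact: (@continuousB _ _ _ T f x (cT x) (cf x)).
have iTf := integrable_continuous mu cTf TfM.
rewrite (le_trans (le_normr_Rintegral _ iTf))//.
have iB : mu.-integrable setT (EFin \o (\1_(~` @box R k L) : _ -> R)).
  apply: (@integrable_bounded _ _ _ _ _ 1); first exact: measurable_indic.
  by move=> x; rewrite indicE; case: (_ \in _); rewrite !(normr1, normr0).
have iM : mu.-integrable setT (EFin \o (fun x => 2 * M * \1_(~` @box R k L) x)).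
  by have := integrableZl measurableT (2 * M) iB.
have ie : mu.-integrable setT (EFin \o (fun=> e)).
  by apply: (@integrable_bounded _ _ _ _ _ e) => // x; rewrite ger0_norm.
apply: (@le_trans _ _ (\int[mu]_x (e + 2 * M * \1_(~` @box R k L) x))).
  apply: le_Rintegral => //.
  - exact: integrable_norm.
  - by have := integrableD measurableT ie iM.
  - move=> x _; rewrite indicE; have [bx|nbx] := pselect (box L x).
      by rewrite memNset ?mulr0 ?addr0; [exact: Tf|exact].
    by rewrite mem_set// mulr1 ler_wpDl.
rewrite RintegralD// RintegralZl// Rintegral_cst//.
rewrite [X in e * X](_ : _ = 1) ?mulr1; last exact: (congr1 fine (probability_setT mu)).
rewrite lerD2l ler_wpM2l ?mulr_ge0//.
by rewrite /Rintegral integral_indic// setIT.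
Qed.

(** A form of Levy's theorem. Tightness confines the mass to a box up to a
    small error, and on the box every bounded continuous function is uniformly
    close to a trigonometric polynomial with the same global bound. *)
Lemma cvg_from_trigonometric_integrals (mu_ : nat -> probability 'cV[R]_k R) mu :
  (forall t c, \int[mu_ n]_x cos (dot t x + c) @[n --> \oo] -->
               \int[mu]_x cos (dot t x + c)) ->
  (forall e : R, 0 < e -> exists L : R, [/\ 0 < L,
     \forall n \near \oo, (mu_ n (~` box L) <= e%:E)%E &
     (mu (~` box L) <= e%:E)%E]) ->
  forall f : 'cV[R]_k -> R, continuous f -> bounded_fun f ->
    \int[mu_ n]_x f x @[n --> \oo] --> \int[mu]_x f x.
Proof.
move=> cvg_cos tight f cf [M0 [_ bM]].
pose M := `|M0| + 1.
have M_gt0 : 0 < M by rewrite ltr_wpDl.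
have fM x : `|f x| <= M by apply: bM => //; rewrite /M ltr_pwDr// ler_norm.
have cvg_trig T : trigpoly T -> \int[mu_ n]_x T x @[n --> \oo] --> \int[mu]_x T x.
  elim=> [a t c|F G tF cF tG cG].
    have cc : continuous (fun x : 'cV[R]_k => cos (dot t x + c)).
      have := continuous_trigpoly (trigpoly_cos 1 t c).
      by under eq_fun do rewrite mul1r.
    have c1 (x : 'cV[R]_k) : `|cos (dot t x + c)| <= 1 by exact: cos_max.
    rewrite RintegralZl//; last exact: integrable_continuous cc c1.
    under eq_fun do rewrite (RintegralZl _ measurableT (integrable_continuous _ cc c1)).
    exact: cvgMl_tmp.
  have [MF bF] := bounded_trigpoly tF; have [MG bG] := bounded_trigpoly tG.
  have iF (nu : probability 'cV[R]_k R) : nu.-integrable setT (EFin \o F).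
    exact: integrable_continuous (continuous_trigpoly tF) bF.
  have iG (nu : probability 'cV[R]_k R) : nu.-integrable setT (EFin \o G).
    exact: integrable_continuous (continuous_trigpoly tG) bG.
  rewrite (RintegralD measurableT (iF mu) (iG mu)).
  under eq_cvg do rewrite (RintegralD measurableT (iF _) (iG _)).
  exact: cvgD.
apply/cvgrPdist_le => e e0.
pose e1 := e / 5; have e10 : 0 < e1 by rewrite divr_gt0.
have eM0 : 0 < e1 / (2 * M) by rewrite divr_gt0// mulr_gt0.
have [L [L0 tL tmu]] := tight _ eM0.
have [T [tT TM Tf]] := trigpoly_approximation L0 cf fM e10.
have approx (nu : probability 'cV[R]_k R) : (nu (~` box L) <= (e1 / (2 * M))%:E)%E ->
    `|\int[nu]_x T x - \int[nu]_x f x| <= 2 * e1.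
  move=> nuL; have := Rintegral_box_approximation nu cf (continuous_trigpoly tT)
    fM TM (ltW e10) Tf.
  move=> /le_trans; apply.
  have -> : 2 * e1 = e1 + e1 by ring.
  rewrite lerD2l mulrC -ler_pdivlMr ?mulr_gt0//.
  rewrite -lee_fin fineK// fin_num_measure//.
  by apply: measurableC; exact: measurable_box.
have := cvg_trig T tT => /cvgrPdist_le /(_ _ e10) cT.
near=> n.
have h1 : (mu_ n (~` box L) <= (e1 / (2 * M))%:E)%E by near: n.
have h2 : `|\int[mu]_x T x - \int[mu_ n]_x T x| <= e1 by near: n.
have := approx _ h1; have := approx _ tmu.
move: h2; rewrite !ler_distl /e1 => /andP[a1 a2] /andP[b1 b2] /andP[c1 c2].
by apply/andP; split; lra.
Unshelve. all: by end_near. Qed.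

End weak_convergence.

(** * Moments of the entries of a uniform Stiefel matrix *)

Section reflection.
Context (R : realType) (n : nat) (j l : 'I_n).
Let c : R := Num.sqrt 2 / 2.
Let w : 'cV[R]_n := delta_mx j 0 - (1 + 2 * c) *: delta_mx l 0.

(** The Householder reflection that acts on the coordinates [j] and [l] as the
    Hadamard matrix, sending (a, b) to ((a + b) / sqrt 2, (a - b) / sqrt 2). *)
Definition hadamard_reflection : 'M[R]_n := 1%:M - (1 - c) *: (w *m w^T).

Lemma sqr_half_sqrt2 : (Num.sqrt 2 / 2 : R) ^+ 2 = 2^-1.
Proof. by rewrite exprMn sqr_sqrtr//; field. Qed.

Hypothesis jl : j != l.

Let wj : w j 0 = 1.
Proof. by rewrite !mxE !eqxx (negbTE jl) mulr0 subr0. Qed.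

Let wl : w l 0 = - (1 + 2 * c).
Proof. by rewrite !mxE !eqxx eq_sym (negbTE jl) mulr1 sub0r. Qed.

Let w_other x : x != j -> x != l -> w x 0 = 0.
Proof.
by move=> xj xl; rewrite !mxE (negbTE xj) (negbTE xl) !(andbF, mulr0) subr0.
Qed.

Let norm_w : w^T *m w = (4 + 4 * c)%:M.
Proof.
apply/matrixP => p q; rewrite !ord1.
have -> : (w^T *m w) 0 0 = \sum_x w x 0 * w x 0.
  by rewrite mxE; apply: eq_bigr => x _; rewrite [w^T _ _]mxE.
rewrite [RHS]mxE eqxx mulr1n (bigD1 j)//= (bigD1 l) 1?eq_sym//=.
rewrite big1 => [|x /andP[xj xl]]; last by rewrite w_other// mulr0.
have := sqr_half_sqrt2; rewrite -/c => c2.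
rewrite wj wl addr0.
transitivity (2 + 4 * c + 4 * c ^+ 2); first by move: (c) => z; ring.
by rewrite c2; field.
Qed.

Lemma hadamard_reflection_orthogonal :
  hadamard_reflection *m hadamard_reflection^T = 1%:M.
Proof.
have Wsym : hadamard_reflection^T = hadamard_reflection.
  by rewrite /hadamard_reflection linearB/= linearZ/= trmx1 trmx_mul trmxK.
rewrite Wsym /hadamard_reflection mulmxBl mul1mx mulmxBr mulmx1.
rewrite -!scalemxAr -!scalemxAl -mulmxA (mulmxA w^T) norm_w mul_scalar_mx.
rewrite -scalemxAr !scalerA; set A := w *m w^T.
have := sqr_half_sqrt2; rewrite -/c => c2.
have -> : (1 - c) * (1 - c) * (4 + 4 * c) = 2 * (1 - c).
  transitivity ((1 - c) * (4 - 4 * c ^+ 2)); first by move: (c) => z; ring.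
  by rewrite c2; field.
set B := (1 - c) *: A.
have -> : (2 * (1 - c)) *: A = B + B by rewrite -scalerA scaler_nat mulr2n.
by rewrite opprB addrK subrK.
Qed.

Let row_w k (V : 'M[R]_(k, n)) i : (V *m w) i 0 = V i j - (1 + 2 * c) * V i l.
Proof.
rewrite mxE (bigD1 j)//= (bigD1 l) 1?eq_sym//= big1 => [|x /andP[xj xl]].
  by rewrite wj wl; ring.
by rewrite w_other// mulr0.
Qed.

Let mul_reflection k (V : 'M[R]_(k, n)) i x :
  (V *m hadamard_reflection) i x =
  V i x - (1 - c) * ((V i j - (1 + 2 * c) * V i l) * w x 0).
Proof.
rewrite /hadamard_reflection mulmxBr mulmx1 -scalemxAr mulmxA.
rewrite 2!mxE; congr (_ - _); rewrite mxE; congr (_ * _).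
by rewrite mxE big_ord1 row_w mxE.
Qed.

Lemma mul_hadamard_reflection_l k (V : 'M[R]_(k, n)) i :
  (V *m hadamard_reflection) i j = c * (V i j + V i l).
Proof.
rewrite mul_reflection wj; have := sqr_half_sqrt2; rewrite -/c => c2.
rewrite (_ : _ - _ = c * V i j + (1 + c - 2 * c ^+ 2) * V i l); last by ring.
by rewrite c2; field.
Qed.

Lemma mul_hadamard_reflection_r k (V : 'M[R]_(k, n)) i :
  (V *m hadamard_reflection) i l = c * (V i j - V i l).
Proof.
rewrite mul_reflection wl; have := sqr_half_sqrt2; rewrite -/c => c2.
rewrite (_ : _ - _ = (1 + c - 2 * c ^+ 2) * V i j +
  c * (4 * c ^+ 2 - 3) * V i l); last by ring.
by rewrite c2; field.
Qed.

End reflection.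

Lemma measurable_stiefel (R : realType) k n : measurable (@stiefel R k n).
Proof.
rewrite (_ : @stiefel R k n = \bigcap_(i in [set: 'I_k]) \bigcap_(j in [set: 'I_k])
    (fun V : 'M[R]_(k, n) => \sum_x V i x * V j x) @^-1` [set (i == j)%:R]).
  apply: fin_bigcap_measurable => // i _; apply: fin_bigcap_measurable => // j _.
  rewrite -[X in measurable X]setTI.
  have m : measurable_fun setT (fun V : 'M[R]_(k, n) => \sum_x V i x * V j x).
    apply: measurable_sum => x; apply: measurable_funM; exact: measurable_fun_coord.
  exact: m.
have E (V : 'M[R]_(k, n)) i j : (V *m V^T) i j = \sum_x V i x * V j x.
  by rewrite mxE; apply: eq_bigr => x _; rewrite mxE.
apply/seteqP; split=> V /= HV.
  by move=> i _ j _ /=; rewrite -E HV mxE.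
by apply/matrixP => i j; rewrite E (HV i I j I) mxE.
Qed.

Section stiefel_moments.
Context (R : realType) (k n : nat) (mu : probability 'M[R]_(k, n) R).
Hypothesis mu_uniform : stiefel_uniform mu.
Variable i : 'I_k.

Let D := @stiefel R k n.
Let mD : measurable D := @measurable_stiefel R k n.

Let row_norm V : D V -> \sum_j V i j ^+ 2 = 1.
Proof.
move=> DV; have : (V *m V^T) i i = 1 by rewrite DV mxE eqxx.
by rewrite mxE => <-; apply: eq_bigr => j _; rewrite mxE expr2.
Qed.

Let entry_le1 V j : D V -> `|V i j| <= 1.
Proof.
move=> DV; have := row_norm DV; rewrite (bigD1 j)//= => H.
rewrite -(@expr_le1 _ 2)// real_normK ?num_real// -H lerDl.
by rewrite sumr_ge0// => x _; exact: sqr_ge0.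
Qed.

(** A class of functions integrable on the Stiefel manifold that is stable under
    sums and products. *)
Let good (f : 'M[R]_(k, n) -> R) :=
  measurable_fun setT f /\ exists M, forall V, D V -> `|f V| <= M.

Let good_entry j : good (fun V => V i j).
Proof. by split; [exact: measurable_fun_coord|exists 1 => V; exact: entry_le1]. Qed.

Let goodD f g : good f -> good g -> good (fun V => f V + g V).
Proof.
move=> [mf [M fM]] [mg [N gN]]; split; first exact: measurable_funD.
by exists (M + N) => V DV; rewrite (le_trans (ler_normD _ _))// lerD ?fM ?gN.
Qed.

Let goodM f g : good f -> good g -> good (fun V => f V * g V).
Proof.
move=> [mf [M fM]] [mg [N gN]]; split; first exact: measurable_funM.
by exists (M * N) => V DV; rewrite normrM ler_pM ?fM ?gN.
Qed.

Let good_cst c : good (fun=> c).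
Proof. by split=> //; exists `|c|. Qed.

Let goodZ c f : good f -> good (fun V => c * f V).
Proof. exact: goodM (good_cst c). Qed.

Let goodX f m : good f -> good (fun V => f V ^+ m).
Proof.
move=> gf; elim: m => [|m IH]; first exact: good_cst.
by under eq_fun do rewrite exprS; exact: goodM.
Qed.

Let good_sum (F : 'I_n -> 'M[R]_(k, n) -> R) :
  (forall j, good (F j)) -> good (fun V => \sum_j F j V).
Proof.
move=> gF; elim: (index_enum _) => [|j s IH].
  by under eq_fun do rewrite big_nil; exact: good_cst.
by under eq_fun do rewrite big_cons; exact: goodD.
Qed.

Let good_integrable f : good f -> mu.-integrable D (EFin \o f).
Proof.
move=> [mf [M fM]]; apply: measurable_bounded_integrable => //.
- by rewrite -ge0_fin_numE// fin_num_measure.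
- exact: measurable_funTS.
- by exists M; split=> [|N MN x Dx /=]; rewrite ?num_real// (le_trans (fM x Dx))// ltW.
Qed.

Let E (f : 'M[R]_(k, n) -> R) := \int[mu]_(V in D) f V.

Let E_ext f g : (forall V, D V -> f V = g V) -> E f = E g.
Proof. by move=> fg; apply: eq_Rintegral => V /set_mem; exact: fg. Qed.

Let ED f g : good f -> good g -> E (fun V => f V + g V) = E f + E g.
Proof. by move=> gf gg; apply: RintegralD => //; exact: good_integrable. Qed.

Let EZ c f : good f -> E (fun V => c * f V) = c * E f.
Proof. by move=> gf; apply: RintegralZl => //; exact: good_integrable. Qed.

Let E_cst c : E (fun=> c) = c.
Proof.
rewrite /E Rintegral_cst// (_ : fine _ = 1) ?mulr1//.
exact: (congr1 fine mu_uniform.1).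
Qed.

Let E_sum (F : 'I_n -> 'M[R]_(k, n) -> R) : (forall j, good (F j)) ->
  E (fun V => \sum_j F j V) = \sum_j E (F j).
Proof.
move=> gF.
suff : good (fun V => \sum_j F j V) /\ E (fun V => \sum_j F j V) = \sum_j E (F j).
  by case.
elim: (index_enum _) => [|j s [IH1 IH2]].
  under eq_fun do rewrite big_nil; rewrite big_nil; split; first exact: good_cst.
  exact: E_cst.
under eq_fun do rewrite big_cons; rewrite big_cons; split; first exact: goodD.
by rewrite ED// IH2.
Qed.

Let E_reflection j l f : j != l -> good f ->
  E (fun V => f (V *m hadamard_reflection R j l)) = E f.
Proof.
move=> jl gf; set W := hadamard_reflection R j l.
have mW : measurable_fun setT (fun V : 'M[R]_(k, n) => V *m W).
  apply/measurable_fun_mxP => x y; under eq_fun do rewrite mxE.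
  apply: measurable_sum => z; apply: measurable_funM => //.
  exact: measurable_fun_coord.
have WW : W *m W^T = 1%:M := hadamard_reflection_orthogonal R jl.
have preD : (fun V : 'M[R]_(k, n) => V *m W) @^-1` D = D.
  apply/seteqP; split=> V /=; rewrite /D /stiefel/= trmx_mul mulmxA;
  by rewrite -(mulmxA V) WW mulmx1.
have [mf _] := gf.
have mD' : mu.-integrable ((fun V : 'M[R]_(k, n) => V *m W) @^-1` D)
    ((EFin \o f) \o (fun V => V *m W)).
  rewrite preD; apply: (@good_integrable (fun V => f (V *m W))); split.
    exact: measurableT_comp.
  have [_ [M fM]] := gf; exists M => V DV; apply: fM.
  by move: DV; rewrite -{1}preD.
have := integral_pushforward mW _ mD' mD; rewrite preD => H.
rewrite /E /Rintegral; congr fine.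
rewrite -[LHS]H; last exact/measurable_EFinP.
apply: eq_measure_integral => A mA _.
have := mu_uniform.2 1%:M W; rewrite /orthogonal_mx/= trmx1 mulmx1 => /(_ erefl WW A mA) <-.
by rewrite /pushforward; congr (mu _); apply/seteqP; split=> V /=; rewrite mul1mx.
Qed.

Let S4 := \sum_j E (fun V => V i j ^+ 4).
Let S6 := \sum_j E (fun V => V i j ^+ 6).

Let goodXM j l a b : good (fun V => V i j ^+ a * V i l ^+ b).
Proof. by apply: goodM; apply: goodX. Qed.

Let fourth_pair j l : j != l ->
  E (fun V => V i j ^+ 4) + E (fun V => V i l ^+ 4) =
  6 * E (fun V => V i j ^+ 2 * V i l ^+ 2).
Proof.
move=> jl; have g4 x := goodX 4 (good_entry x).
have := E_reflection jl (goodD (g4 j) (g4 l)).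
rewrite (E_ext (g := fun V => 2^-1 * (V i j ^+ 4 + V i l ^+ 4) + 3 * (V i j ^+ 2 * V i l ^+ 2))); last first.
  move=> V _; rewrite mul_hadamard_reflection_l// mul_hadamard_reflection_r//.
  have := @sqr_half_sqrt2 R; move: (Num.sqrt 2 / 2) => c c2.
  transitivity ((c ^+ 2) ^+ 2 * ((V i j + V i l) ^+ 4 + (V i j - V i l) ^+ 4)); first by ring.
  by rewrite c2; field.
have g44 := goodD (g4 j) (g4 l).
have g22 := goodXM j l 2 2.
rewrite (ED (goodZ 2^-1 g44) (goodZ 3 g22)) (EZ 2^-1 g44) (EZ 3 g22).
by rewrite (ED (g4 j) (g4 l)); lra.
Qed.

Let sixth_pair j l : j != l ->
  E (fun V => V i j ^+ 6) + E (fun V => V i l ^+ 6) =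
  5 * (E (fun V => V i j ^+ 4 * V i l ^+ 2) + E (fun V => V i l ^+ 4 * V i j ^+ 2)).
Proof.
move=> jl; have g6 x := goodX 6 (good_entry x).
have := E_reflection jl (goodD (g6 j) (g6 l)).
rewrite (E_ext (g := fun V => 4^-1 * (V i j ^+ 6 + V i l ^+ 6) +
  (15 / 4) * (V i j ^+ 4 * V i l ^+ 2 + V i l ^+ 4 * V i j ^+ 2))); last first.
  move=> V _; rewrite mul_hadamard_reflection_l// mul_hadamard_reflection_r//.
  have := @sqr_half_sqrt2 R; move: (Num.sqrt 2 / 2) => c c2.
  transitivity ((c ^+ 2) ^+ 3 * ((V i j + V i l) ^+ 6 + (V i j - V i l) ^+ 6)); first by ring.
  by rewrite c2; field.
have g66 := goodD (g6 j) (g6 l).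
have g42 := goodD (goodXM j l 4 2) (goodXM l j 4 2).
rewrite (ED (goodZ 4^-1 g66) (goodZ (15 / 4) g42)) (EZ 4^-1 g66) (EZ (15 / 4) g42).
by rewrite (ED (g6 j) (g6 l)) (ED (goodXM j l 4 2) (goodXM l j 4 2)); lra.
Qed.

Let moment_sum m j : \sum_l E (fun V => V i j ^+ m * V i l ^+ 2) = E (fun V => V i j ^+ m).
Proof.
rewrite -E_sum; last by move=> l; exact: goodXM.
by apply: E_ext => V DV; rewrite -mulr_sumr row_norm// mulr1.
Qed.

Let diagE m j : E (fun V => V i j ^+ m * V i j ^+ 2) = E (fun V => V i j ^+ (m + 2)).
Proof. by apply: E_ext => V _; rewrite exprD. Qed.

(* The diagonal pairs do not satisfy the relation of [fourth_pair]: they add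
   2 E a^4 on the left and 6 E a^4 on the right, hence the correction by 4. *)
Let S4E : (n%:R + 2) * S4 = 3.
Proof.
have S2 : \sum_j E (fun V => V i j ^+ 2) = 1.
  rewrite -E_sum; last by move=> l; exact: goodX.
  by rewrite (E_ext (g := fun=> 1)) ?E_cst// => V; exact: row_norm.
have : \sum_j \sum_l (E (fun V => V i j ^+ 4) + E (fun V => V i l ^+ 4)) =
       \sum_j (6 * E (fun V => V i j ^+ 2) - 4 * E (fun V => V i j ^+ 4)).
  apply: eq_bigr => j _; rewrite -(moment_sum 2) mulr_sumr (bigD1 j)//= [in RHS](bigD1 j)//=.
  rewrite [in RHS]addrAC diagE; congr (_ + _); first by ring.
  by apply: eq_bigr => l lj; rewrite fourth_pair// eq_sym.
rewrite sumrB -!mulr_sumr S2 -/S4.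
under eq_bigr do rewrite big_split/= sumr_const card_ord -/S4.
by rewrite big_split/= sumr_const card_ord sumrMnl -/S4 -[S4 *+ n]mulr_natl; lra.
Qed.

(* Here a diagonal pair adds 2 E a^6 on the left and 10 E a^6 on the right. *)
Let S6E : (n%:R + 4) * S6 = 5 * S4.
Proof.
have : \sum_j \sum_l (E (fun V => V i j ^+ 6) + E (fun V => V i l ^+ 6)) =
       \sum_j (5 * E (fun V => V i j ^+ 4) + 5 * \sum_l E (fun V => V i l ^+ 4 * V i j ^+ 2)
            - 8 * E (fun V => V i j ^+ 6)).
  apply: eq_bigr => j _; rewrite -(moment_sum 4) -mulrDr -big_split/= mulr_sumr.
  rewrite (bigD1 j)//= [in RHS](bigD1 j)//=.
  rewrite [in RHS]addrAC diagE; congr (_ + _); first by ring.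
  by apply: eq_bigr => l lj; rewrite sixth_pair// eq_sym.
rewrite sumrB big_split/= -!mulr_sumr.
have -> : \sum_j \sum_l E (fun V => V i l ^+ 4 * V i j ^+ 2) = S4.
  by rewrite exchange_big; apply: eq_bigr => l _; exact: moment_sum.
rewrite -/S4 -/S6.
under eq_bigr do rewrite big_split/= sumr_const card_ord -/S6.
by rewrite big_split/= sumr_const card_ord sumrMnl -/S6 -[S6 *+ n]mulr_natl; lra.
Qed.

(** Invariance under the Hadamard reflections gives, for two entries a and b of a
    row, E (a^4 + b^4) = 6 E (a^2 b^2) and E (a^6 + b^6) = 5 E (a^4 b^2 + a^2 b^4).
    Summed over all pairs of columns, these equations determine the moments,
    since rows are unit vectors. *)
Lemma stiefel_sixth_moment :
  (\int[mu]_(V in @stiefel R k n) (\sum_j V i j ^+ 6)%:E =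
  (15 / ((n%:R + 2) * (n%:R + 4)))%:E)%E.
Proof.
have gS : good (fun V => \sum_j V i j ^+ 6) by apply: good_sum => j; exact: goodX.
rewrite -[LHS]fineK; last exact: (integrable_fin_num mD (good_integrable gS)).
congr (_%:E); rewrite -[LHS]/(E (fun V => \sum_j V i j ^+ 6)) E_sum; last by move=> j; exact: goodX.
rewrite -/S6; have n0 : 0 <= n%:R :> R by [].
have n2 : n%:R + 2 != 0 :> R by rewrite gt_eqF//; lra.
have n4 : n%:R + 4 != 0 :> R by rewrite gt_eqF//; lra.
apply: (mulfI n4); rewrite S6E; apply: (mulfI n2).
by rewrite mulrCA S4E; field; rewrite n2 n4.
Qed.

End stiefel_moments.

(** * Almost sure decay of the entries *)

(** The series of the [g n] has a finite integral, so it converges almost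
    everywhere and its terms tend to zero. *)
Lemma ae_cvg0_of_summable_integrals d (T : measurableType d) (R : realType)
    (P : {measure set T -> \bar R}) (g : nat -> T -> R) (c : nat -> R) (C : R) :
  (forall n, measurable_fun setT (g n)) -> (forall n w, 0 <= g n w) ->
  (forall n, (\int[P]_w (g n w)%:E <= (c n)%:E)%E) ->
  (forall N, \sum_(n < N) c n <= C) ->
  {ae P, forall w, g n w @[n --> \oo] --> 0}.
Proof.
move=> mg g0 gc cC.
have mf n : measurable_fun setT (fun w => (g n w)%:E) by exact/measurable_EFinP.
have total : (\int[P]_w (\sum_(n <oo) (g n w)%:E) <= C%:E)%E.
  rewrite integral_nneseries//; last by move=> n w _; rewrite lee_fin.
  apply: lime_le.
    by apply: is_cvg_nneseries => n _ _; apply: integral_ge0 => w _; rewrite lee_fin.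
  apply: nearW => N; rewrite (@le_trans _ _ (\sum_(0 <= n < N) (c n)%:E)%E)//.
    by apply: lee_sum => n _; exact: gc.
  by rewrite sumEFin lee_fin big_mkord.
have sum0 w : (0 <= \sum_(n <oo) (g n w)%:E)%E.
  by apply: nneseries_ge0 => n _ _; rewrite lee_fin.
have int : P.-integrable setT (fun w => \sum_(n <oo) (g n w)%:E)%E.
  apply/integrableP; split.
    by apply: ge0_emeasurable_sum => // n w _ _; rewrite lee_fin.
  rewrite (le_lt_trans _ (ltry C))// (le_trans _ total)//.
  by under eq_integral do rewrite gee0_abs//.
have := integrable_ae measurableT int; apply: filterS => w /(_ I) fin_sum.
apply: cvg_series_cvg_0; apply: nondecreasing_is_cvgn.
  by apply: nondecreasing_series => n _ _; exact: g0.
exists (fine (\sum_(n <oo) (g n w)%:E)%E) => _ [N _ <-].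
rewrite -lee_fin fineK//= /series/= -sumEFin.
by apply: nneseries_lim_ge => n _ _; rewrite lee_fin.
Qed.

(** The expected sums of the sixth powers are of order [n^-2], hence summable,
    whereas those of the fourth powers are only of order [1 / n]. Summability
    gives almost sure convergence whatever the joint law of the matrices. *)
Lemma stiefel_entries_cvg0 (R : realType) k d (Omega : measurableType d)
    (P : probability Omega R) (V : forall n, {mfun Omega >-> 'M[R]_(k, n)}) :
  (forall n, (k <= n)%N -> stiefel_uniform (distribution P (V n))) ->
  {ae P, forall w, (forall n, (k <= n)%N -> stiefel (V n w)) /\
    (\sum_i \sum_j V n w i j ^+ 6) @[n --> \oo] --> 0}.
Proof.
move=> hV.
have ae_stiefel : {ae P, forall w, forall n, (k <= n)%N -> stiefel (V n w)}.
  apply: ae_foralln => n; have [kn|nk] := leqP k n; last first.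
    exact: aeW.
  have mVD : measurable (V n @^-1` @stiefel R k n).
    by apply: measurable_funPTI; exact: measurable_stiefel.
  exists (~` (V n @^-1` @stiefel R k n)); split.
  - exact: measurableC.
  - have := probability_setC P mVD.
    by rewrite (_ : P (V n @^-1` _) = 1%E) ?subee//; exact: (hV n kn).1.
  - by move=> w /= H Dw; apply: H.
pose S n (M : 'M[R]_(k, n)) := \sum_i \sum_j M i j ^+ 6.
pose g n w := if (k <= n)%N then S n (V n w) * \1_(@stiefel R k n) (V n w) else 0.
have S0 n M : 0 <= S n M.
  by rewrite /S !sumr_ge0// => i _; rewrite sumr_ge0// => j _; rewrite exprn_even_ge0.
have mS n : measurable_fun setT (@S n).
  apply: measurable_sum => i; apply: measurable_sum => j.
  by apply: measurable_funX; exact: measurable_fun_coord.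
have mSD n : measurable_fun setT (fun M => @S n M * \1_(@stiefel R k n) M).
  by apply: measurable_funM => //; apply: measurable_indic; exact: measurable_stiefel.
pose c (n : nat) : R := k%:R * (15 / ((n%:R + 1) * (n%:R + 2))).
have : {ae P, forall w, g n w @[n --> \oo] --> 0}.
  apply: (@ae_cvg0_of_summable_integrals _ _ _ _ g c (k%:R * 15)).
  - move=> n; rewrite /g; case: (k <= n)%N; last exact: measurable_cst.
    exact: (measurableT_comp (mSD n) (@measurable_funPT _ _ _ _ (V n))).
  - by move=> n w; rewrite /g; case: ifP => // _; rewrite mulr_ge0.
  - move=> n; have n0 : 0 <= n%:R :> R by [].
    have c0 : 0 <= c n by rewrite /c mulr_ge0// divr_ge0// mulr_ge0// addr_ge0.
    rewrite /g; have [kn|_] := boolP (k <= n)%N; last by rewrite integral0 lee_fin.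
    have -> : (\int[P]_w (S n (V n w) * \1_(@stiefel R k n) (V n w))%:E =
        \int[distribution P (V n)]_(M in @stiefel R k n) (S n M)%:E)%E.
      rewrite [RHS]integral_mkcond ge0_integral_pushforward//.
      + apply: eq_integral => w _ /=; rewrite patchE indicE.
        by case: (_ \in _); rewrite ?mulr1 ?mulr0.
      + rewrite (_ : _ \_ _ = EFin \o (fun M => @S n M * \1_(@stiefel R k n) M)).
          exact/measurable_EFinP.
        apply/funext => M; rewrite /= patchE indicE.
        by case: (_ \in _); rewrite ?mulr1 ?mulr0.
      + by move=> M _; rewrite patchE; case: ifPn; rewrite ?lee_fin.
    under eq_integral do rewrite -sumEFin.
    rewrite ge0_integral_sum//; last 3 first.
    + exact: measurable_stiefel.
    + move=> i; apply/measurable_EFinP/measurable_funTS; apply: measurable_sum => j.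
      by apply: measurable_funX; exact: measurable_fun_coord.
    + by move=> i M _; rewrite lee_fin sumr_ge0// => j _; rewrite exprn_even_ge0.
    under eq_bigr do rewrite (stiefel_sixth_moment (hV n kn)).
    rewrite sumEFin lee_fin sumr_const card_ord -[_ *+ k]mulr_natl /c ler_wpM2l//.
    rewrite ler_pM2l// lef_pV2 ?posrE ?mulr_gt0//; try lra.
  - move=> N; rewrite -mulr_sumr ler_wpM2l//.
    (* telescoping *)
    have -> : \sum_(n < N) 15 / ((n%:R + 1) * (n%:R + 2)) = 15 * (1 - (N%:R + 1)^-1) :> R.
      elim: N => [|N IH]; first by rewrite big_ord0 add0r invr1 subrr mulr0.
      rewrite big_ord_recr/= IH -natr1; have n0 : 0 <= N%:R :> R by [].
      field.
      by apply/andP; split; rewrite gt_eqF//; lra.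
    by rewrite ler_piMr// gerBl invr_ge0 addr_ge0.
apply: filterS2 ae_stiefel => w Dw gw; split=> //.
apply: cvg_trans gw; apply: near_eq_cvg; near=> n.
have kn : (k <= n)%N by near: n; exact: nbhs_infty_ge.
by rewrite /g kn indicE mem_set ?mulr1//; exact: Dw.
Unshelve. all: by end_near. Qed.

(** * Layer-cake formula and Gamma function *)

Section layer_cake.
Context (R : realType).
Local Notation leb := (@lebesgue_measure R).

Lemma integral_expRN_tail (u : R) :
  (\int[leb]_(t in `[u, +oo[) (expR (- t))%:E = (expR (- u))%:E)%E.
Proof.
have d (t : R) : is_derive t 1 (fun t : R => - expR (- t)) (expR (- t)).
  have dN : is_derive t 1 (-%R : R -> R) (-1) by exact: is_deriveN.
  have := is_derive1_comp (is_derive_expR (- t)) dN.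
  by move=> /is_deriveN; rewrite mulrN1 opprK.
have c : continuous (fun t : R => - expR (- t)).
  move=> t; apply: differentiable_continuous; apply/derivable1_diffP.
  by have [] := d t.
have c' : continuous (fun t : R => expR (- t)).
  move=> t; apply: (@continuous_comp _ _ _ (fun t : R => - t) expR).
    exact: opp_continuous.
  exact: continuous_expR.
rewrite (@ge0_continuous_FTC2y _ _ (fun t => - expR (- t)) _ 0).
- by rewrite EFinN oppeK add0e.
- by move=> t _; rewrite expR_ge0.
- exact: continuous_subspaceT.
- rewrite -oppr0; apply: cvgN.
  exact: (@cvgr_expR R).
- by move=> t _; have [] := d t.
- by apply: cvg_at_right_filter; exact: c.
- by move=> t _; rewrite derive1E; have [_ ->] := d t.
Qed.

(** For [a < 1] the integrand is unbounded near 0, so the fundamental theorem is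
    applied on intervals that exhaust the domain. *)
Lemma integral_powR (a r : R) : 0 < a -> 0 < r ->
  (\int[leb]_(t in `]0%R, r]) (a * t `^ (a - 1))%:E = (r `^ a)%:E)%E.
Proof.
move=> a0 r0.
pose F n := `[r / n.+2%:R, r]%classic.
have Fx n : 0 < r / n.+2%:R by rewrite divr_gt0.
have Fr n : r / n.+2%:R < r.
  by rewrite ltr_pdivrMr// ltr_pMr// ltr1n.
have UF : \bigcup_n F n = `]0, r]%classic.
  apply/seteqP; split=> t /=.
    by move=> [n _]; rewrite /F/= !in_itv/= => /andP[nt ->]; rewrite (lt_le_trans _ nt).
  rewrite in_itv/= => /andP[t0 tr]; exists (Num.truncn (r / t)) => //.
  rewrite /F/= in_itv/= tr andbT ler_pdivrMr// mulrC -ler_pdivrMr//.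
  apply: ltW; apply: (lt_trans (truncnS_gt _)).
  by rewrite ltr_nat.
have mf : measurable_fun (`]0%R, r]%classic : set R) (fun t : R => (a * t `^ (a - 1))%:E).
  apply/measurable_EFinP; apply: measurable_funM => //.
  by apply: measurable_funTS; exact: measurable_powR.
have ndF : nondecreasing_seq F.
  move=> m n mn; apply/subsetPset => t; rewrite /F/= !in_itv/= => /andP[mt ->].
  rewrite andbT (le_trans _ mt)// ler_pM2l// lef_pV2 ?posrE//.
  by rewrite ler_nat ltnS.
have := @ge0_nondecreasing_set_cvg_integral _ (measurableTypeR R) _ F (fun t : R => (a * t `^ (a - 1))%:E) leb ndF.
rewrite UF => /(_ (fun=> measurable_itv _)) H.
have mfF n : measurable_fun (F n) (fun t : R => (a * t `^ (a - 1))%:E).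
  by apply: measurable_funS mf => //; rewrite -UF; exact: bigcup_sup.
have {}H : (\int[leb]_(t in F n) (a * t `^ (a - 1))%:E @[n --> \oo] -->
   \int[leb]_(t in `]0%R, r]) (a * t `^ (a - 1))%:E)%E.
  by apply: H => // n t _; rewrite lee_fin mulr_ge0 ?powR_ge0// ltW.
have Fint n : (\int[leb]_(t in F n) (a * t `^ (a - 1))%:E =
    (r `^ a)%:E - ((r / n.+2%:R) `^ a)%:E)%E.
  have dpow (t : R) : 0 < t -> is_derive t 1 (fun x : R => x `^ a) (a * t `^ (a - 1)).
    exact: is_derive1_powR.
  have cpow (t : R) b : 0 < t -> {for t, continuous (fun x : R => x `^ b)}.
    move=> t0; apply: differentiable_continuous; apply/derivable1_diffP.
    by have [] := @is_derive1_powR R b t t0.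
  rewrite (@continuous_FTC2 _ _ (fun x : R => x `^ a))//.
  - apply: continuous_in_subspaceT => t; rewrite inE/= in_itv/= => /andP[nt _].
    have t0 : 0 < t by rewrite (lt_le_trans _ nt).
    exact: (@continuousM R R (fun=> a) _ t (@cst_continuous _ _ a t) (cpow t (a - 1) t0)).
  - split.
    + move=> t; rewrite in_itv/= => /andP[nt _].
      by have [] := dpow t (lt_trans (Fx n) nt).
    + by apply: cvg_at_right_filter; exact: cpow.
    + by apply: cvg_at_left_filter; exact: cpow.
  - move=> t; rewrite in_itv/= => /andP[nt _].
    by rewrite powR_derive1// in_itv/= (lt_trans (Fx n) nt).
have cF : ((r `^ a)%:E - ((r / n.+2%:R) `^ a)%:E)%E @[n --> \oo] --> (r `^ a)%:E.
  rewrite -[X in _ --> X]sube0; apply: cvgeB => //; first exact: cvg_cst.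
  apply: cvg_EFin; first by apply: nearW.
  have /cvg_at_rightP := powR_cvg0 a0; apply; split=> [n|]; first exact: Fx.
  rewrite -(mulr0 r); apply: cvgMl_tmp.
  by have := @cvg_harmonic R; rewrite -(@cvg_shiftS R).
move: H; rewrite (funext Fint) => H; exact: (cvg_unique _ H cF).
Qed.

End layer_cake.

Section layer_cake_formula.
Context (R : realType).
Local Notation leb := (@lebesgue_measure R).

(** Integrates the identity [exp (- u) = \int_u^oo exp (- t) dt] by Tonelli. *)
Lemma layer_cake d (T : measurableType d) (m : {sigma_finite_measure set T -> \bar R})
    (u h : T -> R) :
  measurable_fun setT u -> measurable_fun setT h ->
  (forall y, 0 <= u y) -> (forall y, 0 <= h y) ->
  (\int[m]_y (h y * expR (- u y))%:E =
   \int[leb]_(t in `]0%R, +oo[)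
     ((expR (- t))%:E * \int[m]_(y in [set y | (u y <= t)%R]) (h y)%:E))%E.
Proof.
move=> mu mh u0 h0.
pose A : set (T * measurableTypeR R) := [set z | u z.1 <= z.2].
have mA : measurable A.
  have mg : measurable_fun setT (fun z : T * measurableTypeR R => z.2 - u z.1).
    apply: measurable_funB; first exact: measurable_snd.
    exact: (measurableT_comp mu measurable_fst).
  rewrite (_ : A = (fun z : T * measurableTypeR R => z.2 - u z.1) @^-1` `[0, +oo[).
    by rewrite -[X in measurable X]setTI; exact: mg.
  by apply/seteqP; split=> z; rewrite /A/= in_itv/= andbT subr_ge0.
pose f (z : T * measurableTypeR R) : R := h z.1 * expR (- z.2) * \1_A z.
have f0 z : 0 <= f z by rewrite /f !mulr_ge0// expR_ge0.
have mf : measurable_fun setT (fun z => (f z)%:E).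
  apply/measurable_EFinP; apply: measurable_funM; last exact: measurable_indic.
  apply: measurable_funM; first exact: (measurableT_comp mh measurable_fst).
  apply: measurableT_comp => //; apply: measurableT_comp => //.
have ft := fubini_tonelli (m1 := m) (m2 := leb) _ mf
  (fun z => (f0 z : (0 <= (f z)%:E)%E)).
have inL y : (\int[leb]_t (f (y, t))%:E = (h y * expR (- u y))%:E)%E.
  rewrite EFinM -integral_expRN_tail -ge0_integralZl_EFin//; last first.
    apply/measurable_EFinP/measurable_funTS.
    by apply: measurableT_comp => //; exact: measurableT_comp.
  rewrite [RHS]integral_mkcond; apply: eq_integral => t _.
  rewrite patchE /f/= indicE; case: ifPn => [|/negP].
    by rewrite inE/= in_itv/= andbT => ut; rewrite mem_set//= mulr1 EFinM.
  by rewrite inE/= in_itv/= andbT => nut; rewrite memNset ?mulr0.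
rewrite (eq_integral _ _ (fun y _ => inL y)) in ft.
rewrite ft.
have inR t : (\int[m]_y (f (y, t))%:E =
    (expR (- t))%:E * \int[m]_(y in [set y | (u y <= t)%R]) (h y)%:E)%E.
  have mS : measurable [set y | u y <= t].
    rewrite (_ : mkset _ = u @^-1` `]-oo, t]); last first.
      by apply/seteqP; split=> y /=; rewrite in_itv.
    by rewrite -[X in measurable X]setTI; exact: mu.
  rewrite -ge0_integralZl_EFin ?expR_ge0//; last 2 first.
  - by move=> y _; rewrite lee_fin.
  - exact/measurable_EFinP/measurable_funTS.
  rewrite [RHS]integral_mkcond; apply: eq_integral => y _.
  rewrite patchE /f/= indicE; case: ifPn => [|/negP].
    by rewrite inE/= => ut; rewrite mem_set//= mulr1 mulrC EFinM.
  by rewrite inE/= => nut; rewrite memNset ?mulr0.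
rewrite -(eq_integral _ _ (fun t _ => inR t)).
rewrite integral_itv_obnd_cbnd; last first.
  apply: measurable_funTS.
  exact: (measurable_fun_fubini_tonelli_G _ mf (fun z => (f0 z : (0 <= (f z)%:E)%E))).
rewrite [RHS]integral_mkcond; apply: eq_integral => t _.
rewrite patchE; case: ifPn => // /negP.
rewrite inE/= in_itv/= andbT => /negP; rewrite -ltNge => t0.
apply: integral0_eq => y _; rewrite /f/= indicE memNset ?mulr0//= => ut.
by have := u0 y; rewrite leNgt (le_lt_trans ut t0).
Qed.

End layer_cake_formula.

Section gamma_function.
Context (R : realType).
Local Notation leb := (@lebesgue_measure R).

Let G (a : R) : \bar R := (\int[leb]_(t in `]0%R, +oo[) (t `^ (a - 1) * expR (- t))%:E)%E.

Let mexpN : measurable_fun setT (fun t : R => expR (- t)).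
Proof. by apply: measurableT_comp => //; exact: measurableT_comp. Qed.

Let G1 : G 1 = 1%E.
Proof.
rewrite /G subrr; under eq_integral do rewrite powRr0 mul1r.
rewrite integral_itv_obnd_cbnd; last exact/measurable_EFinP/measurable_funTS.
by rewrite integral_expRN_tail oppr0 expR0.
Qed.

(* The layer-cake formula for the density a t^(a - 1) on the half-line, whose
   integral from 0 to t is t^a. *)
Let G_rec a : 0 < a -> G (a + 1) = (a%:E * G a)%E.
Proof.
move=> a0; pose h (t : measurableTypeR R) : R := a * t `^ (a - 1) * \1_(`]0, +oo[ : set R) t.
pose u (t : measurableTypeR R) : R := Num.max t 0.
have mh : measurable_fun setT h.
  apply: measurable_funM; last exact: measurable_indic.
  by apply: measurable_funM => //; exact: measurable_powR.
have mu : measurable_fun setT u by exact: measurable_maxr.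
have h0 t : 0 <= h t by rewrite /h !mulr_ge0// ?powR_ge0// ltW.
have u0 t : 0 <= u t by rewrite /u le_max lexx orbT.
have := layer_cake leb mu mh u0 h0.
have -> : (\int[leb]_y (h y * expR (- u y))%:E = a%:E * G a)%E.
  rewrite /G -ge0_integralZl_EFin//; last 3 first.
  - by move=> t _; rewrite lee_fin mulr_ge0 ?powR_ge0 ?expR_ge0.
  - apply/measurable_EFinP/measurable_funTS.
    by apply: measurable_funM => //; exact: measurable_powR.
  - exact: ltW.
  rewrite [RHS]integral_mkcond; apply: eq_integral => t _.
  rewrite patchE /h /u indicE; case: ifPn => [|_]; last by rewrite mulr0 mul0r.
  rewrite inE/= in_itv/= andbT => t0; rewrite mulr1 max_l ?ltW//.
  by rewrite -EFinM mulrA.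
move=> ->; rewrite /G addrK; apply: eq_integral => t.
rewrite inE/= in_itv/= andbT => t0.
rewrite (_ : (\int[_]_(_ in _) _ = (t `^ a)%:E)%E) -?EFinM 1?mulrC//.
rewrite -(integral_powR a0 t0) integral_mkcond [RHS]integral_mkcond.
apply: eq_integral => s _; rewrite !patchE /h indicE.
have sE : (s \in `]0, +oo[%classic) = (0 < s).
  by rewrite mem_setE in_itv/= andbT.
have rE : (s \in `]0, t]%classic) = (0 < s <= t) by rewrite mem_setE in_itv.
have uE : (s \in [set y | u y <= t]) = (Num.max s 0 <= t) by apply/idP/idP; rewrite inE.
rewrite uE sE rE; have [s0|s0] := ltP 0 s.
  by rewrite /= mulr1.
by rewrite (ltW t0) /= mulr0.
Qed.

Let G_lty_nat m : (G m.+1%:R < +oo)%E.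
Proof.
elim: m => [|m IH]; first by rewrite G1 ltry.
by rewrite -natr1 G_rec ?ltr0n// lte_mul_pinfty.
Qed.

Let G_ge0 a : (0 <= G a)%E.
Proof.
by apply: integral_ge0 => t _; rewrite lee_fin mulr_ge0 ?powR_ge0 ?expR_ge0.
Qed.

Let mG a : measurable_fun setT (fun t : R => t `^ (a - 1) * expR (- t)).
Proof. by apply: measurable_funM => //; exact: measurable_powR. Qed.

Let mGE a (D : set (measurableTypeR R)) :
  measurable_fun D (fun t : measurableTypeR R => (t `^ (a - 1) * expR (- t))%:E).
Proof. by apply/measurable_EFinP/measurable_funTS; exact: mG. Qed.

Let mEE (D : set (measurableTypeR R)) :
  measurable_fun D (fun t : measurableTypeR R => (expR (- t))%:E).
Proof. by apply/measurable_EFinP/measurable_funTS; exact: mexpN. Qed.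

(* t^(b - 1) <= 1 + t^m for an integer m >= b, and the recursion settles integer
   arguments. *)
Let G_lty a : 0 < a -> (G a < +oo)%E.
Proof.
suff H b : 1 <= b -> (G b < +oo)%E.
  move=> a0; have a1 : (G (a + 1) < +oo)%E by apply: H; rewrite lerDr ltW.
  move: a1; rewrite G_rec//; have := G_ge0 a; case: (G a) => [r _ _|_|//]; first by rewrite ltry.
  by rewrite mulry gtr0_sg// mul1e.
move=> b1; pose m := (Num.truncn b).+1.
have bm : b <= m%:R by apply: ltW; exact: truncnS_gt.
apply: (@le_lt_trans _ _ (G 1 + G m.+1%:R)%E); last first.
  by rewrite lte_add_pinfty// G1 ltry.
rewrite /G -ge0_integralD//; try apply: mGE.
apply: ge0_le_integral => //.
- by move=> t _; rewrite lee_fin; exact: mulr_ge0 (powR_ge0 _ _) (expR_ge0 _).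
- by apply: emeasurable_funD; apply: mGE.
- move=> t /=; rewrite in_itv/= andbT => t0.
  rewrite -EFinD lee_fin -mulrDl ler_wpM2r ?expR_ge0// subrr powRr0 -natr1 addrK.
  have [t1|t1] := leP t 1.
    rewrite ler_wpDr ?powR_ge0//.
    have p1 : 1 `^ (b - 1) = 1 :> R by rewrite powR1.
    by rewrite -[leRHS]p1 ge0_ler_powR ?nnegrE ?subr_ge0// ltW.
  rewrite ler_wpDl// ler_powR ?(ltW t1)//.
  by rewrite (le_trans _ bm)// gerBl.
- by move=> t _; rewrite lee_fin; exact: mulr_ge0 (powR_ge0 _ _) (expR_ge0 _).
- by move=> t _; rewrite lee_fin; exact: mulr_ge0 (powR_ge0 _ _) (expR_ge0 _).
Qed.

Lemma integral_Gamma (a : R) : 0 < a ->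
  (\int[leb]_(t in `]0%R, +oo[) (t `^ (a - 1) * expR (- t))%:E = (Gamma a)%:E)%E.
Proof. by move=> a0; rewrite /Gamma /Rintegral fineK// ge0_fin_numE; [exact: (G_lty a0)|exact: G_ge0]. Qed.

Lemma Gamma_rec (a : R) : 0 < a -> Gamma (a + 1) = a * Gamma a.
Proof.
move=> a0; have := G_rec a0; rewrite /G !integral_Gamma ?addr_gt0//.
by rewrite -EFinM => -[].
Qed.

Lemma Gamma_gt0 (a : R) : 0 < a -> 0 < Gamma a.
Proof.
suff H (b : R) : 1 <= b -> 0 < Gamma b.
  move=> a0; have := H (a + 1); rewrite lerDr (ltW a0) => /(_ isT).
  by rewrite Gamma_rec// pmulr_rgt0.
move=> b1; rewrite -lte_fin -integral_Gamma ?(lt_le_trans ltr01)//.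
apply: (@lt_le_trans _ _ (expR (- 1))%:E); first by rewrite lte_fin expR_gt0.
rewrite -integral_expRN_tail.
apply: (@le_trans _ _ (\int[leb]_(t in `[1%R, +oo[) (t `^ (b - 1) * expR (- t))%:E)%E).
  apply: ge0_le_integral => //.
  - move=> t /=; rewrite in_itv/= andbT => t1.
    rewrite lee_fin ler_peMl ?expR_ge0//.
    by rewrite -[leLHS](powRr0 t) ler_powR// subr_ge0.
apply: ge0_subset_integral => //.
- by move=> t _; rewrite lee_fin; exact: mulr_ge0 (powR_ge0 _ _) (expR_ge0 _).
- by move=> t /=; rewrite !in_itv/= !andbT; exact: lt_le_trans.
Qed.

End gamma_function.

(** * Taylor bounds for the cosine *)

Section cosine_taylor.
Context (R : realType).
Implicit Types y t : R.

Let cosT m y : R := \sum_(k < m) (-1) ^+ k * (y ^+ k.*2 / (k.*2)`!%:R).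
Let sinT m y : R := \sum_(k < m) (-1) ^+ k * (y ^+ k.*2.+1 / (k.*2.+1)`!%:R).

Let is_derive_monomial (c : R) n y :
  is_derive y 1 (fun y : R => c * (y ^+ n.+1 / (n.+1)`!%:R)) (c * (y ^+ n / n`!%:R)).
Proof.
have n0 : (n.+1)`!%:R != 0 :> R by rewrite pnatr_eq0 -lt0n fact_gt0.
have := is_derive_poly ((c / (n.+1)`!%:R) *: 'X^(n.+1)) y.
rewrite derivZ derivXn hornerZ hornerMn hornerXn/=.
rewrite (_ : horner _ = (fun y : R => c * (y ^+ n.+1 / (n.+1)`!%:R))).
  move=> /(is_derive_eq); apply.
  rewrite -[y ^+ n *+ _]mulr_natl factS natrM; move: n0; rewrite factS natrM mulf_eq0.
  move: (n`!%:R : R) (n.+1%:R : R) => F N /norP[N0 F0]; field.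
  by rewrite N0 F0.
by apply/funext => z; rewrite hornerZ hornerXn; ring.
Qed.

Let is_derive_sinT m y : is_derive y 1 (sinT m) (cosT m y).
Proof.
elim: m => [|m IH].
  rewrite /cosT big_ord0 (_ : sinT 0 = cst 0); first exact: is_derive_cst.
  by apply/funext => z; rewrite /sinT big_ord0.
rewrite /cosT big_ord_recr/= -/(cosT m y).
rewrite (_ : sinT m.+1 = sinT m + (fun y => (-1) ^+ m * (y ^+ m.*2.+1 / (m.*2.+1)`!%:R))).
  exact: is_deriveD.
by apply/funext => z; rewrite /sinT big_ord_recr.
Qed.

Let is_derive_cosT m y : is_derive y 1 (cosT m.+1) (- sinT m y).
Proof.
elim: m => [|m IH].
  rewrite /sinT big_ord0 oppr0 (_ : cosT 1 = cst 1); first exact: is_derive_cst.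
  by apply/funext => z; rewrite /cosT big_ord1 !expr0 fact0 divr1 mulr1.
rewrite /sinT big_ord_recr/= -/(sinT m y) opprD.
rewrite (_ : cosT m.+2 = cosT m.+1 +
   (fun y => (-1) ^+ m.+1 * (y ^+ m.*2.+2 / (m.*2.+2)`!%:R))).
  have -> : - ((-1) ^+ m * (y ^+ m.*2.+1 / (m.*2.+1)`!%:R)) =
      (-1) ^+ m.+1 * (y ^+ m.*2.+1 / (m.*2.+1)`!%:R) by rewrite (exprS (-1)) mulN1r mulNr.
  exact: is_deriveD.
by apply/funext => z; rewrite /cosT big_ord_recr.
Qed.

Let ge0_from0 (f df : R -> R) y : (forall t, is_derive t 1 f (df t)) ->
  (forall t, 0 <= t -> 0 <= df t) -> f 0 = 0 -> 0 <= y -> 0 <= f y.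
Proof.
move=> fdf df0 f0 y0.
have cf : {within `[0, y], continuous f}.
  apply: continuous_subspaceT => t; apply: differentiable_continuous.
  by apply/derivable1_diffP; have [] := fdf t.
have [c] := MVT_segment y0 (fun t _ => fdf t) cf.
by rewrite in_itv/= f0 !subr0 => /andP[c0 _] ->; rewrite mulr_ge0// df0.
Qed.

Let bound_from0 (f df : R -> R) n y : (forall t, is_derive t 1 f (df t)) ->
  (forall t, 0 <= t -> `|df t| <= t ^+ n / n`!%:R) -> f 0 = 0 -> 0 <= y ->
  `|f y| <= y ^+ n.+1 / (n.+1)`!%:R.
Proof.
move=> fdf dfn f0 y0.
pose g t : R := 1 * (t ^+ n.+1 / (n.+1)`!%:R).
have dg t := is_derive_monomial 1 n t.
have g0 : g 0 = 0 by rewrite /g expr0n mul0r mulr0.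
rewrite ler_norml -[_ / _]mul1r -/(g y); apply/andP; split.
  rewrite -subr_ge0 opprK.
  apply: (ge0_from0 (f := f + g) (fun t => is_deriveD (fdf t) (dg t))) => //.
    by move=> t /dfn; rewrite mul1r ler_norml => /andP[+ _]; rewrite -subr_ge0 opprK.
  by rewrite /GRing.add/= f0 g0 addr0.
rewrite -subr_ge0.
apply: (ge0_from0 (f := g - f) (fun t => is_deriveB (dg t) (fdf t))) => //.
  by move=> t /dfn; rewrite mul1r ler_norml => /andP[_]; rewrite -subr_ge0.
by rewrite /GRing.add/GRing.opp/= f0 g0 subr0.
Qed.

Let taylor_ge0 m y : 0 <= y -> `|cos y - cosT m y| <= y ^+ m.*2 / (m.*2)`!%:R.
Proof.
suff : (forall y, 0 <= y -> `|cos y - cosT m y| <= y ^+ m.*2 / (m.*2)`!%:R) /\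
  (forall y, 0 <= y -> `|sin y - sinT m y| <= y ^+ m.*2.+1 / (m.*2.+1)`!%:R) by case=> H _; exact: H.
elim: m => [|m [IHc IHs]].
  have h z : 0 <= z -> `|cos z - cosT 0 z| <= z ^+ 0 / 0`!%:R.
    by rewrite /cosT big_ord0 subr0 expr0 fact0 divr1 cos_max.
  split=> // z z0.
  apply: (bound_from0 (f := sin - sinT 0) (df := fun t => cos t - cosT 0 t)) => //.
    by move=> t; exact: is_deriveB.
  by rewrite /GRing.add/GRing.opp/= sin0 /sinT big_ord0 subr0.
have hc z : 0 <= z -> `|cos z - cosT m.+1 z| <= z ^+ m.+1.*2 / (m.+1.*2)`!%:R.
  move=> z0.
  apply: (bound_from0 (f := cos - cosT m.+1) (df := fun t => - sin t - - sinT m t)) => //.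
  - by move=> t; exact: is_deriveB.
  - by move=> t t0; rewrite -opprD normrN; exact: IHs.
  - rewrite /GRing.add/GRing.opp/= cos0 /cosT big_ord_recl big1 => [|i _].
      by rewrite /= !expr0 fact0 divr1 mulr1 addr0 subrr.
    by rewrite /= /bump/= add1n doubleS expr0n mul0r mulr0.
split=> // z z0.
apply: (bound_from0 (f := sin - sinT m.+1) (df := fun t => cos t - cosT m.+1 t)) => //.
  by move=> t; exact: is_deriveB.
rewrite /GRing.add/GRing.opp/= sin0 /sinT big1 ?subr0// => i _.
by rewrite expr0n mul0r mulr0.
Qed.

(** Each bound for the cosine follows by integration from one for the sine and
    conversely, starting from [|cos| <= 1]. *)
Lemma cos_taylor m y :
  `|cos y - \sum_(k < m) (-1) ^+ k * (y ^+ k.*2 / (k.*2)`!%:R)| <=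
  y ^+ m.*2 / (m.*2)`!%:R.
Proof.
have := @taylor_ge0 m `|y| (normr_ge0 y); rewrite cos_norm /cosT.
have e k : `|y| ^+ k.*2 = y ^+ k.*2.
  by rewrite -mul2n !exprM real_normK ?num_real.
by rewrite e; under eq_bigr do rewrite e.
Qed.

Lemma cos_lipschitz (x y : R) : `|cos x - cos y| <= `|x - y|.
Proof.
wlog yx : x y / y <= x => [H|].
  have [/H//|/ltW/H] := leP y x.
  by rewrite distrC [X in _ <= X -> _]distrC.
have [c _ ->] := MVT_segment yx (fun z _ => is_derive_cos z)
  (continuous_subspaceT (@continuous_cos R)).
by rewrite normrM normrN ler_piMl// sin_max.
Qed.

End cosine_taylor.

(** * Integration on powers of a measure *)

Definition tail_cV (R : realType) n (v : 'cV[R]_n.+1) : 'cV[R]_n :=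
  \col_i v (lift ord0 i) 0.

Section integration_on_powers.
Context (R : realType) (mu : {sigma_finite_measure set (measurableTypeR R) -> \bar R}).

Lemma mx_cons_tail n (z : measurableTypeR R * 'cV[R]_n) : tail_cV (mx_cons z) = z.2.
Proof. by apply/colP => i; rewrite mxE mx_consS. Qed.

Lemma measurable_tail_cV n : measurable_fun setT (@tail_cV R n).
Proof.
apply/measurable_fun_mxP => i j; under eq_fun do rewrite mxE.
exact: measurable_fun_coord.
Qed.

Lemma dot_cons n (s v : 'cV[R]_n.+1) :
  dot s v = s ord0 0 * v ord0 0 + dot (tail_cV s) (tail_cV v).
Proof. by rewrite /dot big_ord_recl; congr (_ + _); apply: eq_bigr => i _; rewrite !mxE. Qed.

Lemma ge0_integral_mpow0 (f : 'cV[R]_0 -> \bar R) :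
  measurable_fun setT f -> (\int[mpow mu 0]_v f v = f 0%R)%E.
Proof.
move=> mf; rewrite (eq_measure_integral \d_(0 : 'cV[R]_0))//.
by rewrite integral_dirac// diracT mul1e.
Qed.

Lemma ge0_integral_mpowS n (f : 'cV[R]_n.+1 -> \bar R) :
  measurable_fun setT f -> (forall v, (0 <= f v)%E) ->
  (\int[mpow mu n.+1]_v f v = \int[mu]_x \int[mpow mu n]_v f (mx_cons (x, v)))%E.
Proof.
move=> mf f0.
rewrite -(fubini_tonelli1 (m1 := mu) (m2 := mpow mu n) (fun z => f (mx_cons z)))//; last first.
  exact: (measurableT_comp mf (@measurable_mx_cons R n)).
rewrite -[RHS](ge0_integral_pushforward (@measurable_mx_cons R n) (mu \x mpow mu n)%E (D := setT))//.
Qed.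

Lemma integrable_mpowS n (f : 'cV[R]_n.+1 -> \bar R) :
  (mpow mu n.+1).-integrable setT f ->
  (mu \x mpow mu n)%E.-integrable setT (fun z => f (mx_cons z)).
Proof.
move=> /integrableP[mf foo]; apply/integrableP.
have mfc := measurableT_comp mf (@measurable_mx_cons R n); split=> //.
rewrite fubini_tonelli1//; last exact: measurableT_comp.
by move: foo; rewrite ge0_integral_mpowS//; exact: measurableT_comp.
Qed.

Lemma integral_mpowS n (f : 'cV[R]_n.+1 -> \bar R) :
  (mpow mu n.+1).-integrable setT f ->
  (\int[mpow mu n.+1]_v f v = \int[mu]_x \int[mpow mu n]_v f (mx_cons (x, v)))%E.
Proof.
move=> fi; have [mf foo] := integrableP _ _ _ fi; have fci := integrable_mpowS fi.
rewrite (integral12_prod_meas1 fci).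
rewrite -[RHS](integral_pushforward (@measurable_mx_cons R n) mf fci measurableT).
by [].
Qed.

(** Fubini for a product of a function of the first coordinate and a function
    of the remaining ones. *)
Lemma integrable_mpow_mul n (a : R -> R) (b : 'cV[R]_n -> R) :
  mu.-integrable setT (EFin \o a) -> (mpow mu n).-integrable setT (EFin \o b) ->
  (mpow mu n.+1).-integrable setT (fun v => (a (v ord0 0) * b (tail_cV v))%:E).
Proof.
move=> /integrableP[/measurable_EFinP ma aoo] /integrableP[/measurable_EFinP mb boo].
have m1 : measurable_fun setT (fun v : 'cV[R]_n.+1 => a (v ord0 0) * b (tail_cV v)).
  apply: measurable_funM.
    exact: (measurableT_comp (ma : measurable_fun setT (a : measurableTypeR R -> R)) (@measurable_fun_coord R n.+1 1 ord0 0)).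
  exact: (measurableT_comp mb (@measurable_tail_cV n)).
apply/integrableP; split; first exact/measurable_EFinP.
rewrite ge0_integral_mpowS//; last by apply: measurableT_comp => //; exact/measurable_EFinP.
rewrite (eq_integral (fun x : measurableTypeR R => `|(a x)%:E| * \int[mpow mu n]_v `|(b v)%:E|)%E); last first.
  move=> x _; rewrite -ge0_integralZl//; last first.
    by apply: measurableT_comp => //; exact/measurable_EFinP.
  apply: eq_integral => v _; rewrite mx_cons0 mx_cons_tail/=.
  by rewrite normrM EFinM.
rewrite ge0_integralZr//; last 2 first.
- by apply: measurableT_comp => //; exact/measurable_EFinP.
- by apply: integral_ge0.
by apply: lte_mul_pinfty => //; [exact: integral_ge0|rewrite ge0_fin_numE//; exact: integral_ge0].
Qed.

Lemma Rintegral_mpow_mul n (a : R -> R) (b : 'cV[R]_n -> R) :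
  mu.-integrable setT (EFin \o a) -> (mpow mu n).-integrable setT (EFin \o b) ->
  \int[mpow mu n.+1]_v (a (v ord0 0) * b (tail_cV v)) =
  \int[mu]_x a x * \int[mpow mu n]_v b v.
Proof.
move=> ia ib; rewrite /Rintegral (integral_mpowS (integrable_mpow_mul ia ib)).
rewrite -fineM; [|exact: integrable_fin_num|exact: integrable_fin_num].
congr fine; rewrite muleC.
have bfin : (\int[mpow mu n]_v (b v)%:E)%E \is a fin_num by exact: integrable_fin_num.
rewrite -(fineK bfin) -integralZl//.
apply: eq_integral => x _; rewrite fineK// muleC -integralZl//.
by apply: eq_integral => v _; rewrite mx_cons0 mx_cons_tail EFinM.
Qed.

End integration_on_powers.

(** * Product densities *)

Section product_densities.
Context (R : realType) (mu : {sigma_finite_measure set (measurableTypeR R) -> \bar R}).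
Variable w : R -> R.
Hypothesis w0 : forall x, 0 <= w x.
Hypothesis iw : mu.-integrable setT (EFin \o w).
Hypothesis w1 : \int[mu]_x w x = 1.

Definition prod_density n (v : 'cV[R]_n) : R := \prod_(i < n) w (v i 0).

Lemma prod_density_ge0 n (v : 'cV[R]_n) : 0 <= prod_density v.
Proof. by rewrite prodr_ge0. Qed.

Lemma prod_density_cons n (v : 'cV[R]_n.+1) :
  prod_density v = w (v ord0 0) * prod_density (tail_cV v).
Proof.
by rewrite /prod_density big_ord_recl; congr (_ * _); apply: eq_bigr => i _; rewrite mxE.
Qed.

Lemma integrable_prod_density n :
  (mpow mu n).-integrable setT (EFin \o @prod_density n).
Proof.
elim: n => [|n IH].
  apply/integrableP; split.
    apply/measurable_EFinP; rewrite (_ : @prod_density 0 = cst 1)//.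
    by apply/funext => v; rewrite /prod_density big_ord0.
  rewrite ge0_integral_mpow0 ?ltry//.
  apply/measurable_EFinP; apply: measurableT_comp => //.
  rewrite (_ : @prod_density 0 = cst 1)//.
  by apply/funext => v; rewrite /prod_density big_ord0.
have := integrable_mpow_mul iw IH; congr integrable.
by apply/funext => v /=; rewrite prod_density_cons.
Qed.

Lemma Rintegral_prod_density n : \int[mpow mu n]_v prod_density v = 1.
Proof.
elim: n => [|n IH].
  rewrite /Rintegral ge0_integral_mpow0/=; first by rewrite /prod_density big_ord0.
  apply/measurable_EFinP; rewrite (_ : @prod_density 0 = cst 1)//.
  by apply/funext => v; rewrite /prod_density big_ord0.
under eq_Rintegral do rewrite prod_density_cons.
by rewrite (Rintegral_mpow_mul iw (integrable_prod_density n)) IH w1 mulr1.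
Qed.

Lemma integrable_bounded_mul d (T : measurableType d) (m : {measure set T -> \bar R})
    (f g : T -> R) (M : R) :
  measurable_fun setT f -> (forall x, `|f x| <= M) -> m.-integrable setT (EFin \o g) ->
  m.-integrable setT (EFin \o (fun x => f x * g x)).
Proof.
move=> mf fM ig; apply: (@le_integrable _ _ _ _ setT _ _ (EFin \o (fun x => M * g x))) => //.
- apply/measurable_EFinP; apply: measurable_funM => //.
  by apply/measurable_EFinP; case/integrableP: ig.
- move=> x _ /=; rewrite lee_fin !normrM ler_wpM2r//.
  by rewrite (le_trans (fM x))// ler_norm.
- by have := integrableZl measurableT M ig.
Qed.

Hypothesis sin_w : forall s, \int[mu]_x (sin (s * x) * w x) = 0.

Lemma measurable_dot n (s : 'cV[R]_n) : measurable_fun setT (dot s).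
Proof. by apply: continuous_measurable_mxR; exact: continuous_dot. Qed.

Lemma measurable_sin : measurable_fun setT (@sin R).
Proof. by apply: continuous_measurable_fun; exact: continuous_sin. Qed.

Lemma measurable_cos : measurable_fun setT (@cos R).
Proof. by apply: continuous_measurable_fun; exact: continuous_cos. Qed.

Lemma integrable_cos_density n (s : 'cV[R]_n) :
  (mpow mu n).-integrable setT (EFin \o (fun v => cos (dot s v) * prod_density v)).
Proof.
apply: (@integrable_bounded_mul _ _ _ _ _ 1) (integrable_prod_density n) => [|x].
  exact: (measurableT_comp measurable_cos (measurable_dot s)).
exact: cos_max.
Qed.

Lemma integrable_sin_density n (s : 'cV[R]_n) :
  (mpow mu n).-integrable setT (EFin \o (fun v => sin (dot s v) * prod_density v)).
Proof.
apply: (@integrable_bounded_mul _ _ _ _ _ 1) (integrable_prod_density n) => [|x].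
  exact: (measurableT_comp measurable_sin (measurable_dot s)).
exact: sin_max.
Qed.

Let icos s : mu.-integrable setT (EFin \o (fun x => cos (s * x) * w x)).
Proof.
apply: (@integrable_bounded_mul _ _ _ _ _ 1) iw => [|x]; last exact: cos_max.
by apply: (measurableT_comp measurable_cos) => //; exact: measurable_funM.
Qed.

Let isin s : mu.-integrable setT (EFin \o (fun x => sin (s * x) * w x)).
Proof.
apply: (@integrable_bounded_mul _ _ _ _ _ 1) iw => [|x]; last exact: sin_max.
by apply: (measurableT_comp measurable_sin) => //; exact: measurable_funM.
Qed.

(** For a symmetric density the sine terms of the addition formula vanish, so
    the characteristic function of the product law is a product of cosine
    transforms. *)
Lemma Rintegral_cos_density n (s : 'cV[R]_n) :
  \int[mpow mu n]_v (cos (dot s v) * prod_density v) =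
  \prod_(i < n) \int[mu]_x (cos (s i 0 * x) * w x).
Proof.
elim: n s => [|n IH] s.
  rewrite big_ord0 -(Rintegral_prod_density 0); apply: eq_Rintegral => v _.
  by rewrite /dot big_ord0 cos0 mul1r.
rewrite big_ord_recl.
set s0 := s ord0 0; set s' := tail_cV s.
pose A (v : 'cV[R]_n.+1) := (cos (s0 * v ord0 0) * w (v ord0 0)) * (cos (dot s' (tail_cV v)) * prod_density (tail_cV v)).
pose B (v : 'cV[R]_n.+1) := (sin (s0 * v ord0 0) * w (v ord0 0)) * (sin (dot s' (tail_cV v)) * prod_density (tail_cV v)).
have iA : (mpow mu n.+1).-integrable setT (EFin \o A).
  exact: (integrable_mpow_mul (icos s0) (integrable_cos_density s')).
have iB : (mpow mu n.+1).-integrable setT (EFin \o B).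
  exact: (integrable_mpow_mul (isin s0) (integrable_sin_density s')).
transitivity (\int[mpow mu n.+1]_v (A v - B v)).
  apply: eq_Rintegral => v _; rewrite dot_cons -/s0 -/s' cosD prod_density_cons /A /B.
  by ring.
rewrite RintegralB// /A /B.
rewrite (Rintegral_mpow_mul (icos s0) (integrable_cos_density s')).
rewrite (Rintegral_mpow_mul (isin s0) (integrable_sin_density s')).
rewrite sin_w mul0r subr0 IH; congr (_ * _).
by apply: eq_bigr => i _; rewrite mxE.
Qed.

Lemma Rintegral_sin_density n (s : 'cV[R]_n) :
  \int[mpow mu n]_v (sin (dot s v) * prod_density v) = 0.
Proof.
elim: n s => [|n IH] s.
  rewrite /Rintegral (eq_integral (fun=> 0%E)) ?integral0// => v _.
  by rewrite /dot big_ord0 sin0 mul0r.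
set s0 := s ord0 0; set s' := tail_cV s.
have iA := integrable_mpow_mul (isin s0) (integrable_cos_density s').
have iB := integrable_mpow_mul (icos s0) (integrable_sin_density s').
under eq_Rintegral do rewrite dot_cons -/s0 -/s' sinD mulrDl prod_density_cons
  (mulrACA (sin _)) (mulrACA (cos _)).
rewrite RintegralD//.
rewrite (Rintegral_mpow_mul (isin s0) (integrable_cos_density s')).
rewrite (Rintegral_mpow_mul (icos s0) (integrable_sin_density s')).
by rewrite sin_w IH mul0r mulr0 addr0.
Qed.

Variable m2 : R.
Hypothesis ixw : mu.-integrable setT (EFin \o (fun x => x * w x)).
Hypothesis ix2w : mu.-integrable setT (EFin \o (fun x => x ^+ 2 * w x)).
Hypothesis xw : \int[mu]_x (x * w x) = 0.
Hypothesis x2w : \int[mu]_x (x ^+ 2 * w x) = m2.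

(** The coordinates are centred and uncorrelated under the product law. *)
Lemma sqr_dot_density n (s : 'cV[R]_n) :
  [/\ (mpow mu n).-integrable setT (EFin \o (fun v => dot s v * prod_density v)),
      (mpow mu n).-integrable setT (EFin \o (fun v => dot s v ^+ 2 * prod_density v)) &
      \int[mpow mu n]_v (dot s v ^+ 2 * prod_density v) = m2 * \sum_(i < n) s i 0 ^+ 2].
Proof.
elim: n s => [|n IH] s.
  have i1 : (mpow mu 0).-integrable setT (EFin \o (fun v : 'cV[R]_0 => 0 : R)).
    by have := integrable0 (mpow mu 0) (@setT 'cV[R]_0).
  split; rewrite ?big_ord0 ?mulr0.
  - rewrite (_ : (fun v => _) = (fun=> 0))//.
    by apply/funext => v; rewrite /dot big_ord0 mul0r.
  - rewrite (_ : (fun v => _) = (fun=> 0))//.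
    by apply/funext => v; rewrite /dot big_ord0 expr0n mul0r.
  - under eq_Rintegral do rewrite /dot big_ord0 expr0n mul0r.
    by rewrite /Rintegral integral0.
have [i1 i2 e2] := IH (tail_cV s).
set s0 := s ord0 0; set s' := tail_cV s.
have i0 := integrable_prod_density n.
have sx : mu.-integrable setT (EFin \o (fun x => s0 * (x * w x))).
  by have := integrableZl measurableT s0 ixw.
have sx2 : mu.-integrable setT (EFin \o (fun x => s0 ^+ 2 * (x ^+ 2 * w x))).
  by have := integrableZl measurableT (s0 ^+ 2) ix2w.
have s2x : mu.-integrable setT (EFin \o (fun x => 2 * s0 * (x * w x))).
  by have := integrableZl measurableT (2 * s0) ixw.
pose x0 (v : 'cV[R]_n.+1) := v ord0 0.
pose A v := (s0 * (x0 v * w (x0 v))) * prod_density (tail_cV v).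
pose B v := w (x0 v) * (dot s' (tail_cV v) * prod_density (tail_cV v)).
pose C v := (s0 ^+ 2 * (x0 v ^+ 2 * w (x0 v))) * prod_density (tail_cV v).
pose D v := (2 * s0 * (x0 v * w (x0 v))) * (dot s' (tail_cV v) * prod_density (tail_cV v)).
pose E v := w (x0 v) * (dot s' (tail_cV v) ^+ 2 * prod_density (tail_cV v)).
have iA : (mpow mu n.+1).-integrable setT (EFin \o A) by exact: (integrable_mpow_mul sx i0).
have iB : (mpow mu n.+1).-integrable setT (EFin \o B) by exact: (integrable_mpow_mul iw i1).
have iC : (mpow mu n.+1).-integrable setT (EFin \o C) by exact: (integrable_mpow_mul sx2 i0).
have iD : (mpow mu n.+1).-integrable setT (EFin \o D) by exact: (integrable_mpow_mul s2x i1).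
have iE : (mpow mu n.+1).-integrable setT (EFin \o E) by exact: (integrable_mpow_mul iw i2).
have ABE : (fun v : 'cV[R]_n.+1 => dot s v * prod_density v) = (fun v => A v + B v).
  apply/funext => v; rewrite dot_cons -/s0 -/s' prod_density_cons /A /B /x0; ring.
have CDE : (fun v : 'cV[R]_n.+1 => dot s v ^+ 2 * prod_density v) = (fun v => C v + (D v + E v)).
  apply/funext => v; rewrite dot_cons -/s0 -/s' prod_density_cons /C /D /E /x0; ring.
have iDE : (mpow mu n.+1).-integrable setT (EFin \o (fun v => D v + E v)).
  by have := integrableD measurableT iD iE.
rewrite ABE CDE; split.
- by have := integrableD measurableT iA iB.
- by have := integrableD measurableT iC iDE.
rewrite RintegralD// RintegralD// /C /D /E.
rewrite (Rintegral_mpow_mul sx2 i0) (Rintegral_mpow_mul s2x i1) (Rintegral_mpow_mul iw i2).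
rewrite w1 mul1r e2 Rintegral_prod_density mulr1 RintegralZl// RintegralZl// xw x2w.
rewrite mulr0 mul0r add0r big_ord_recl -/s0 mulrDr mulrC; congr (_ + _ * _).
by apply: eq_bigr => i _; rewrite mxE.
Qed.

End product_densities.

(** * Symmetry and scaling of Lebesgue integrals *)

Section lebesgue_symmetries.
Context (R : realType).
Local Notation leb := (@lebesgue_measure R).
Let T := measurableTypeR R.

Let measurable_scale (c : R) : measurable_fun setT ( *%R c : T -> T).
Proof. exact: (@mulrl_measurable R). Qed.

Let push (c : R) : {measure set T -> \bar R} :=
  measure_function_pushforward__canonical__measure_function_Measure leb (measurable_scale c).

Let pushN1 A : measurable A -> leb A = push (-1) A.
Proof.
apply: lebesgue_measure_unique => _ [[a b] _ <-].
rewrite /push/= /pushforward.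
rewrite (_ : _ @^-1` _ = `[- b, - a[%classic); last first.
  by apply/seteqP; split=> x /=; rewrite !in_itv/= mulN1r ltrNr lerNl andbC.
rewrite !lebesgue_measure_itv/= !lte_fin ltrN2; case: ifP => // _.
by rewrite -!EFinB opprK addrC.
Qed.

Lemma Rintegral_odd (f : R -> R) : leb.-integrable setT (EFin \o f) ->
  (forall x, f (- x) = - f x) -> \int[leb]_x f x = 0.
Proof.
move=> fi odd; have [mf _] := integrableP _ _ _ fi.
have ifN : leb.-integrable setT ((EFin \o f) \o ( *%R (-1) : T -> T)).
  rewrite (_ : _ \o _ = EFin \o (fun x => -1 * f x)).
    by have := integrableZl measurableT (-1) fi.
  by apply/funext => x /=; rewrite !mulN1r odd.
have e : (\int[leb]_y (f y)%:E = \int[leb]_y (f (-1 * y)%R)%:E)%E.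
  apply: etrans (integral_pushforward (measurable_scale (-1)) mf ifN measurableT).
  by apply: eq_measure_integral => A mA _; exact: pushN1.
have : \int[leb]_y f y = - \int[leb]_y f y.
  rewrite {1}/Rintegral e -[RHS]mulN1r -RintegralZl//; congr fine; apply: eq_integral => x _ /=.
  by rewrite !mulN1r odd.
by lra.
Qed.

Let push_scale c A : 0 < c -> measurable A -> (leb A = c%:E * push c A)%E.
Proof.
move=> c0; have c0' : 0 <= c by exact: ltW.
move: A; apply: (@lebesgue_measure_unique R (mscale (NngNum c0') (push c))).
move=> _ [[a b] _ <-].
transitivity (c%:E * leb (( *%R c) @^-1` `]a, b]%classic))%E; last by [].
rewrite (_ : _ @^-1` _ = `]a / c, b / c]%classic); last first.
  apply/seteqP; split=> x /=; rewrite !in_itv/= ltr_pdivrMr// ler_pdivlMr//;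
  by rewrite [x * c]mulrC.
rewrite !lebesgue_measure_itv/= !lte_fin ltr_pM2r ?invr_gt0//; case: ifP => // _.
  by rewrite -!EFinB -EFinM -mulrBl mulrCA divff ?mulr1// gt_eqF.
by rewrite mule0.
Qed.

Lemma ge0_integral_lebesgue_scale (f : R -> \bar R) c : 0 < c ->
  measurable_fun setT f -> (forall x, (0 <= f x)%E) ->
  (\int[leb]_x f x = c%:E * \int[leb]_x f (c * x)%R)%E.
Proof.
move=> c0 mf f0; have c0' : 0 <= c by exact: ltW.
transitivity (\int[mscale (NngNum c0') (push c)]_x f x)%E.
  by apply: eq_measure_integral => A mA _; exact: push_scale.
rewrite ge0_integral_mscale//; congr (_ * _)%E.
exact: (ge0_integral_pushforward (measurable_scale c) leb (D := setT)).
Qed.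

Lemma ge0_integral_lebesgue_cV_scale n (f : 'cV[R]_n -> \bar R) c : 0 < c ->
  measurable_fun setT f -> (forall x, (0 <= f x)%E) ->
  (\int[@lebesgue_cV R n]_x f x =
   (c ^+ n)%:E * \int[@lebesgue_cV R n]_x f (c *: x)%R)%E.
Proof.
move=> c0; elim: n f => [|n IH] f mf f0.
  rewrite expr0 mul1e; apply: eq_integral => x _; congr f.
  by apply/colP => -[].
have mcons (x : T) : measurable_fun setT (fun v : 'cV[R]_n => mx_cons (x, v)).
  exact: (measurableT_comp (@measurable_mx_cons R n) (measurable_pair1 x)).
have mZ m : measurable_fun setT (fun v : 'cV[R]_m => c *: v).
  apply/measurable_fun_mxP => i j; under eq_fun do rewrite mxE.
  by apply: measurable_funM => //; exact: measurable_fun_coord.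
have consZ (x : R) (v : 'cV[R]_n) : mx_cons (c * x, c *: v) = c *: mx_cons (x, v).
  apply/colP => i; have [j|] := unliftP ord0 i => ->; rewrite [RHS]mxE.
    by rewrite !mx_consS mxE.
  by rewrite !mx_cons0.
have Fm (g : 'cV[R]_n.+1 -> \bar R) : measurable_fun setT g -> (forall v, (0 <= g v)%E) ->
    measurable_fun setT (fun x : T => \int[mpow leb n]_v g (mx_cons (x, v)))%E.
  move=> mg g0.
  apply: (measurable_fun_fubini_tonelli_F (m2 := mpow leb n) (fun z => g (mx_cons z))) => //.
  exact: (measurableT_comp mg (@measurable_mx_cons R n)).
rewrite (ge0_integral_mpowS leb mf f0).
rewrite (ge0_integral_lebesgue_scale c0); last 2 first.
- exact: Fm.
- by move=> x; exact: integral_ge0.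
rewrite (ge0_integral_mpowS leb (measurableT_comp mf (mZ n.+1)))//=.
rewrite exprS EFinM -muleA; congr (_ * _)%E.
rewrite -ge0_integralZl_EFin//; last 3 first.
- by move=> x _; exact: integral_ge0.
- by apply: (Fm (fun v => f (c *: v))) => //; exact: (measurableT_comp mf (mZ n.+1)).
- by rewrite exprn_ge0// ltW.
apply: eq_integral => x _; rewrite IH//; last exact: (measurableT_comp mf (mcons _)).
by congr (_ * _)%E; apply: eq_integral => v _; rewrite consZ.
Qed.

End lebesgue_symmetries.

(** * Generalized Gaussian integrals *)

Section generalized_gaussian_moments.
Context (R : realType).
Local Notation leb := (@lebesgue_measure R).

Lemma le_powR_root (q x y : R) : 0 < q -> 0 <= x -> 0 <= y ->
  (x `^ q <= y) = (x <= y `^ q^-1).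
Proof.
move=> q0 x0 y0; have qn : q != 0 by rewrite gt_eqF.
apply/idP/idP => h.
  rewrite -(powRr1 x0) -(divff qn) powRrM ge0_ler_powR ?nnegrE ?powR_ge0//.
  by rewrite invr_ge0 ltW.
rewrite -(powRr1 y0) -(mulVf qn) powRrM ge0_ler_powR ?nnegrE ?powR_ge0//.
exact: ltW.
Qed.

Lemma integral_even_power m (r : R) : 0 < r ->
  (\int[leb]_(x in `[(- r)%R, r]) (x ^+ m.*2)%:E =
   (2 / (m.*2.+1)%:R * r ^+ m.*2.+1)%:E)%E.
Proof.
move=> r0; pose P : {poly R} := (m.*2.+1)%:R^-1 *: 'X^(m.*2.+1).
have n0 : (m.*2.+1)%:R != 0 :> R by rewrite pnatr_eq0.
have dP (x : R) : is_derive x 1 (horner P) (x ^+ m.*2).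
  have := is_derive_poly P x.
  rewrite /P derivZ derivXn hornerZ hornerMn hornerXn/= -[x ^+ _ *+ _]mulr_natl.
  by rewrite mulrA mulVf// mul1r.
have cP : continuous (horner P) by exact: continuous_horner.
have PE x : P.[x] = (m.*2.+1)%:R^-1 * x ^+ m.*2.+1 by rewrite hornerZ hornerXn.
rewrite (@continuous_FTC2 _ _ (horner P)) ?PE.
- rewrite -EFinB; congr (_%:E).
  have -> : (- r) ^+ m.*2.+1 = - r ^+ m.*2.+1.
    by rewrite exprNn -signr_odd/= odd_double expr1 mulN1r.
  by field.
- by rewrite gtrN.
- by apply: continuous_subspaceT => x; exact: exprn_continuous.
- split.
  + by move=> x _; have [] := dP x.
  + by apply: cvg_at_right_filter; exact: cP.
  + by apply: cvg_at_left_filter; exact: cP.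
- by move=> x _; rewrite derive1E; have [_ ->] := dP x.
Qed.

(** The layer-cake formula: the sublevel sets of [|x|^q / c] are intervals. *)
Lemma integral_generalized_gaussian m (q c : R) : 0 < q -> 0 < c ->
  (\int[leb]_x (x ^+ m.*2 * expR (- (`|x| `^ q / c)))%:E =
   (2 / (m.*2.+1)%:R * c `^ ((m.*2.+1)%:R / q) * Gamma ((m.*2.+1)%:R / q + 1))%:E)%E.
Proof.
move=> q0 c0; set b := _ / q.
have mu : measurable_fun setT (fun x : measurableTypeR R => `|x : R| `^ q / c).
  apply: measurable_funM => //; apply: (measurableT_comp (measurable_powR q)) => //.
have mh : measurable_fun setT (fun x : measurableTypeR R => (x : R) ^+ m.*2).
  exact: measurable_funX.
rewrite (layer_cake leb mu mh); last 2 first.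
- by move=> x; rewrite divr_ge0 ?powR_ge0// ltW.
- by move=> x; rewrite -mul2n exprM exprn_ge0// sqr_ge0.
have b0 : 0 <= b by rewrite divr_ge0// ltW.
rewrite EFinM -(integral_Gamma (ltr_wpDl b0 ltr01)) -ge0_integralZl_EFin//; last 3 first.
- by move=> t _; rewrite lee_fin; exact: mulr_ge0 (powR_ge0 _ _) (expR_ge0 _).
- apply/measurable_EFinP/measurable_funTS; apply: measurable_funM.
    exact: measurable_powR.
  by apply: measurableT_comp => //; exact: measurableT_comp.
- by rewrite mulr_ge0 ?powR_ge0// divr_ge0.
apply: eq_integral => t; rewrite inE/= in_itv/= andbT => t0.
rewrite (_ : [set y | _] = `[(- (c * t) `^ q^-1), (c * t) `^ q^-1]%classic); last first.
  apply/seteqP; split=> x /=; rewrite in_itv/= -ler_norml ler_pdivrMr// mulrC -le_powR_root//;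
  by rewrite mulr_ge0// ltW.
rewrite integral_even_power ?powR_gt0 ?mulr_gt0//.
rewrite -EFinM addrK; congr (_%:E).
rewrite -powR_mulrn ?powR_ge0// -powRrM (mulrC q^-1) -/b powRM ?(ltW c0) ?(ltW t0)//.
by ring.
Qed.

End generalized_gaussian_moments.

Definition lp_sum (R : realType) (p : R) n (x : 'cV[R]_n) : R :=
  \sum_(i < n) `|x i 0| `^ p.

Section lp_ball_mixture.
Context (R : realType) (p : R) (n : nat).
Hypotheses (p0 : 0 < p) (n0 : (0 < n)%N).
Local Notation leb := (@lebesgue_measure R).
Let a : R := n%:R / p.
Let K : set 'cV[R]_n := [set x | lp_sum p x <= n%:R].

Lemma measurable_lp_sum m : measurable_fun setT (@lp_sum R p m).
Proof.
apply: measurable_sum => i; apply: (measurableT_comp (measurable_powR p)) => //.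
by apply: measurableT_comp => //; exact: measurable_fun_coord.
Qed.

Lemma lp_sum_ge0 m (x : 'cV[R]_m) : 0 <= lp_sum p x.
Proof. by rewrite sumr_ge0// => i _; rewrite powR_ge0. Qed.

Lemma lp_sumZ m c (x : 'cV[R]_m) : 0 <= c -> lp_sum p (c *: x) = c `^ p * lp_sum p x.
Proof.
move=> c0; rewrite /lp_sum mulr_sumr; apply: eq_bigr => i _.
by rewrite mxE normrM ger0_norm// powRM.
Qed.

(** The layer-cake formula: the sublevel sets of [lp_sum p x / p] are the dilates
    of [K], and [a = n / p] turns the Jacobian [c^n] into [(t / a)^a]. *)
Lemma integral_lp_mixture (h : 'cV[R]_n -> R) : measurable_fun setT h ->
  (forall x, 0 <= h x) ->
  (\int[@lebesgue_cV R n]_x (h x * expR (- (lp_sum p x / p)))%:E =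
   \int[leb]_(t in `]0%R, +oo[) ((expR (- t) * (t / a) `^ a)%:E *
     \int[@lebesgue_cV R n]_(x in K) (h ((t / a) `^ p^-1 *: x)%R)%:E))%E.
Proof.
move=> mh h0; have a0 : 0 < a by rewrite divr_gt0// ltr0n.
have mZ c : measurable_fun setT (fun v : 'cV[R]_n => c *: v).
  apply/measurable_fun_mxP => i j; under eq_fun do rewrite mxE.
  by apply: measurable_funM => //; exact: measurable_fun_coord.
have mu : measurable_fun setT (fun x : 'cV[R]_n => lp_sum p x / p).
  by apply: measurable_funM; [exact: measurable_lp_sum|exact: measurable_cst].
have u0 (x : 'cV[R]_n) : 0 <= lp_sum p x / p by rewrite divr_ge0 ?lp_sum_ge0// ltW.
rewrite (layer_cake (@lebesgue_cV R n) mu mh u0 h0).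
apply: eq_integral => t; rewrite inE/= in_itv/= andbT => t0.
have ta0 : 0 < t / a by rewrite divr_gt0.
set c := (t / a) `^ p^-1; have c0 : 0 < c by rewrite powR_gt0.
have cp : c `^ p = t / a.
  by rewrite /c -powRrM mulVf ?gt_eqF// powRr1// ltW.
have cn : c ^+ n = (t / a) `^ a.
  by rewrite -powR_mulrn ?powR_ge0// /c -powRrM (mulrC p^-1).
rewrite EFinM -muleA; congr (_ * _)%E.
have mK : measurable K.
  rewrite (_ : K = @lp_sum R p n @^-1` `]-oo, n%:R]); last first.
    by apply/seteqP; split=> x /=; rewrite in_itv.
  by rewrite -[X in measurable X]setTI; exact: measurable_lp_sum.
have mS : measurable [set y : 'cV[R]_n | lp_sum p y / p <= t].
  rewrite (_ : mkset _ = @lp_sum R p n @^-1` `]-oo, t * p]); last first.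
    by apply/seteqP; split=> x /=; rewrite in_itv/= ler_pdivrMr.
  by rewrite -[X in measurable X]setTI; exact: measurable_lp_sum.
rewrite integral_mkcond (ge0_integral_lebesgue_cV_scale c0); last 2 first.
- by apply/(measurable_restrictT _ _).1 => //; exact/measurable_EFinP/measurable_funTS.
- by move=> x; rewrite patchE; case: ifPn => // _; rewrite lee_fin.
rewrite cn; congr (_ * _)%E; rewrite [RHS]integral_mkcond.
apply: eq_integral => x _; rewrite !patchE.
suff -> : (c *: x \in [set y | lp_sum p y / p <= t]) = (x \in K) by [].
apply/idP/idP; rewrite !inE /K/= lp_sumZ ?(ltW c0)// cp ler_pdivrMr//;
  by rewrite -ler_pdivlMl// invf_div (_ : a / t * (t * p) = n%:R)// /a; field;
  rewrite !gt_eqF.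
Qed.

End lp_ball_mixture.

(** * Cosine transform of the normal law *)

Section gaussian_cosine_transform.
Context (R : realType) (s : R).
Hypothesis s0 : 0 < s.
Local Notation leb := (@lebesgue_measure R).
Local Notation pdf := (normal_pdf 0 s).

Lemma integral_normal_prob (f : R -> \bar R) : (normal_prob 0 s).-integrable setT f ->
  (\int[normal_prob 0 s]_x f x = \int[leb]_x (f x * (pdf x)%:E))%E.
Proof.
move=> fi; have dom := @normal_prob_dominates R 0 s.
have ipdf := @integrable_normal_pdf R 0 s.
rewrite -(Radon_Nikodym_change_of_variables dom)//=.
have mf := measurable_int _ fi.
apply: ae_eq_integral => //.
- apply: emeasurable_funM; first exact: mf.
  apply: (measurable_int leb).
  apply: (integrableS _ _ (@subsetT _ _)) => //=.
  by apply: Radon_Nikodym_integrable; exact: dom.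
- exact: (emeasurable_funM mf (measurable_int _ ipdf)).
apply: ae_eqe_mul2l => /=; rewrite Radon_NikodymE//=; case: cid => /= h [_ ih hE].
by apply: (integral_ae_eq measurableT ih (measurable_int _ ipdf)) => E _ mE; rewrite -hE.
Qed.

Let pdfE x : pdf x = normal_peak s * expR (- (`|x| `^ 2 / (2 * s ^+ 2))).
Proof.
rewrite normal_pdfE ?gt_eqF// /normal_fun subr0 powR_mulrn// real_normK ?num_real//.
by rewrite mulNr mulr_natl.
Qed.

Let M m : R := normal_peak s * (2 / (m.*2.+1)%:R * (2 * s ^+ 2) `^ ((m.*2.+1)%:R / 2) *
  Gamma ((m.*2.+1)%:R / 2 + 1)).

Let moment m : (\int[leb]_x (x ^+ m.*2 * pdf x)%:E = (M m)%:E)%E.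
Proof.
have c0 : 0 < 2 * s ^+ 2 by rewrite mulr_gt0// exprn_gt0.
rewrite /M EFinM -(integral_generalized_gaussian m (ltr0n R 2) c0).
rewrite -ge0_integralZl_EFin//.
- by apply: eq_integral => x _; rewrite -EFinM pdfE mulrCA.
- by move=> x _; rewrite lee_fin mulr_ge0 ?expR_ge0// -mul2n exprM exprn_ge0// sqr_ge0.
- apply/measurable_EFinP; apply: measurable_funM; first exact: measurable_funX.
  apply: measurableT_comp => //; apply: measurableT_comp => //.
  apply: measurable_funM => //; apply: (measurableT_comp (measurable_powR 2)) => //.
- exact: normal_peak_ge0.
Qed.

Let M0 : M 0 = 1.
Proof.
have := moment 0; under eq_integral do rewrite double0 expr0 mul1r.
by rewrite integral_normal_pdf => -[].
Qed.

Let MS m : M m.+1 = (m.*2.+1)%:R * s ^+ 2 * M m.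
Proof.
rewrite /M doubleS; set b : R := (m.*2.+1)%:R / 2.
have b0 : 0 < b by rewrite divr_gt0.
have -> : (m.*2.+3)%:R / 2 = b + 1 :> R by rewrite /b -[m.*2.+3]addn2 natrD mulrDl divff.
rewrite (Gamma_rec (addr_gt0 b0 ltr01)) powRD; last by rewrite (gt_eqF (addr_gt0 b0 ltr01)).
have c0 : 0 <= 2 * s ^+ 2 by exact: mulr_ge0 (ler0n _ _) (sqr_ge0 _).
rewrite powRr1//.
have n1 : (m.*2.+1)%:R != 0 :> R by rewrite pnatr_eq0.
have n3 : (m.*2.+3)%:R != 0 :> R by rewrite pnatr_eq0.
have e3 : (m.*2.+3)%:R = b * 2 + 2 :> R by rewrite /b divfK// -[m.*2.+3]addn2 natrD.
have e1 : (m.*2.+1)%:R = b * 2 :> R by rewrite /b divfK.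
rewrite e3 e1; field.
by apply/andP; split; rewrite gt_eqF//; lra.
Qed.

Let M_closed m : M m / (m.*2)`!%:R = (s ^+ 2 / 2) ^+ m / m`!%:R.
Proof.
elim: m => [|m IH]; first by rewrite M0 double0 fact0 expr0.
rewrite MS doubleS !factS !natrM (exprS (s ^+ 2 / 2)).
have F0 : m`!%:R != 0 :> R by rewrite pnatr_eq0 -lt0n fact_gt0.
have F2 : (m.*2)`!%:R != 0 :> R by rewrite pnatr_eq0 -lt0n fact_gt0.
transitivity (s ^+ 2 / (m.*2.+2)%:R * (M m / (m.*2)`!%:R)).
  have n1 : (m.*2.+1)%:R != 0 :> R by rewrite pnatr_eq0.
  have n2 : (m.*2.+2)%:R != 0 :> R by rewrite pnatr_eq0.
  move: (M m) ((m.*2)`!%:R : R) F2 ((m.*2.+1)%:R : R) n1 ((m.*2.+2)%:R : R) n2.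
  by move=> x F F20 a a0 b b0; field; rewrite F20 a0 b0.
rewrite IH (_ : (m.*2.+2)%:R = 2 * m.+1%:R :> R); last by rewrite -natrM mul2n.
have n1 : m.+1%:R != 0 :> R by rewrite pnatr_eq0.
move: (m`!%:R : R) F0 (m.+1%:R : R) n1 => F F0 a a0.
by field; rewrite F0 a0.
Qed.

Let imoment m : leb.-integrable setT (EFin \o (fun x => x ^+ m.*2 * pdf x)).
Proof.
apply/integrableP; split.
  apply/measurable_EFinP; apply: measurable_funM; first exact: measurable_funX.
  exact: measurable_normal_pdf.
rewrite (eq_integral (fun x : measurableTypeR R => (x ^+ m.*2 * pdf x)%:E)) ?moment ?ltry//.
move=> x _; rewrite gee0_abs// lee_fin mulr_ge0 ?normal_pdf_ge0//.
by rewrite -mul2n exprM exprn_ge0// sqr_ge0.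
Qed.

(** The Taylor polynomials of the cosine integrate to those of the exponential
    of [- s^2 t^2 / 2], because the even moments are (2m)! / (2^m m!) s^2m. *)
Lemma gaussian_cosine_transform t :
  \int[leb]_x (cos (t * x) * pdf x) = expR (- (s ^+ 2 * t ^+ 2 / 2)).
Proof.
set z := s ^+ 2 * t ^+ 2 / 2; set I := LHS.
have z0 : 0 <= z by rewrite divr_ge0// mulr_ge0// sqr_ge0.
have Zk k : t ^+ k.*2 * (M k / (k.*2)`!%:R) = z ^+ k / k`!%:R.
  by rewrite M_closed mulrA -mul2n exprM -exprMn mulrA [t ^+ 2 * _]mulrC.
have ipdf : leb.-integrable setT (EFin \o pdf) by exact: integrable_normal_pdf.
have icos : leb.-integrable setT (EFin \o (fun x => cos (t * x) * pdf x)).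
  have mc : measurable_fun setT (fun x : measurableTypeR R => cos (t * x)).
    by apply: (measurableT_comp (@measurable_cos R)) => //; exact: measurable_funM.
  have c1 (x : measurableTypeR R) : `|cos (t * x)| <= 1 by exact: cos_max.
  exact: (integrable_bounded_mul mc c1 ipdf).
have iterm k c : leb.-integrable setT (EFin \o (fun x => c * (x ^+ k.*2 * pdf x))).
  by have := integrableZl measurableT c (imoment k).
have Rmoment k : \int[leb]_x (x ^+ k.*2 * pdf x) = M k by rewrite /Rintegral moment.
pose T m (x : R) := \sum_(k < m) (-1) ^+ k * ((t * x) ^+ k.*2 / (k.*2)`!%:R) * pdf x.
have IT m : leb.-integrable setT (EFin \o T m) /\
    \int[leb]_x T m x = \sum_(k < m) (- z) ^+ k / k`!%:R.
  elim: m => [|m [i1 e1]].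
    rewrite big_ord0 (_ : T 0%N = cst 0); last by apply/funext => x; rewrite /T big_ord0.
    by split; [have := integrable0 leb setT|rewrite /Rintegral integral0].
  pose c := (-1) ^+ m * (t ^+ m.*2 / (m.*2)`!%:R).
  have TE : T m.+1 = (fun x => T m x + c * (x ^+ m.*2 * pdf x)).
    by apply/funext => x; rewrite /T big_ord_recr/= exprMn /c; congr (_ + _); ring.
  rewrite TE; split; first by have := integrableD measurableT i1 (iterm m c).
  rewrite RintegralD// e1 RintegralZl// Rmoment big_ord_recr/=; congr (_ + _).
  rewrite [in RHS]exprNn -[in RHS]mulrA -Zk /c; ring.
have bound m : `|I - \sum_(k < m) (- z) ^+ k / k`!%:R| <= z ^+ m / m`!%:R.
  have [iT <-] := IT m; rewrite /I -RintegralB//.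
  have iB : leb.-integrable setT (EFin \o (fun x => cos (t * x) * pdf x - T m x)).
    by have := integrableB measurableT icos iT.
  rewrite (le_trans (le_normr_Rintegral _ iB))// -Zk.
  have -> : t ^+ m.*2 * (M m / (m.*2)`!%:R) =
      \int[leb]_x (t ^+ m.*2 / (m.*2)`!%:R * (x ^+ m.*2 * pdf x)).
    by rewrite RintegralZl// Rmoment; ring.
  apply: le_Rintegral => //; first exact: integrable_norm iB.
  move=> x _; rewrite /T -mulr_suml -mulrBl normrM (ger0_norm (normal_pdf_ge0 _ _ _)).
  rewrite [leRHS](_ : _ = (t * x) ^+ m.*2 / (m.*2)`!%:R * pdf x); last by rewrite exprMn; ring.
  by rewrite ler_wpM2r ?normal_pdf_ge0// cos_taylor.
have c1 : (fun m => \sum_(k < m) (- z) ^+ k / k`!%:R) @ \oo --> expR (- z).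
  have := @is_cvg_series_exp_coeff R (- z).
  rewrite /expR => /cvg_ex[l cl]; rewrite (cvg_lim _ cl)//.
  apply: cvg_trans cl; apply: near_eq_cvg; apply: nearW => m.
  by rewrite /series/= big_mkord.
have c2 : (fun m => \sum_(k < m) (- z) ^+ k / k`!%:R) @ \oo --> I.
  apply/cvgrPdist_le => e e0.
  have := @cvg_exp_coeff R z => /cvgrPdist_le /(_ _ e0); apply: filterS => m.
  rewrite sub0r normrN /exp_coeff => ze; apply: (le_trans (bound m)).
  by rewrite (le_trans _ ze)// ler_norm.
exact: (cvg_unique _ c2 c1).
Qed.

Lemma Rintegral_normal_prob (f : R -> R) :
  (normal_prob 0 s).-integrable setT (EFin \o f) ->
  \int[normal_prob 0 s]_x f x = \int[leb]_x (f x * pdf x).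
Proof.
by move=> fi; rewrite /Rintegral integral_normal_prob.
Qed.

End gaussian_cosine_transform.

(** * Concentration of the gamma law *)

Section gamma_density.
Context (R : realType) (a : R).
Hypothesis a1 : 1 <= a.
Local Notation leb := (@lebesgue_measure R).

Definition gamma_density (t : R) : R := t `^ a * expR (- t) / Gamma (a + 1).

Let a0 : 0 < a. Proof. exact: lt_le_trans a1. Qed.
Let G0 : 0 < Gamma (a + 1). Proof. by apply: Gamma_gt0; rewrite addr_gt0. Qed.

Lemma gamma_density_ge0 t : 0 <= gamma_density t.
Proof. by rewrite divr_ge0 ?(ltW G0)//; exact: mulr_ge0 (powR_ge0 _ _) (expR_ge0 _). Qed.

Lemma measurable_gamma_density (D : set (measurableTypeR R)) :
  measurable_fun D (gamma_density : measurableTypeR R -> R).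
Proof.
apply: measurable_funTS; apply: measurable_funM => //; apply: measurable_funM.
  exact: measurable_powR.
by apply: measurableT_comp => //; exact: measurableT_comp.
Qed.

Let mI : measurable (`]0%R, +oo[%classic : set (measurableTypeR R)).
Proof. exact: measurable_itv. Qed.

Let moment k : (\int[leb]_(t in `]0%R, +oo[) (t ^+ k * gamma_density t)%:E =
  (Gamma (a + k%:R + 1) / Gamma (a + 1))%:E)%E.
Proof.
have ak : 0 < a + k%:R + 1 by rewrite addr_gt0// ltr_pwDl.
rewrite EFinM -(integral_Gamma ak) -ge0_integralZr//.
- apply: eq_integral => t; rewrite inE/= in_itv/= andbT => t0.
  rewrite -EFinM addrK powRD; last by rewrite [t == 0]gt_eqF ?implybT.
  by rewrite powR_mulrn ?(ltW t0)// /gamma_density; congr (_%:E); ring.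
- apply/measurable_EFinP/measurable_funTS; apply: measurable_funM; first exact: measurable_powR.
  by apply: measurableT_comp => //; exact: measurableT_comp.
- by move=> t _; rewrite lee_fin; exact: mulr_ge0 (powR_ge0 _ _) (expR_ge0 _).
- by rewrite lee_fin invr_ge0 ltW.
Qed.

Lemma integral_gamma_density :
  (\int[leb]_(t in `]0%R, +oo[) (gamma_density t)%:E = 1)%E.
Proof.
have := moment 0; under eq_integral do rewrite expr0 mul1r.
by rewrite addr0 divff ?gt_eqF.
Qed.

Let I k c : leb.-integrable `]0%R, +oo[ (EFin \o (fun t : R => c * (t ^+ k * gamma_density t))).
Proof.
have mf : measurable_fun (`]0%R, +oo[%classic : set (measurableTypeR R))
    (fun t : measurableTypeR R => ((t : R) ^+ k * gamma_density t)%:E).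
  apply/measurable_EFinP; apply: measurable_funM; last exact: measurable_gamma_density.
  by apply: measurable_funTS; exact: measurable_funX.
have i : leb.-integrable `]0%R, +oo[ (EFin \o (fun t : R => t ^+ k * gamma_density t)).
  apply/integrableP; split; first exact: mf.
  rewrite (le_lt_trans _ (ltry (Gamma (a + k%:R + 1) / Gamma (a + 1))))// -moment.
  apply: ge0_le_integral => //; first exact: (measurableT_comp _ mf).
  move=> t /=; rewrite in_itv/= andbT => t0.
  by rewrite lee_fin ger0_norm// mulr_ge0 ?gamma_density_ge0// exprn_ge0// ltW.
by have := integrableZl mI c i.
Qed.

(** A gamma variable of parameter [a + 1] has mean [a + 1] and second moment
    [(a + 1) (a + 2)], hence concentrates around [a]. *)
Lemma gamma_density_deviation :
  (\int[leb]_(t in `]0%R, +oo[) (`|t / a - 1| * gamma_density t)%:E <=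
   (2 / Num.sqrt a)%:E)%E.
Proof.
set r := Num.sqrt a; have r0 : 0 < r by rewrite sqrtr_gt0.
have ra : r ^+ 2 = a by rewrite sqr_sqrtr// ltW.
have rn : r != 0 by rewrite gt_eqF.
(* |z| <= 1 / (2 r) + r z^2 / 2 with z = t / a - 1, expanded in powers of t. *)
pose c0 : R := r^-1 / 2 + r / 2; pose c1 : R := - (r / a); pose c2 : R := r / (2 * a ^+ 2).
pose B (t : R) : R := c0 * (t ^+ 0 * gamma_density t) + (c1 * (t ^+ 1 * gamma_density t) +
   c2 * (t ^+ 2 * gamma_density t)).
have i12 : leb.-integrable `]0%R, +oo[ (EFin \o (fun t : R => c1 * (t ^+ 1 * gamma_density t) +
   c2 * (t ^+ 2 * gamma_density t))) by have := integrableD mI (I 1 c1) (I 2 c2).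
have iB : leb.-integrable `]0%R, +oo[ (EFin \o B) by have := integrableD mI (I 0 c0) i12.
have dB (t : R) : `|t / a - 1| * gamma_density t <= B t.
  rewrite (_ : B t = (r^-1 / 2 + r / 2 * (t / a - 1) ^+ 2) * gamma_density t); last first.
    by rewrite /B /c0 /c1 /c2; field; rewrite gt_eqF.
  rewrite ler_wpM2r ?gamma_density_ge0// -subr_ge0 -[(t / a - 1) ^+ 2]real_normK ?num_real//.
  set z := `| _ |; rewrite (_ : _ - _ = (r * z - 1) ^+ 2 / (2 * r)); last by field.
  by rewrite divr_ge0 ?sqr_ge0// mulr_ge0// ltW.
apply: (@le_trans _ _ (\int[leb]_(t in `]0%R, +oo[) (B t)%:E)%E).
  apply: ge0_le_integral => //.
  - by move=> t _; rewrite lee_fin mulr_ge0 ?gamma_density_ge0.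
  - apply/measurable_EFinP; apply: measurable_funM; last exact: measurable_gamma_density.
    apply: measurable_funTS; apply: measurableT_comp => //.
    by apply: measurable_funB => //; exact: measurable_funM.
  - exact: (measurable_int _ iB).
  - by move=> t _; rewrite lee_fin.
have mR k c : \int[leb]_(t in `]0%R, +oo[) (c * (t ^+ k * gamma_density t)) =
    c * (Gamma (a + k%:R + 1) / Gamma (a + 1)).
  rewrite RintegralZl//; first by rewrite /Rintegral moment.
  by have := I k 1; congr integrable; apply/funext => t /=; rewrite mul1r.
have -> : (\int[leb]_(t in `]0%R, +oo[) (B t)%:E = (\int[leb]_(t in `]0%R, +oo[) B t)%:E)%E.
  by rewrite fineK//; exact: integrable_fin_num.
rewrite lee_fin /B (RintegralD mI (I 0 c0) i12) (RintegralD mI (I 1 c1) (I 2 c2)).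
rewrite !mR addr0.
have g1 : Gamma (a + 1 + 1) = (a + 1) * Gamma (a + 1) by rewrite Gamma_rec// addr_gt0.
have g2 : Gamma (a + 2 + 1) = (a + 2) * (a + 1) * Gamma (a + 1).
  have -> : a + 2 + 1 = (a + 1 + 1) + 1 by ring.
  rewrite Gamma_rec ?addr_gt0// g1; ring.
rewrite g1 g2 !mulfK ?divff ?gt_eqF// /c0 /c1 /c2.
rewrite [leLHS](_ : _ = r^-1 / 2 + (a + 2) * r / (2 * a ^+ 2)); last first.
  by field; rewrite rn gt_eqF.
have -> : 2 / r = r^-1 / 2 + 3 / 2 / r by field.
rewrite lerD2l -ra.
rewrite [leLHS](_ : _ = (r ^+ 2 + 2) / r ^+ 2 / (2 * r)); last by field.
rewrite [leRHS](_ : _ = 3 / (2 * r)); last by field.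
have h : a + 2 <= 3 * a.
  have -> : 3 * a = a + 2 * a by ring.
  by rewrite lerD2l ler_peMr.
have r2 : 0 < r ^+ 2 by rewrite exprn_gt0.
have r3 : 0 < (2 * r)^-1 by rewrite invr_gt0 mulr_gt0.
by rewrite ler_pM2r// ler_pdivrMr// ra.
Qed.

End gamma_density.

(** * The p-Gaussian density *)

Section lp_density.
Context (R : realType) (p : R).
Hypothesis p0 : 0 < p.
Local Notation leb := (@lebesgue_measure R).

(** The integral of [x^2m exp (- |x|^p / p)]. *)
Let M m : R := 2 / (m.*2.+1)%:R * p `^ ((m.*2.+1)%:R / p) * Gamma ((m.*2.+1)%:R / p + 1).

Let M_gt0 m : 0 < M m.
Proof.
by rewrite !mulr_gt0 ?powR_gt0 ?Gamma_gt0 ?invr_gt0// addr_gt0 ?divr_gt0.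
Qed.

(** The normalizing constant is [M 0]. *)
Definition lp_density (x : R) : R :=
  expR (- (`|x| `^ p / p)) / (2 * p `^ (1 / p) * Gamma (1 / p + 1)).

Definition lp_fourth_moment : R := M 2 / M 0.

Let densE x : lp_density x = expR (- (`|x| `^ p / p)) / M 0.
Proof. by rewrite /lp_density /M double0 divr1. Qed.

Lemma lp_density_ge0 x : 0 <= lp_density x.
Proof. by rewrite densE divr_ge0 ?expR_ge0// ltW. Qed.

Let measurable_w0 : measurable_fun setT (fun x : measurableTypeR R => expR (- (`|x : R| `^ p / p))).
Proof.
apply: measurableT_comp => //; apply: measurableT_comp => //.
by apply: measurable_funM => //; apply: (measurableT_comp (measurable_powR p)) => //.
Qed.

Let measurable_w : measurable_fun setT (lp_density : measurableTypeR R -> R).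
Proof.
rewrite (_ : lp_density = (fun x => expR (- (`|x| `^ p / p)) / M 0)).
  by apply: measurable_funM => //; exact: measurable_cst.
by apply/funext => x; rewrite densE.
Qed.

Let moment m : (\int[leb]_x (x ^+ m.*2 * lp_density x)%:E = (M m / M 0)%:E)%E.
Proof.
rewrite EFinM -(integral_generalized_gaussian m p0 p0) -ge0_integralZr//.
- by apply: eq_integral => x _; rewrite -EFinM densE mulrA.
- by apply/measurable_EFinP; apply: measurable_funM; [exact: measurable_funX|exact: measurable_w0].
- by move=> x _; rewrite lee_fin mulr_ge0 ?expR_ge0// -mul2n exprM exprn_ge0// sqr_ge0.
- by rewrite lee_fin invr_ge0 ltW.
Qed.

Let imoment m : leb.-integrable setT (EFin \o (fun x => x ^+ m.*2 * lp_density x)).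
Proof.
apply/integrableP; split.
  by apply/measurable_EFinP; apply: measurable_funM; [exact: measurable_funX|exact: measurable_w].
rewrite (eq_integral (fun x : measurableTypeR R => (x ^+ m.*2 * lp_density x)%:E)) ?moment ?ltry//.
move=> x _; rewrite gee0_abs// lee_fin mulr_ge0 ?lp_density_ge0//.
by rewrite -mul2n exprM exprn_ge0// sqr_ge0.
Qed.

Lemma integrable_lp_density : leb.-integrable setT (EFin \o lp_density).
Proof. by have := imoment 0; congr integrable; apply/funext => x; rewrite /= double0 mul1r. Qed.

Lemma Rintegral_lp_density : \int[leb]_x lp_density x = 1.
Proof.
have := congr1 fine (moment 0); rewrite /= divff ?gt_eqF// => <-.
by congr fine; apply: eq_integral => x _; rewrite double0 mul1r.
Qed.

Lemma integrable_lp_density_sqr : leb.-integrable setT (EFin \o (fun x => x ^+ 2 * lp_density x)).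
Proof. exact: (imoment 1). Qed.

Lemma integrable_lp_density_fourth : leb.-integrable setT (EFin \o (fun x => x ^+ 4 * lp_density x)).
Proof. exact: (imoment 2). Qed.

(** The recursion of Gamma turns the quotient of [M 1] by [M 0] into [sigma2 p]. *)
Lemma Rintegral_lp_density_sqr : \int[leb]_x (x ^+ 2 * lp_density x) = sigma2 p.
Proof.
rewrite /Rintegral (moment 1)/= /M /sigma2 double0 -muln2.
have pp : 0 < 1 / p :> R by rewrite divr_gt0.
have p3 : 0 < 3 / p :> R by rewrite divr_gt0.
rewrite (Gamma_rec pp) (Gamma_rec p3).
have -> : 3 / p = 2 / p + 1 / p :> R by rewrite -mulrDl; congr (_ / _); ring.
rewrite powRD; last by rewrite (gt_eqF p0) implybT.
have g1 := Gamma_gt0 pp.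
have q1 : p `^ (1 / p) != 0 by rewrite gt_eqF// powR_gt0.
move: (Gamma _) => g3.
field; rewrite q1 !gt_eqF//.
Qed.

Lemma Rintegral_lp_density_fourth : \int[leb]_x (x ^+ 4 * lp_density x) = lp_fourth_moment.
Proof. by rewrite /Rintegral (moment 2). Qed.

Lemma sigma2_gt0 : 0 < sigma2 p.
Proof. by rewrite !mulr_gt0 ?invr_gt0 ?powR_gt0 ?Gamma_gt0 ?divr_gt0. Qed.

Let even_density x : lp_density (- x) = lp_density x.
Proof. by rewrite /lp_density normrN. Qed.

Lemma Rintegral_lp_density_sin s : \int[leb]_x (sin (s * x) * lp_density x) = 0.
Proof.
apply: Rintegral_odd => [|x]; last by rewrite mulrN sinN even_density mulNr.
have ms : measurable_fun setT (fun x : measurableTypeR R => sin (s * x)).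
  by apply: (measurableT_comp (@measurable_sin R)) => //; exact: measurable_funM.
have s1 (x : measurableTypeR R) : `|sin (s * x)| <= 1 by exact: sin_max.
exact: (integrable_bounded_mul ms s1 integrable_lp_density).
Qed.

Lemma integrable_lp_density_id : leb.-integrable setT (EFin \o (fun x => x * lp_density x)).
Proof.
have i1 : leb.-integrable setT (EFin \o (fun x => lp_density x + x ^+ 2 * lp_density x)).
  by have := integrableD measurableT integrable_lp_density integrable_lp_density_sqr.
apply: (le_integrable _ _ _ i1) => //.
  by apply/measurable_EFinP; apply: measurable_funM.
move=> x _ /=; rewrite lee_fin normrM (ger0_norm (lp_density_ge0 x)) [leRHS]ger0_norm; last first.
  exact: addr_ge0 (lp_density_ge0 x) (mulr_ge0 (sqr_ge0 x) (lp_density_ge0 x)).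
have -> : lp_density x + x ^+ 2 * lp_density x = (1 + x ^+ 2) * lp_density x by ring.
rewrite ler_wpM2r ?lp_density_ge0// -[x ^+ 2]real_normK ?num_real//.
have h (z : R) : 0 <= z -> z <= 1 + z ^+ 2 by move=> z0; nra.
exact: h.
Qed.

Lemma Rintegral_lp_density_id : \int[leb]_x (x * lp_density x) = 0.
Proof.
apply: Rintegral_odd => [|x]; first exact: integrable_lp_density_id.
by rewrite even_density mulNr.
Qed.

End lp_density.

(** * Uniform law on the ball and product law *)

Section uniform_lp_ball.
Context (R : realType) (p : R) (n : nat).
Hypothesis p1 : 1 <= p.
Local Notation leb := (@lebesgue_measure R).
Let a : R := n%:R / p.
Hypothesis a1 : 1 <= a.
Let K : set 'cV[R]_n := [set x | lp_sum p x <= n%:R].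
Variable muX : probability 'cV[R]_n R.
Hypothesis muX_uniform : uniform_on K muX.

Let p0 : 0 < p. Proof. exact: lt_le_trans p1. Qed.
Let a0 : 0 < a. Proof. exact: lt_le_trans a1. Qed.
Let n0 : (0 < n)%N.
Proof. by rewrite lt0n; apply: contraTneq a0 => n0; rewrite /a n0 mul0r ltxx. Qed.

Let Z : R := 2 * p `^ (1 / p) * Gamma (1 / p + 1).
Let Z0 : 0 < Z. Proof. by rewrite !mulr_gt0 ?powR_gt0 ?Gamma_gt0// addr_gt0 ?divr_gt0. Qed.

Let W : 'cV[R]_n -> R := @prod_density R (lp_density p) n.
Let W_ge0 v : 0 <= W v.
Proof. by apply: prod_density_ge0 => x; exact: lp_density_ge0. Qed.

Let WE v : expR (- (lp_sum p v / p)) = Z ^+ n * W v.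
Proof.
rewrite /W /prod_density /lp_density big_split/= prodr_const card_ord -/Z.
rewrite mulrCA exprVn divff ?expf_neq0 ?gt_eqF// mulr1 -expR_sum/=; congr expR.
by rewrite /lp_sum mulr_suml -sumrN.
Qed.

Let iW : (@lebesgue_cV R n).-integrable setT (EFin \o W).
Proof. exact: (integrable_prod_density (integrable_lp_density p0)). Qed.

Let W1 : (\int[@lebesgue_cV R n]_v (W v)%:E = 1)%E.
Proof.
have h := Rintegral_prod_density (integrable_lp_density p0) (Rintegral_lp_density p0) n.
by rewrite -[LHS]fineK ?(integrable_fin_num measurableT iW)// [X in X%:E]h.
Qed.

Let I : set (measurableTypeR R) := `]0%R, +oo[%classic.
Let mI : measurable I. Proof. exact: measurable_itv. Qed.

Let C : R := Gamma (a + 1) / a `^ a.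
Let C0 : 0 < C. Proof. by rewrite divr_gt0 ?powR_gt0 ?Gamma_gt0// addr_gt0. Qed.

Let CE (t : R) : 0 < t -> expR (- t) * (t / a) `^ a = C * gamma_density a t.
Proof.
move=> t0; have G0 : Gamma (a + 1) != 0 by rewrite gt_eqF// Gamma_gt0// addr_gt0.
have e : t `^ a = (t / a) `^ a * a `^ a.
  have ta0 : 0 <= t / a by rewrite divr_ge0 ?(ltW t0) ?(ltW a0).
  by rewrite -(powRM _ ta0 (ltW a0)) divfK// gt_eqF.
have A0 : a `^ a != 0 by rewrite gt_eqF// powR_gt0.
by rewrite /gamma_density e /C; field; rewrite G0 A0.
Qed.

Let mK : measurable K.
Proof.
rewrite (_ : K = @lp_sum R p n @^-1` `]-oo, n%:R]); last first.
  by apply/seteqP; split=> x /=; rewrite in_itv.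
by rewrite -[X in measurable X]setTI; exact: measurable_lp_sum.
Qed.

(* The mixture identity for the constant function 1. *)
Let volume : lebesgue_cV K = (Z ^+ n / C)%:E.
Proof.
have h1 : measurable_fun setT (fun _ : 'cV[R]_n => 1 : R) by exact: measurable_cst.
have := integral_lp_mixture p0 n0 h1 (fun=> ler01).
have -> : (\int[@lebesgue_cV R n]_x (1 * expR (- (lp_sum p x / p)))%:E = (Z ^+ n)%:E)%E.
  rewrite -[RHS]mule1 -W1 -ge0_integralZl_EFin//.
  - by apply: eq_integral => x _; rewrite mul1r WE.
  - by move=> x _; rewrite lee_fin.
  - exact: (measurable_int _ iW).
  - by rewrite exprn_ge0// ltW.
rewrite (eq_integral (fun t : measurableTypeR R => C%:E * ((gamma_density a t)%:E * lebesgue_cV K)))%E; last first.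
  move=> t; rewrite inE/= in_itv/= andbT => t0; rewrite CE// EFinM -muleA; congr (_ * (_ * _))%E.
  by rewrite -/a -/K integral_cst// mul1e.
rewrite ge0_integralZl_EFin//; last 3 first.
- by move=> t _; rewrite mule_ge0// lee_fin gamma_density_ge0.
- apply: emeasurable_funM => //; apply/measurable_EFinP; exact: measurable_gamma_density.
- exact: ltW.
rewrite ge0_integralZr//; last 2 first.
- by apply/measurable_EFinP; exact: measurable_gamma_density.
- by move=> t _; rewrite lee_fin gamma_density_ge0.
rewrite integral_gamma_density// mul1e.
have : (0 <= lebesgue_cV K)%E by [].
case: (lebesgue_cV K) => [r _|_|//].
  by rewrite -EFinM => -[->]; rewrite mulrAC divff ?mul1r// gt_eqF.
by rewrite mulry gtr0_sg// mul1e.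
Qed.

Let lamK0 : 0 < Z ^+ n / C. Proof. by rewrite divr_gt0 ?exprn_gt0. Qed.

Let integral_K (g : 'cV[R]_n -> \bar R) : measurable_fun setT g -> (forall x, (0 <= g x)%E) ->
  (\int[@lebesgue_cV R n]_(x in K) g x = (Z ^+ n / C)%:E * \int[muX]_x g x)%E.
Proof.
move=> mg g0; have lK := ltW lamK0.
have muXE A : measurable A -> (lebesgue_cV (A `&` K) = (Z ^+ n / C)%:E * muX A)%E.
  move=> mA; rewrite (muX_uniform mA) volume /=.
  have AK : (lebesgue_cV (A `&` K) <= (Z ^+ n / C)%:E)%E.
    by rewrite -volume le_measure// ?inE//; exact: measurableI.
  have Afin : lebesgue_cV (A `&` K) \is a fin_num.
    by rewrite ge0_fin_numE// (le_lt_trans AK)// ltry.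
  by rewrite -EFinM mulrCA divff ?mulr1 ?fineK// gt_eqF.
have muXK : muX (~` K) = 0%E.
  have := muXE _ (measurableC mK); rewrite setICl measure0.
  by move/esym/eqP; rewrite mule_eq0 eqe gt_eqF//= => /eqP.
transitivity (\int[mscale (NngNum lK) muX]_(x in K) g x)%E.
  apply: eq_measure_integral => A mA AK.
  by have := muXE _ mA; rewrite (setIidl AK).
rewrite ge0_integral_mscale//; last exact: measurable_funTS.
congr (_ * _)%E; rewrite -[in RHS](setUv K) ge0_integral_setU//.
- by rewrite (null_set_integral (measurableC mK) _ muXK) ?adde0//; exact: measurable_funTS.
- exact: measurableC.
- by rewrite setUv.
- exact/disj_setPCl.
Qed.

(** The product of p-Gaussian densities is a mixture of the uniform laws on the
    dilated balls, with a gamma mixing law. *)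
Let mixture (h : 'cV[R]_n -> R) : measurable_fun setT h -> (forall x, 0 <= h x) ->
  (\int[@lebesgue_cV R n]_v (h v * W v)%:E = \int[leb]_(t in I)
     ((gamma_density a t)%:E * \int[muX]_x (h ((t / a) `^ p^-1 *: x)%R)%:E))%E.
Proof.
move=> mh h0; have Zn0 : 0 < Z ^+ n by rewrite exprn_gt0.
have mZ c : measurable_fun setT (fun v : 'cV[R]_n => c *: v).
  apply/measurable_fun_mxP => i j; under eq_fun do rewrite mxE.
  by apply: measurable_funM => //; exact: measurable_fun_coord.
have mhW : measurable_fun setT (fun v => (h v * W v)%:E).
  by apply/measurable_EFinP; apply: measurable_funM => //; apply/measurable_EFinP; exact: (measurable_int _ iW).
have E1 : ((Z ^+ n)%:E * \int[@lebesgue_cV R n]_v (h v * W v)%:E =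
   \int[@lebesgue_cV R n]_x (h x * expR (- (lp_sum p x / p)))%:E)%E.
  rewrite -ge0_integralZl_EFin//; last 2 first.
  - by move=> v _; rewrite lee_fin mulr_ge0.
  - exact: ltW.
  by apply: eq_integral => v _; rewrite -EFinM WE mulrCA.
have inner t : (\int[@lebesgue_cV R n]_(x in K) (h ((t / a) `^ p^-1 *: x)%R)%:E =
    (Z ^+ n / C)%:E * \int[muX]_x (h ((t / a) `^ p^-1 *: x)%R)%:E)%E.
  apply: integral_K => [|x]; last by rewrite lee_fin.
  by apply/measurable_EFinP; exact: (measurableT_comp mh (mZ _)).
have mI2 : measurable_fun setT (fun t : measurableTypeR R => \int[muX]_x (h ((t / a) `^ p^-1 *: x)%R)%:E)%E.
  apply: (measurable_fun_fubini_tonelli_G (m1 := muX)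
    (fun z : 'cV[R]_n * measurableTypeR R => (h ((z.2 / a) `^ p^-1 *: z.1))%:E)).
    apply/measurable_EFinP; apply: (measurableT_comp mh).
    apply/measurable_fun_mxP => i j; under eq_fun do rewrite mxE.
    apply: measurable_funM.
      apply: (measurableT_comp (measurable_powR p^-1)).
      by apply: measurable_funM => //; exact: measurable_snd.
    exact: (measurableT_comp (measurable_fun_coord i j) measurable_fst).
  by move=> z; rewrite lee_fin.
have := integral_lp_mixture p0 n0 mh h0; rewrite -E1 -/a -/K.
rewrite (eq_integral (fun t : measurableTypeR R => (Z ^+ n)%:E * ((gamma_density a t)%:E *
    \int[muX]_x (h ((t / a) `^ p^-1 *: x)%R)%:E)))%E; last first.
  move=> t; rewrite inE/= in_itv/= andbT => t0; rewrite CE// inner !muleA -!EFinM.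
  by congr (_%:E * _)%E; field; rewrite gt_eqF.
rewrite ge0_integralZl_EFin//; last 3 first.
- by move=> t _; rewrite mule_ge0 ?lee_fin ?gamma_density_ge0// integral_ge0// => x _; rewrite lee_fin.
- apply: emeasurable_funM; last exact: measurable_funTS.
  by apply/measurable_EFinP; exact: measurable_gamma_density.
- exact: ltW.
move=> /(congr1 (fun z => (Z ^+ n)^-1%:E * z)%E).
by rewrite !muleA -!EFinM mulVf ?gt_eqF// !mul1e.
Qed.

Let r (t : R) : R := (t / a) `^ p^-1.

Let r_deviation t : 0 < t -> `|r t - 1| <= `|t / a - 1|.
Proof.
move=> t0; have ta0 : 0 < t / a by rewrite divr_gt0.
have rp : r t `^ p = t / a by rewrite /r -powRrM mulVf ?gt_eqF// powRr1// ltW.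
have r0 : 0 < r t by rewrite powR_gt0.
rewrite -rp; have [r1|r1] := leP 1 (r t).
  have h : r t <= r t `^ p by exact: le1r_powR.
  by rewrite !ger0_norm ?subr_ge0 ?(le_trans r1)// lerD2r.
have h : r t `^ p <= r t by apply: ge1r_powR => //; rewrite r0 ltW.
by rewrite !ler0_norm ?subr_le0 ?(ltW r1) ?(le_trans h (ltW r1))// lerN2 lerD2r.
Qed.

Let measurable_r : measurable_fun setT (r : measurableTypeR R -> R).
Proof.
apply: (measurableT_comp (measurable_powR p^-1)).
by apply: measurable_funM => //; exact: measurable_cst.
Qed.

Let mgd (D : set (measurableTypeR R)) :
  measurable_fun D (fun t : measurableTypeR R => (gamma_density a t)%:E).
Proof. by apply/measurable_EFinP; exact: measurable_gamma_density. Qed.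

Let dev : \bar R := (\int[leb]_(t in I) (`|t / a - 1| * gamma_density a t)%:E)%E.

Let mdev (D : set (measurableTypeR R)) :
  measurable_fun D (fun t : measurableTypeR R => (`|(t : R) / a - 1| * gamma_density a t)%:E).
Proof.
apply/measurable_EFinP; apply: measurable_funM; last exact: measurable_gamma_density.
apply: measurable_funTS; apply: measurableT_comp => //.
by apply: measurable_funB => //; exact: measurable_funM.
Qed.

Let dotZ (c : R) (s x : 'cV[R]_n) : dot s (c *: x) = c * dot s x.
Proof. by rewrite /dot mulr_sumr; apply: eq_bigr => i _; rewrite mxE mulrCA. Qed.

(** By the mixture, the second moment under the product law is that under the
    uniform law times the second moment of the dilation factor. The bound 64
    makes the mean deviation of this factor at most 1 / 4, so that its second
    moment is at least 1 / 2. *)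
Lemma second_moment_uniform (s : 'cV[R]_n) : 64 <= a ->
  (\int[muX]_x (dot s x ^+ 2)%:E <= (2 * (sigma2 p * \sum_(i < n) s i 0 ^+ 2))%:E)%E.
Proof.
move=> a64; set Q := (\int[_]_x _)%E.
have Q0 : (0 <= Q)%E by apply: integral_ge0 => x _; rewrite lee_fin sqr_ge0.
have md : measurable_fun setT (fun v : 'cV[R]_n => dot s v ^+ 2).
  by apply: measurable_funX; exact: measurable_dot.
have := mixture md (fun v => sqr_ge0 (dot s v)).
have [_ i2 e2] := sqr_dot_density (integrable_lp_density p0) (Rintegral_lp_density p0)
  (integrable_lp_density_id p0) (integrable_lp_density_sqr p0)
  (Rintegral_lp_density_id p0) (Rintegral_lp_density_sqr p0) s.
have -> : (\int[@lebesgue_cV R n]_v (dot s v ^+ 2 * W v)%:E =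
    (sigma2 p * \sum_(i < n) s i 0 ^+ 2)%:E)%E.
  by rewrite -e2 /Rintegral fineK//; exact: (integrable_fin_num measurableT i2).
pose A := (\int[leb]_(t in I) (gamma_density a t * r t ^+ 2)%:E)%E.
have mA (D : set (measurableTypeR R)) :
    measurable_fun D (fun t : measurableTypeR R => (gamma_density a t * r t ^+ 2)%:E).
  apply/measurable_EFinP; apply: measurable_funM; first exact: measurable_gamma_density.
  by apply: measurable_funTS; apply: measurable_funX; exact: measurable_r.
have gr0 t : 0 <= gamma_density a t * r t ^+ 2.
  exact: mulr_ge0 (gamma_density_ge0 a1 _) (sqr_ge0 _).
have -> : (\int[leb]_(t in I) ((gamma_density a t)%:E *
    \int[muX]_x (dot s ((t / a) `^ p^-1 *: x)%R ^+ 2)%:E) = A * Q)%E.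
  rewrite /A -ge0_integralZr//; last by move=> t _; rewrite lee_fin.
  apply: eq_integral => t _; rewrite [in RHS]EFinM -[in RHS]muleA; congr (_ * _)%E.
  rewrite /Q -ge0_integralZl_EFin ?sqr_ge0//; last 2 first.
  - by move=> x _; rewrite lee_fin sqr_ge0.
  - exact/measurable_EFinP.
  by apply: eq_integral => x _; rewrite dotZ exprMn EFinM.
move=> e; rewrite EFinM e.
(* r^2 >= 1 - 2 |r - 1| *)
have A2 : (1 <= 2%:E * A)%E.
  have A0 : (0 <= A)%E by apply: integral_ge0 => t _; rewrite lee_fin.
  have dev_le : (dev <= (4^-1)%:E)%E.
    rewrite (le_trans (gamma_density_deviation a1))// lee_fin.
    have s8 : 8 <= Num.sqrt a.
      by rewrite -(ger0_norm (ler0n R 8)) -sqrtr_sqr ler_wsqrtr// (le_trans _ a64)// -natrX ler_nat.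
    rewrite ler_pdivrMr ?(lt_le_trans _ s8)//; lra.
  have : (1 <= A + 2%:E * dev)%E.
    have m2dev (D : set (measurableTypeR R)) : measurable_fun D
        (fun t : measurableTypeR R => (2 * (`|(t : R) / a - 1| * gamma_density a t))%:E).
      by under eq_fun do rewrite EFinM; apply: emeasurable_funM => //; exact: mdev.
    have d0 t : 0 <= `|t / a - 1| * gamma_density a t.
      by rewrite mulr_ge0 ?gamma_density_ge0.
    rewrite -(integral_gamma_density a1) /A /dev -ge0_integralZl_EFin//; last first.
      by move=> t _; rewrite lee_fin.
    rewrite -ge0_integralD//; last 2 first.
    - by move=> t _; rewrite lee_fin.
    - by move=> t _; rewrite mule_ge0 ?lee_fin.
    apply: ge0_le_integral => //.
    - by move=> t _; rewrite lee_fin gamma_density_ge0.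
    - by apply: emeasurable_funD; [exact: mA|exact: m2dev].
    - move=> t; rewrite /I/= in_itv/= andbT => t0; rewrite -EFinM -EFinD lee_fin.
      have g0 := gamma_density_ge0 a1 t; have rd := r_deviation t0.
      rewrite [leRHS](_ : _ = (r t ^+ 2 + 2 * `|t / a - 1|) * gamma_density a t); last by ring.
      rewrite ler_peMl//; move: rd; rewrite ler_distl => /andP[rd _].
      have := sqr_ge0 (r t - 1); move: rd; set z := `| _ |; set y := r t; nra.
  have dev0 : (0 <= dev)%E by apply: integral_ge0 => t _; rewrite lee_fin mulr_ge0 ?gamma_density_ge0.
  move: A0 dev_le dev0; case: (A) => [x|_ _ _ _|//]; last by rewrite mulry gtr0_sg// mul1e leey.
  case: (dev) => [y|//|//]; rewrite -!EFinM -EFinD !lee_fin => x0 y1 y0 xy; lra.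
by rewrite muleA -[leLHS]mul1e lee_wpmul2r.
Qed.

(** Dilating by [r] changes the integral of [g (dot s x)] under the uniform law by
    at most [|r - 1|] times the mean of [|dot s x|]. The product law is a mixture
    of such dilates with [r] close to 1, so the two laws give nearly the same
    integral. *)
Lemma lipschitz_transform_uniform (g : R -> R) (s : 'cV[R]_n) :
  measurable_fun setT g -> (forall u, `|g u| <= 1) ->
  (forall u v, `|g u - g v| <= `|u - v|) -> 64 <= a ->
  `|\int[muX]_x g (dot s x) -
    \int[@lebesgue_cV R n]_v (g (dot s v) * prod_density (lp_density p) v)| <=
  (1 + 2 * (sigma2 p * \sum_(i < n) s i 0 ^+ 2)) * (2 / Num.sqrt a).
Proof.
move=> mg g1 glip a64; set B := 1 + _; set c := \int[@lebesgue_cV R n]_v _.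
have Q2 := second_moment_uniform s a64.
have mdot := @measurable_dot R n s.
have mgy (y : R) : measurable_fun setT (fun x : 'cV[R]_n => g (y * dot s x)).
  by apply: (measurableT_comp mg); exact: measurable_funM.
have h0 (u : R) : 0 <= 1 + g u by have := g1 u; rewrite ler_norml => /andP[+ _]; rewrite -subr_ge0 opprK addrC.
have ic (y : R) : muX.-integrable setT (EFin \o (fun x => g (y * dot s x))).
  by apply: (@integrable_bounded _ _ _ _ _ 1) => [|x]; [exact: mgy|exact: g1].
have i1 (u : R) : muX.-integrable setT (EFin \o (fun=> u)).
  by apply: (@integrable_bounded _ _ _ _ _ `|u|).
have ih (y : R) : muX.-integrable setT (EFin \o (fun x => 1 + g (y * dot s x))).
  by have := integrableD measurableT (i1 1) (ic y).
(* The mixture identity holds for nonnegative functions, hence the shift by 1. *)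
pose psi (y : R) : R := \int[muX]_x (1 + g (y * dot s x)).
have psiE y : (\int[muX]_x (1 + g (y * dot s x))%:E = (psi y)%:E)%E.
  by rewrite /psi /Rintegral fineK//; exact: (integrable_fin_num measurableT (ih y)).
have psi0 y : 0 <= psi y by apply: Rintegral_ge0.
have i2 : muX.-integrable setT (EFin \o (fun x => 1 + dot s x ^+ 2)).
  have i2' : muX.-integrable setT (EFin \o (fun x => dot s x ^+ 2)).
    apply/integrableP; split; first by apply/measurable_EFinP; exact: measurable_funX.
    apply: le_lt_trans (ltry _); apply: le_trans Q2.
    by under eq_integral do rewrite /= ger0_norm ?sqr_ge0//.
  by have := integrableD measurableT (i1 1) i2'.
have B2 : \int[muX]_x (1 + dot s x ^+ 2) <= B.
  rewrite -lee_fin /Rintegral fineK; last exact: (integrable_fin_num measurableT i2).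
  under eq_integral do rewrite EFinD.
  rewrite ge0_integralD//; last 2 first.
  - by move=> x _; rewrite lee_fin sqr_ge0.
  - by apply/measurable_EFinP; exact: measurable_funX.
  rewrite integral_cst// mul1e /B EFinD leeD//.
  by rewrite probability_le1.
have psi_lip y : `|psi y - psi 1| <= `|y - 1| * B.
  rewrite -RintegralB//.
  have iB : muX.-integrable setT (EFin \o (fun x => 1 + g (y * dot s x) - (1 + g (1 * dot s x)))).
    by have := integrableB measurableT (ih y) (ih 1).
  have iy : muX.-integrable setT (EFin \o (fun x => `|y - 1| * (1 + dot s x ^+ 2))).
    by have := integrableZl measurableT `|y - 1| i2.
  rewrite (le_trans (le_normr_Rintegral _ iB))//.
  apply: (@le_trans _ _ (\int[muX]_x (`|y - 1| * (1 + dot s x ^+ 2)))).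
    apply: le_Rintegral => //; first exact: integrable_norm iB.
    move=> x _; rewrite (_ : _ - _ = g (y * dot s x) - g (1 * dot s x)); last by ring.
    rewrite (le_trans (glip _ _))// -mulrBl normrM ler_wpM2l//.
    have h (u : R) : 0 <= u -> u <= 1 + u ^+ 2 by move=> u0; nra.
    by rewrite -[dot s x ^+ 2]real_normK ?num_real//; exact: h.
  by rewrite RintegralZl// ler_wpM2l.
have m1 : measurable_fun setT (fun v : 'cV[R]_n => 1 + g (dot s v)).
  by apply: measurable_funD => //; exact: (measurableT_comp mg).
have := mixture m1 (fun v => h0 (dot s v)).
have -> : (\int[@lebesgue_cV R n]_v ((1 + g (dot s v)) * W v)%:E = (1 + c)%:E)%E.
  have icW : (@lebesgue_cV R n).-integrable setT (EFin \o (fun v => g (dot s v) * W v)).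
    apply: (integrable_bounded_mul (M := 1)) iW => [|v]; last exact: g1.
    exact: (measurableT_comp mg).
  rewrite /c.
  rewrite -[in RHS](Rintegral_prod_density (integrable_lp_density p0) (Rintegral_lp_density p0) n).
  rewrite -RintegralD// /Rintegral fineK; last first.
    by apply: integrable_fin_num => //; have := integrableD measurableT iW icW.
  by apply: eq_integral => v _; rewrite mulrDl mul1r.
have mpsi (D : set (measurableTypeR R)) :
    measurable_fun D (fun t : measurableTypeR R => (gamma_density a t * psi (r t))%:E).
  apply: measurable_funTS; under eq_fun do rewrite EFinM -psiE.
  apply: emeasurable_funM; first exact: mgd.
  apply: (measurable_fun_fubini_tonelli_G (m1 := muX)
    (fun z : 'cV[R]_n * measurableTypeR R => (1 + g (r z.2 * dot s z.1))%:E)).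
    apply/measurable_EFinP; apply: measurable_funD => //.
    apply: (measurableT_comp mg); apply: measurable_funM.
      exact: (measurableT_comp measurable_r measurable_snd).
    exact: (measurableT_comp mdot measurable_fst).
  by move=> z; rewrite lee_fin.
have -> : (\int[leb]_(t in I) ((gamma_density a t)%:E *
    \int[muX]_x (1 + g (dot s ((t / a) `^ p^-1 *: x)%R))%:E) =
    \int[leb]_(t in I) (gamma_density a t * psi (r t))%:E)%E.
  apply: eq_integral => t _; rewrite [in RHS]EFinM -psiE; congr (_ * _)%E.
  by apply: eq_integral => x _; rewrite dotZ.
set J := (\int[leb]_(t in I) _)%E => cJ.
have B0 : 0 <= B by rewrite (le_trans _ B2)// Rintegral_ge0// => x _; rewrite addr_ge0 ?sqr_ge0.
have mBdev (D : set (measurableTypeR R)) : measurable_fun D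
    (fun t : measurableTypeR R => (B * (`|(t : R) / a - 1| * gamma_density a t))%:E).
  by under eq_fun do rewrite EFinM; apply: emeasurable_funM => //; exact: mdev.
have mpsi1 (D : set (measurableTypeR R)) : measurable_fun D
    (fun t : measurableTypeR R => (psi 1 * gamma_density a t)%:E).
  by under eq_fun do rewrite EFinM; apply: emeasurable_funM => //; exact: mgd.
have d0 t : 0 <= `|t / a - 1| * gamma_density a t by rewrite mulr_ge0 ?gamma_density_ge0.
have gd0 t := gamma_density_ge0 a1 t.
have psi1E : (\int[leb]_(t in I) (psi 1 * gamma_density a t)%:E = (psi 1)%:E)%E.
  under eq_integral do rewrite EFinM.
  rewrite ge0_integralZl_EFin//; first by rewrite /I (integral_gamma_density a1) mule1.
  by move=> t _; rewrite lee_fin.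
have devE : (\int[leb]_(t in I) (B * (`|t / a - 1| * gamma_density a t))%:E <= (B * (2 / Num.sqrt a))%:E)%E.
  under eq_integral do rewrite EFinM.
  rewrite ge0_integralZl_EFin//; last by move=> t _; rewrite lee_fin.
  by rewrite EFinM lee_wpmul2l// gamma_density_deviation.
have pt t : I t -> `|psi (r t) - psi 1| * gamma_density a t <= B * (`|t / a - 1| * gamma_density a t).
  rewrite /I/= in_itv/= andbT => t0; rewrite [leRHS]mulrA ler_wpM2r//.
  by rewrite (le_trans (psi_lip _))// mulrC ler_wpM2l// r_deviation.
have up : ((1 + c)%:E <= (psi 1)%:E + (B * (2 / Num.sqrt a))%:E)%E.
  rewrite cJ /J -psi1E (le_trans _ (leeD (lexx _) devE))// -ge0_integralD//; try by move=> t _; rewrite lee_fin mulr_ge0.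
  apply: ge0_le_integral => //.
  - by move=> t _; rewrite lee_fin mulr_ge0.
  - by apply: emeasurable_funD; [exact: mpsi1|exact: mBdev].
  - move=> t It; rewrite -EFinD lee_fin; have := pt t It.
    have := ler_wpM2r (gd0 t) (ler_norm (psi (r t) - psi 1)); move: (gd0 t); lra.
have down : ((psi 1)%:E <= (1 + c)%:E + (B * (2 / Num.sqrt a))%:E)%E.
  rewrite cJ /J -psi1E (le_trans _ (leeD (lexx _) devE))// -ge0_integralD//; try by move=> t _; rewrite lee_fin mulr_ge0.
  apply: ge0_le_integral => //.
  - by move=> t _; rewrite lee_fin mulr_ge0.
  - by apply: emeasurable_funD; [exact: mpsi|exact: mBdev].
  - move=> t It; rewrite -EFinD lee_fin; have := pt t It.
    rewrite distrC; have := ler_wpM2r (gd0 t) (ler_norm (psi 1 - psi (r t))); move: (gd0 t); lra.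
have psi1 : psi 1 = 1 + \int[muX]_x g (dot s x).
  rewrite /psi RintegralD//; congr (_ + _).
    rewrite Rintegral_cst// mul1r; exact: (congr1 fine (probability_setT muX)).
  by apply: eq_Rintegral => x _; rewrite mul1r.
move: up down; rewrite -!EFinD !lee_fin psi1 ler_distl => up down.
by apply/andP; split; lra.
Qed.

End uniform_lp_ball.

(** * Transforms close to the Gaussian one *)

Section product_transform.
Context (R : realType).
Local Notation leb := (@lebesgue_measure R).

Lemma ler_dist_prod n (f g : 'I_n -> R) :
  (forall i, `|f i| <= 1) -> (forall i, `|g i| <= 1) ->
  `|\prod_(i < n) f i - \prod_(i < n) g i| <= \sum_(i < n) `|f i - g i|.
Proof.
elim: n f g => [|n IH] f g f1 g1; first by rewrite !big_ord0 subrr normr0.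
rewrite !big_ord_recl.
set F := \prod_(i < n) _; set G := \prod_(i < n) _.
have F1 : `|F| <= 1 by rewrite normr_prod prodr_ile1// => i _; rewrite normr_ge0 f1.
have -> : f ord0 * F - g ord0 * G = (f ord0 - g ord0) * F + g ord0 * (F - G) by ring.
rewrite (le_trans (ler_normD _ _))// lerD// normrM.
  by rewrite ler_piMr.
by rewrite (le_trans (ler_piMl _ (g1 ord0)))// IH// => i.
Qed.

Lemma expRN_taylor (u : R) : 0 <= u -> `|expR (- u) - (1 - u)| <= u ^+ 2.
Proof.
move=> u0; have l := expR_ge1Dx (- u); rewrite ger0_norm ?subr_ge0//.
have h : 1 + u <= expR u by exact: expR_ge1Dx.
have e : expR (- u) * expR u = 1 by rewrite -expRD addNr expR0.
have e0 := expR_gt0 (- u).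
have : expR (- u) * (1 + u) <= 1 by rewrite -[leRHS]e ler_wpM2l// ltW.
move: (expR (- u)) e0 => y y0 yu.
suff : y * (1 + u) <= (u ^+ 2 + (1 - u)) * (1 + u).
  by rewrite ler_pM2r ?lerBlDr//; lra.
rewrite (le_trans yu)//.
have -> : (u ^+ 2 + (1 - u)) * (1 + u) = 1 + u ^+ 3 by ring.
by rewrite lerDl exprn_ge0.
Qed.

Variable p : R.
Hypothesis p0 : 0 < p.
Local Notation w := (lp_density p).
Local Notation v2 := (sigma2 p).
Local Notation m4 := (lp_fourth_moment p).

Let icos s : leb.-integrable setT (EFin \o (fun x => cos (s * x) * w x)).
Proof.
have mc : measurable_fun setT (fun x : measurableTypeR R => cos (s * x)).
  by apply: (measurableT_comp (@measurable_cos R)) => //; exact: measurable_funM.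
have c1 (x : measurableTypeR R) : `|cos (s * x)| <= 1 by exact: cos_max.
exact: (integrable_bounded_mul mc c1 (integrable_lp_density p0)).
Qed.

Let cos_transform_le1 s : `|\int[leb]_x (cos (s * x) * w x)| <= 1.
Proof.
rewrite -(Rintegral_lp_density p0) (le_trans (le_normr_Rintegral _ (icos s)))//.
apply: le_Rintegral => //.
- by have := integrable_norm (icos s).
- exact: integrable_lp_density.
- move=> x _; rewrite normrM (ger0_norm (lp_density_ge0 p0 x)).
  by rewrite ler_piMl ?lp_density_ge0// cos_max.
Qed.

Lemma cos_transform_taylor s :
  `|\int[leb]_x (cos (s * x) * w x) - (1 - v2 * s ^+ 2 / 2)| <= m4 / 24 * s ^+ 4.
Proof.
have iw := integrable_lp_density p0.
have i2 := integrable_lp_density_sqr p0.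
have i4 := integrable_lp_density_fourth p0.
have i2' : leb.-integrable setT (EFin \o (fun x => s ^+ 2 / 2 * (x ^+ 2 * w x))).
  by have := integrableZl measurableT (s ^+ 2 / 2) i2.
have i4' : leb.-integrable setT (EFin \o (fun x => s ^+ 4 / 24 * (x ^+ 4 * w x))).
  by have := integrableZl measurableT (s ^+ 4 / 24) i4.
have iq : leb.-integrable setT (EFin \o (fun x => w x - s ^+ 2 / 2 * (x ^+ 2 * w x))).
  by have := integrableB measurableT iw i2'.
have ie : leb.-integrable setT
    (EFin \o (fun x => cos (s * x) * w x - (w x - s ^+ 2 / 2 * (x ^+ 2 * w x)))).
  by have := integrableB measurableT (icos s) iq.
have -> : 1 - v2 * s ^+ 2 / 2 = \int[leb]_x (w x - s ^+ 2 / 2 * (x ^+ 2 * w x)).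
  rewrite RintegralB// RintegralZl// Rintegral_lp_density// Rintegral_lp_density_sqr//.
  by field.
have -> : m4 / 24 * s ^+ 4 = \int[leb]_x (s ^+ 4 / 24 * (x ^+ 4 * w x)).
  rewrite RintegralZl// Rintegral_lp_density_fourth//.
  by field.
rewrite -RintegralB// (le_trans (le_normr_Rintegral _ ie))//.
apply: le_Rintegral => //.
- by have := integrable_norm ie.
- move=> x _.
  have -> : cos (s * x) * w x - (w x - s ^+ 2 / 2 * (x ^+ 2 * w x)) =
      (cos (s * x) - (1 - (s * x) ^+ 2 / 2)) * w x by field.
  have -> : s ^+ 4 / 24 * (x ^+ 4 * w x) = (s * x) ^+ 4 / 24 * w x by field.
  rewrite normrM (ger0_norm (lp_density_ge0 p0 x)) ler_wpM2r ?lp_density_ge0//.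
  have := cos_taylor 2 (s * x).
  rewrite !big_ord_recl big_ord0 /= /bump/= !expr0 !expr1 divr1 mul1r addr0 mulN1r.
  by move=> h; exact: h.
Qed.

(** Both the factors of the product and those of the Gaussian transform are
    [1 - v2 s^2 / 2] up to a multiple of [s^4]. *)
Lemma cos_transform_prod n (s : 'cV[R]_n) :
  `|\prod_(i < n) \int[leb]_x (cos (s i 0 * x) * w x) -
    expR (- (v2 * (\sum_(i < n) s i 0 ^+ 2) / 2))| <=
  (m4 / 24 + v2 ^+ 2 / 4) * \sum_(i < n) s i 0 ^+ 4.
Proof.
have v0 := ltW (sigma2_gt0 p0).
have -> : expR (- (v2 * (\sum_(i < n) s i 0 ^+ 2) / 2)) =
    \prod_(i < n) expR (- (v2 * s i 0 ^+ 2 / 2)).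
  by rewrite -expR_sum sumrN; congr (expR (- _)); rewrite -mulr_suml -mulr_sumr.
have u0 i : 0 <= v2 * s i 0 ^+ 2 / 2.
  by rewrite divr_ge0// mulr_ge0// sqr_ge0.
have g1 i : `|expR (- (v2 * s i 0 ^+ 2 / 2))| <= 1.
  by rewrite ger0_norm ?expR_ge0// -[leRHS]expR0 ler_expR oppr_le0.
rewrite (le_trans (ler_dist_prod (fun i => cos_transform_le1 (s i 0)) g1))//.
rewrite mulr_sumr; apply: ler_sum => i _.
rewrite (le_trans (ler_distD (1 - v2 * s i 0 ^+ 2 / 2) _ _))// mulrDl.
rewrite lerD ?cos_transform_taylor// distrC (le_trans (expRN_taylor (u0 i)))//.
by rewrite le_eqVlt; apply/orP; left; apply/eqP; field.
Qed.

Variable n : nat.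
Hypothesis p1 : 1 <= p.
Hypothesis a64 : 64 <= n%:R / p.
Variable muX : probability 'cV[R]_n R.
Hypothesis muX_uniform : uniform_on [set x | lp_sum p x <= n%:R] muX.

(** The first error term is the cost of passing to the product law; the second is
    the distance of its transform to the Gaussian one. *)
Lemma uniform_transform_gaussian c (s : 'cV[R]_n) :
  `|\int[muX]_x cos (dot s x + c) -
    cos c * expR (- (v2 * (\sum_(i < n) s i 0 ^+ 2) / 2))| <=
  (1 + 2 * (v2 * \sum_(i < n) s i 0 ^+ 2)) * (2 / Num.sqrt (n%:R / p)) +
  (m4 / 24 + v2 ^+ 2 / 4) * \sum_(i < n) s i 0 ^+ 4.
Proof.
have a1 : 1 <= n%:R / p by apply: le_trans a64; rewrite ler1n.
have iw := integrable_lp_density p0.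
have w1 := Rintegral_lp_density p0.
have ic := integrable_cos_density iw s.
have is_ := integrable_sin_density iw s.
have ic' : (@lebesgue_cV R n).-integrable setT
    (EFin \o (fun v => cos c * (cos (dot s v) * prod_density w v))).
  by have := integrableZl measurableT (cos c) ic.
have is' : (@lebesgue_cV R n).-integrable setT
    (EFin \o (fun v => sin c * (sin (dot s v) * prod_density w v))).
  by have := integrableZl measurableT (sin c) is_.
pose g u : R := cos (u + c).
have mg : measurable_fun setT g.
  by apply: (measurableT_comp (@measurable_cos R)); exact: measurable_funD.
have glip u v : `|g u - g v| <= `|u - v|.
  by rewrite /g (le_trans (cos_lipschitz _ _))// opprD addrACA subrr addr0.
have := lipschitz_transform_uniform p1 a1 muX_uniform s mg
  (fun u => cos_max (u + c)) glip a64.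
have -> : \int[@lebesgue_cV R n]_v (g (dot s v) * prod_density w v) =
    cos c * \prod_(i < n) \int[leb]_x (cos (s i 0 * x) * w x).
  have -> : \int[@lebesgue_cV R n]_v (g (dot s v) * prod_density w v) =
      \int[@lebesgue_cV R n]_v (cos c * (cos (dot s v) * prod_density w v) -
        sin c * (sin (dot s v) * prod_density w v)).
    by apply: eq_Rintegral => v _; rewrite /g cosD; ring.
  rewrite RintegralB// RintegralZl// RintegralZl//.
  rewrite (Rintegral_sin_density iw (Rintegral_lp_density_sin p0)) mulr0 subr0.
  by rewrite (Rintegral_cos_density iw w1 (Rintegral_lp_density_sin p0)).
move=> h.
rewrite (le_trans (ler_distD (cos c * \prod_(i < n) \int[leb]_x (cos (s i 0 * x) * w x)) _ _))//.
rewrite lerD// -mulrBr normrM (le_trans _ (cos_transform_prod s))//.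
by rewrite ler_piMl// cos_max.
Qed.

End product_transform.

Section gaussian_transform.
Context (R : realType) (k : nat) (sd : R).
Hypothesis sd0 : 0 < sd.
Local Notation leb := (@lebesgue_measure R).
Local Notation nu := (normal_prob 0 sd).

Let w1 : \int[nu]_x (cst 1 x : R) = 1.
Proof. by rewrite Rintegral_cst// mul1r; exact: (congr1 fine (probability_setT nu)). Qed.

Let bounded_integrable (g : R -> R) : measurable_fun setT (g : measurableTypeR R -> R) -> (forall x, `|g x| <= 1) ->
  nu.-integrable setT (EFin \o g).
Proof. by move=> mg g1; exact: (@integrable_bounded _ _ _ _ _ 1). Qed.

Let iw : nu.-integrable setT (EFin \o (cst 1 : R -> R)).
Proof. by apply: bounded_integrable => // x; rewrite normr1. Qed.

Let msin s : measurable_fun setT ((fun x => sin (s * x)) : measurableTypeR R -> R).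
Proof. by apply: (measurableT_comp (@measurable_sin R)) => //; exact: measurable_funM. Qed.

Let mcos s : measurable_fun setT ((fun x => cos (s * x)) : measurableTypeR R -> R).
Proof. by apply: (measurableT_comp (@measurable_cos R)) => //; exact: measurable_funM. Qed.

Let sin_normal s : \int[nu]_x (sin (s * x) * cst 1 x) = 0.
Proof.
have i := bounded_integrable (msin s) (fun x => sin_max (s * x)).
under eq_Rintegral do rewrite mulr1.
rewrite Rintegral_normal_prob//; apply: Rintegral_odd => [|x].
  have ip : leb.-integrable setT (EFin \o normal_pdf 0 sd) by exact: integrable_normal_pdf.
  have s1 (x : measurableTypeR R) : `|sin (s * x)| <= 1 by exact: sin_max.
  exact: (integrable_bounded_mul (msin s) s1 ip).
by rewrite mulrN sinN mulNr !normal_pdfE ?gt_eqF// /normal_fun !subr0 sqrrN.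
Qed.

Lemma gaussian_cV_transform c (t : 'cV[R]_k) :
  \int[@gaussian_cV R k sd]_x cos (dot t x + c) =
  cos c * expR (- (sd ^+ 2 * (\sum_(i < k) t i 0 ^+ 2) / 2)).
Proof.
have ic := integrable_cos_density iw t.
have is_ := integrable_sin_density iw t.
have ic' : (@gaussian_cV R k sd).-integrable setT
    (EFin \o (fun v => cos c * (cos (dot t v) * prod_density (cst 1) v))).
  by have := integrableZl measurableT (cos c) ic.
have is' : (@gaussian_cV R k sd).-integrable setT
    (EFin \o (fun v => sin c * (sin (dot t v) * prod_density (cst 1) v))).
  by have := integrableZl measurableT (sin c) is_.
transitivity (\int[@gaussian_cV R k sd]_v (cos c * (cos (dot t v) * prod_density (cst 1) v) -
    sin c * (sin (dot t v) * prod_density (cst 1) v))).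
  by apply: eq_Rintegral => v _; rewrite cosD /prod_density big1// !mulr1; ring.
rewrite RintegralB// RintegralZl// RintegralZl//.
rewrite (Rintegral_sin_density iw sin_normal) mulr0 subr0.
rewrite (Rintegral_cos_density iw w1 sin_normal); congr (_ * _).
rewrite mulr_sumr mulr_suml -sumrN expR_sum; apply: eq_bigr => i _.
under eq_Rintegral do rewrite mulr1.
rewrite -(gaussian_cosine_transform sd0) Rintegral_normal_prob//.
exact: bounded_integrable (mcos _) (fun x => cos_max _).
Qed.

End gaussian_transform.

(** * Tightness *)

Section tightness.
Context (R : realType) (k : nat).

(** Chebyshev's inequality for the Euclidean norm. *)
Lemma box_complement_le (mu : probability 'cV[R]_k R) (M L : R) : 0 < L ->
  (forall i, (\int[mu]_x (x i 0 ^+ 2)%:E <= M%:E)%E) ->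
  (mu (~` box L) <= (k%:R * M / L ^+ 2)%:E)%E.
Proof.
move=> L0 muM; have L20 : 0 < L ^+ 2 by rewrite exprn_gt0.
have mB : measurable (~` @box R k L) by apply: measurableC; exact: measurable_box.
have m2 i : measurable_fun setT (fun x : 'cV[R]_k => (x i 0 ^+ 2)%:E).
  by apply/measurable_EFinP; apply: measurable_funX; exact: measurable_fun_coord.
have p2 i (x : 'cV[R]_k) : (0 <= (x i 0 ^+ 2)%:E)%E by rewrite lee_fin sqr_ge0.
have : ((L ^+ 2)%:E * mu (~` box L) <= \int[mu]_x \sum_(i < k) (x i 0 ^+ 2)%:E)%E.
  have i1 (x : 'cV[R]_k) : [set: 'cV[R]_k] x -> (0 <= (\1_(~` box L) x : R)%:E)%E.
    by rewrite lee_fin.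
  rewrite -[~` _]setIT -integral_indic// -ge0_integralZl_EFin ?(ltW L20)//; last first.
    by apply/measurable_EFinP; exact: measurable_indic.
  apply: ge0_le_integral => //.
  - by move=> x _; rewrite mule_ge0 ?lee_fin// ltW.
  - apply: emeasurable_funM => //; apply/measurable_EFinP; exact: measurable_indic.
  - by apply: emeasurable_sum.
  move=> x _; rewrite indicE; case: (boolP (x \in ~` box L)) => [|_]; last first.
    by rewrite mule0 sume_ge0.
  rewrite inE mule1 => /existsNP[i /negP]; rewrite -ltNge => Lx.
  rewrite (bigD1 i)//= -[leLHS]adde0 leeD ?sume_ge0// lee_fin.
  by rewrite -[leRHS]real_normK ?num_real// ler_pXn2r ?nnegrE ?(ltW L0) ?(ltW Lx).
rewrite ge0_integral_sum// => h.
have {}h : ((L ^+ 2)%:E * mu (~` box L) <= (k%:R * M)%:E)%E.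
  rewrite (le_trans h)//; apply: (@le_trans _ _ (\sum_(i < k) M%:E)%E).
    exact: lee_sum.
  by rewrite sumEFin sumr_const card_ord mulr_natl.
have : mu (~` box L) \is a fin_num by exact: fin_num_measure.
case: (mu _) h => // r; rewrite -EFinM !lee_fin => h _.
by rewrite ler_pdivlMr// mulrC.
Qed.

Lemma box_complement_small (mu : probability 'cV[R]_k R) (e : R) : 0 < e ->
  exists L0 : R, forall L, L0 <= L -> (mu (~` box L) <= e%:E)%E.
Proof.
move=> e0; pose F (n : nat) := ~` @box R k n%:R.
have mF n : measurable (F n) by apply: measurableC; exact: measurable_box.
have F0 : \bigcap_n F n = set0.
  apply/seteqP; split=> // x Fx.
  have [n _ nx] := nbhs_infty_ger (\sum_(i < k) `|x i 0|).
  apply: (Fx n I) => i; rewrite (le_trans _ (nx n _))//=.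
  by rewrite (bigD1 i)//= lerDl sumr_ge0.
have box_sub (L1 L2 : R) : L1 <= L2 -> ~` @box R k L2 `<=` ~` box L1.
  by move=> L12; apply: subsetC => x xL i; exact: le_trans (xL i) L12.
have cF : mu (F n) @[n --> \oo] --> 0%E.
  rewrite -(measure0 mu) -F0; apply: nonincreasing_cvg_mu => //.
  - by rewrite -ge0_fin_numE// fin_num_measure.
  - by rewrite F0.
  - by move=> m n mn; apply/subsetPset; apply: box_sub; rewrite ler_nat.
have /fine_cvgP[_] := cF.
move=> /cvgrPdist_le/(_ _ e0)[N _ /(_ N (leqnn N))].
rewrite /= sub0r normrN ger0_norm ?fine_ge0// => muN.
exists N%:R => L NL; rewrite (@le_trans _ _ (mu (F N)))//.
  by rewrite le_measure ?inE//; [apply: measurableC; exact: measurable_box|exact: box_sub].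
by rewrite -[mu (F N)]fineK ?lee_fin// fin_num_measure.
Qed.

End tightness.

(** * Projections *)

Section projections.
Context (R : realType).

Lemma dot_mulmx k n (t : 'cV[R]_k) (V : 'M[R]_(k, n)) x : dot t (V *m x) = dot (V^T *m t) x.
Proof.
rewrite /dot; under eq_bigr do rewrite mxE mulr_sumr.
rewrite exchange_big; apply: eq_bigr => j _; rewrite mxE mulr_suml.
by apply: eq_bigr => i _; rewrite mxE mulrA (mulrC (t i 0)).
Qed.

Lemma stiefel_sqr_norm k n (t : 'cV[R]_k) (V : 'M[R]_(k, n)) : stiefel V ->
  \sum_(j < n) (V^T *m t) j 0 ^+ 2 = \sum_(i < k) t i 0 ^+ 2.
Proof.
have sqr_sum m (v : 'cV[R]_m) : \sum_(j < m) v j 0 ^+ 2 = (v^T *m v) 0 0.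
  by rewrite mxE; apply: eq_bigr => j _; rewrite mxE expr2.
by move=> VV; rewrite !sqr_sum trmx_mul trmxK mulmxA -(mulmxA t^T) VV mulmx1.
Qed.

(** The coefficients of [V^T t] have the Euclidean norm of [t], and each of them is
    at most the sum of the [|t i|] times the largest entry of [V]. Hence the sum
    of their fourth powers is at most a constant times the square of that entry. *)
Lemma stiefel_fourth_cvg0 k (V : forall n, 'M[R]_(k, n)) (t : 'cV[R]_k) :
  (forall n, (k <= n)%N -> stiefel (V n)) ->
  (\sum_i \sum_j V n i j ^+ 6) @[n --> \oo] --> (0 : R) ->
  (\sum_(j < n) ((V n)^T *m t) j 0 ^+ 4) @[n --> \oo] --> (0 : R).
Proof.
move=> VV V6; pose T := \sum_(i < k) `|t i 0|; pose Q := \sum_(i < k) t i 0 ^+ 2.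
have T0 : 0 <= T by rewrite sumr_ge0.
have Q0 : 0 <= Q by rewrite sumr_ge0// => i _; rewrite sqr_ge0.
apply/cvgrPdist_le => e e0; pose c := 1 + T ^+ 2 * Q.
have c0 : 0 < c by rewrite ltr_pwDl// mulr_ge0// sqr_ge0.
pose del := Num.sqrt (e / c); have del0 : 0 < del by rewrite sqrtr_gt0 divr_gt0.
have del2 : del ^+ 2 = e / c by rewrite sqr_sqrtr// ltW// divr_gt0.
have d6 : 0 < del ^+ 6 by rewrite exprn_gt0.
have := @cvgr0_norm_le _ _ _ _ _ _ V6 _ d6 => V6d.
near=> n; have kn : (k <= n)%N by near: n; exact: nbhs_infty_ge.
have Vd i j : `|V n i j| <= del.
  rewrite -(ler_pXn2r (isT : (0 < 6)%N)) ?nnegrE ?(ltW del0)//.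
  have : `|\sum_i \sum_j V n i j ^+ 6| <= del ^+ 6 by near: n; exact: V6d.
  have even6 (y : R) : 0 <= y ^+ 6 by rewrite -[6%N]/(2 * 3)%N exprM exprn_ge0 ?sqr_ge0.
  apply: le_trans; rewrite (le_trans _ (ler_norm _))// -normrX ger0_norm//.
  rewrite (bigD1 i)//= (bigD1 j)//= -addrA lerDl.
  by rewrite addr_ge0 // sumr_ge0// => i' _; rewrite sumr_ge0.
have sd j : `|((V n)^T *m t) j 0| <= T * del.
  rewrite mxE (le_trans (ler_norm_sum _ _ _))// /T mulr_suml ler_sum// => i _.
  by rewrite mxE normrM mulrC ler_wpM2l.
have s4 j : ((V n)^T *m t) j 0 ^+ 4 <= (T * del) ^+ 2 * ((V n)^T *m t) j 0 ^+ 2.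
  rewrite -[4%N]/(2 + 2)%N exprD ler_wpM2r ?sqr_ge0//.
  by rewrite -[leLHS]real_normK ?num_real// lerXn2r ?nnegrE ?mulr_ge0// ltW.
rewrite sub0r normrN ger0_norm; last first.
  by rewrite sumr_ge0// => j _; rewrite -[4%N]/(2 * 2)%N exprM sqr_ge0.
rewrite (le_trans (ler_sum _ (fun j _ => s4 j)))// -mulr_sumr.
rewrite (stiefel_sqr_norm t (VV n kn)) -/Q exprMn del2.
rewrite [leLHS](_ : _ = e * ((T ^+ 2 * Q) / c)); last by ring.
by rewrite ler_piMr ?(ltW e0)// ler_pdivrMr// mul1r lerDr.
Unshelve. all: end_near. Qed.

Lemma Rintegral_proj_law k n d (T : measurableType d) (P : probability T R)
    (X : {mfun T >-> 'cV[R]_n}) (V : 'M[R]_(k, n)) (f : 'cV[R]_k -> R) (M : R) :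
  measurable_fun setT f -> (forall x, `|f x| <= M) ->
  \int[proj_law P X V : probability _ _]_x f x = \int[distribution P X]_x f (V *m x).
Proof.
move=> mf fM; rewrite /Rintegral; congr fine.
have mV : measurable_fun setT (@mulmx R k n 1 V) by exact: measurable_mulmx.
have mfV : measurable_fun setT (fun x : 'cV[R]_n => f (V *m x)).
  exact: (measurableT_comp mf mV).
have mVX : measurable_fun setT (mulmx V \o X) by exact: (measurableT_comp mV).
transitivity (\int[P]_x (f (V *m X x))%:E)%E.
  rewrite [LHS](integral_pushforward mVX) ?preimage_setT//; first exact/measurable_EFinP.
  apply: (@integrable_bounded _ _ _ P (f \o (mulmx V \o X)) M) => [|x]; last exact: fM.
  exact: (measurableT_comp mf mVX).
have mX : measurable_fun setT X by [].
rewrite [RHS](integral_pushforward mX) ?preimage_setT//; first exact/measurable_EFinP.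
apply: (@integrable_bounded _ _ _ P ((fun x => f (V *m x)) \o X) M) => [|x]; last exact: fM.
exact: (measurableT_comp mfV mX).
Qed.

Lemma ge0_integral_proj_law k n d (T : measurableType d) (P : probability T R)
    (X : {mfun T >-> 'cV[R]_n}) (V : 'M[R]_(k, n)) (f : 'cV[R]_k -> \bar R) :
  measurable_fun setT f -> (forall x, (0 <= f x)%E) ->
  (\int[proj_law P X V : probability _ _]_x f x =
   \int[distribution P X]_x f (V *m x)%R)%E.
Proof.
move=> mf f0.
have mV : measurable_fun setT (@mulmx R k n 1 V) by exact: measurable_mulmx.
have mX : measurable_fun setT X by [].
have mVX : measurable_fun setT (mulmx V \o X) by exact: (measurableT_comp mV).
rewrite [LHS](ge0_integral_pushforward mVX)//.
rewrite [RHS](ge0_integral_pushforward mX)//.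
exact: (measurableT_comp mf mV).
Qed.

Lemma scaled_lp_ballE (p : R) n : 0 < p -> (0 < n)%N ->
  [set (n%:R : R) `^ p^-1 *: x | x in @lp_ball R p n] = [set x | lp_sum p x <= n%:R].
Proof.
move=> p0 n0; set r := n%:R `^ p^-1.
have n0R : 0 < n%:R :> R by rewrite ltr0n.
have r0 : 0 < r by rewrite powR_gt0.
have rp : r `^ p = n%:R by rewrite /r -powRrM mulVf ?gt_eqF// powRr1// ltW.
apply/seteqP; split=> [_ [x /= xB <-]|x /= xn].
  by rewrite /= lp_sumZ ?(ltW r0)// rp ler_piMr// ltW.
exists (r^-1 *: x); last by rewrite scalerA divff ?scale1r// gt_eqF.
rewrite /lp_ball/= -[leLHS]/(lp_sum p (r^-1 *: x)).
have := xn; rewrite -{1}[x](scalerKV (lt0r_neq0 r0)) lp_sumZ ?(ltW r0)// rp.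
by rewrite ger_pMr.
Qed.

Lemma cvg_inv_sqrt (p : R) : 0 < p -> (2 / Num.sqrt (n%:R / p)) @[n --> \oo] --> (0 : R).
Proof.
move=> p0.
have h : (n%:R : R)^-1 @[n --> \oo] --> (0 : R).
  apply/(@gtr0_cvgV0 R nat _ _ (fun n => n%:R)); last exact: cvgr_idn.
  by near=> n; rewrite ltr0n; near: n; exact: nbhs_infty_gt.
have h2 : (p * (n%:R : R)^-1) @[n --> \oo] --> (0 : R).
  by rewrite -[0](mulr0 p); apply: cvgM => //; exact: cvg_cst.
have h3 : (Num.sqrt (p * (n%:R : R)^-1)) @[n --> \oo] --> (0 : R).
  rewrite -[0]sqrtr0.
  exact: (cvg_comp _ _ h2 (@sqrt_continuous R 0)).
rewrite -[0](mulr0 2).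
rewrite (_ : (fun n => _) = (fun n : nat => 2 * Num.sqrt (p * (n%:R : R)^-1))).
  by apply: cvgM => //; exact: cvg_cst.
apply/funext => n; rewrite -[p * _]invf_div sqrtrV//.
by rewrite divr_ge0// ltW.
Unshelve. all: end_near. Qed.

End projections.

(** A deterministic sequence of matrices with orthonormal rows, whose entries tend
    to zero in the sense of [V6], is fixed. *)
Section projections_cvg.
Context (R : realType) (p : R) (k : nat).
Hypothesis p1 : 1 <= p.
Context (dX : nat -> measure_display) (TX : forall n, measurableType (dX n)).
Variable PX : forall n, probability (TX n) R.
Variable X : forall n, {mfun TX n >-> 'cV[R]_n}.
Hypothesis hX : forall n, (k <= n)%N ->
  uniform_on [set (n%:R : R) `^ p^-1 *: x | x in @lp_ball R p n]
    (distribution (PX n) (X n)).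
Variable V : forall n, 'M[R]_(k, n).
Hypothesis VV : forall n, (k <= n)%N -> stiefel (V n).
Hypothesis V6 : (\sum_i \sum_j V n i j ^+ 6) @[n --> \oo] --> (0 : R).

Local Notation muX n := (distribution (PX n) (X n)).
Local Notation law n := (proj_law (PX n) (X n) (V n) : probability 'cV[R]_k R).
Local Notation sd := (Num.sqrt (sigma2 p)).
Local Notation gauss := (@gaussian_cV R k sd : probability 'cV[R]_k R).

Let p0 : 0 < p. Proof. exact: lt_le_trans p1. Qed.
Let sd0 : 0 < sd. Proof. by rewrite sqrtr_gt0 sigma2_gt0. Qed.
Let sd2 : sd ^+ 2 = sigma2 p. Proof. by rewrite sqr_sqrtr// ltW// sigma2_gt0. Qed.

Let large : \forall n \near \oo, [/\ (k <= n)%N, 64 <= n%:R / p &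
  uniform_on [set x | lp_sum p x <= n%:R] (muX n)].
Proof.
near=> n; have kn : (k <= n)%N by near: n; exact: nbhs_infty_ge.
have n0 : (0 < n)%N by near: n; exact: nbhs_infty_gt.
split=> //; last by rewrite -scaled_lp_ballE//; exact: hX.
by rewrite ler_pdivlMr//; near: n; exact: nbhs_infty_ger.
Unshelve. all: end_near. Qed.

Lemma proj_law_cos_cvg (t : 'cV[R]_k) c :
  \int[law n]_x cos (dot t x + c) @[n --> \oo] --> \int[gauss]_x cos (dot t x + c).
Proof.
rewrite (gaussian_cV_transform sd0) sd2.
set Q := \sum_(i < k) _; set l := _ * _.
pose b n := (1 + 2 * (sigma2 p * Q)) * (2 / Num.sqrt (n%:R / p)) +
  (lp_fourth_moment p / 24 + sigma2 p ^+ 2 / 4) * \sum_(j < n) ((V n)^T *m t) j 0 ^+ 4.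
have b0 : b n @[n --> \oo] --> (0 : R).
  rewrite -[X in _ --> X](addr0 0); apply: cvgD.
    rewrite -[X in _ --> X](mulr0 (1 + 2 * (sigma2 p * Q))).
    by apply: cvgM; [exact: cvg_cst|exact: cvg_inv_sqrt].
  rewrite -[X in _ --> X](mulr0 (lp_fourth_moment p / 24 + sigma2 p ^+ 2 / 4)).
  by apply: cvgM; [exact: cvg_cst|exact: stiefel_fourth_cvg0].
apply: (@squeeze_cvgr _ _ _ _ (fun n => l - b n) (fun n => l + b n)); last 2 first.
- by rewrite -[X in _ --> X]subr0; apply: cvgB => //; exact: cvg_cst.
- by rewrite -[X in _ --> X]addr0; apply: cvgD => //; exact: cvg_cst.
near=> n; have [kn a64 hn] : [/\ (k <= n)%N, 64 <= n%:R / p &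
  uniform_on [set x | lp_sum p x <= n%:R] (muX n)] by near: n; exact: large.
have mc : measurable_fun setT (fun x : 'cV[R]_k => cos (dot t x + c)).
  apply: (measurableT_comp (@measurable_cos R)).
  by apply: measurable_funD => //; exact: measurable_dot.
rewrite (Rintegral_proj_law _ _ _ mc (fun x => cos_max _)).
under eq_Rintegral do rewrite dot_mulmx.
have := uniform_transform_gaussian p0 p1 a64 hn c ((V n)^T *m t).
by rewrite (stiefel_sqr_norm t (VV kn)) -/Q -/l -/(b n) ler_distl.
Unshelve. all: end_near. Qed.

Lemma proj_law_tight (e : R) : 0 < e -> exists L : R, [/\ 0 < L,
  \forall n \near \oo, (law n (~` box L) <= e%:E)%E & (gauss (~` box L) <= e%:E)%E].
Proof.
move=> e0; have [L0 gL0] := box_complement_small gauss e0.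
have v0 := sigma2_gt0 p0; pose M := 2 * sigma2 p.
have M0 : 0 < M by rewrite mulr_gt0.
pose L := Num.max L0 (1 + k%:R * M / e).
have L1 : 1 + k%:R * M / e <= L by rewrite le_max lexx orbT.
have kM : 0 <= k%:R * M / e by exact: divr_ge0 (mulr_ge0 (ler0n _ _) (ltW M0)) (ltW e0).
have Lp : 0 < L by apply: lt_le_trans L1; rewrite ltr_pwDl.
exists L; split=> //; last by rewrite gL0// le_max lexx.
near=> n; have [kn a64 hn] : [/\ (k <= n)%N, 64 <= n%:R / p &
  uniform_on [set x | lp_sum p x <= n%:R] (muX n)] by near: n; exact: large.
have a1 : 1 <= n%:R / p by apply: le_trans a64; rewrite ler1n.
apply: (@le_trans _ _ (k%:R * M / L ^+ 2)%:E).
  apply: box_complement_le => // i.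
  have mi : measurable_fun setT (fun x : 'cV[R]_k => (x i 0 ^+ 2)%:E).
    by apply/measurable_EFinP; apply: measurable_funX; exact: measurable_fun_coord.
  rewrite (ge0_integral_proj_law _ _ _ mi); last by move=> x; rewrite lee_fin sqr_ge0.
  have coord (x : 'cV[R]_k) : x i 0 = dot (delta_mx i 0) x.
    by rewrite -[delta_mx _ _]scale1r dot_delta mul1r.
  under eq_integral do rewrite coord dot_mulmx.
  have := second_moment_uniform p1 a1 hn ((V n)^T *m delta_mx i 0) a64.
  rewrite (stiefel_sqr_norm _ (VV kn)) (bigD1 i)//= big1 => [|j ji].
    by rewrite mxE !eqxx expr1n addr0 mulr1.
  by rewrite mxE (negbTE ji) expr0n.
rewrite lee_fin ler_pdivrMr ?exprn_gt0// -ler_pdivrMl// mulrC.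
move: L1 kM; set y := _ / e => L1 y0.
(* The value of L was chosen for this inequality. *)
have h (a b : R) : 0 <= a -> 1 + a <= b -> a <= b ^+ 2 by move=> *; nra.
exact: h.
Unshelve. all: end_near. Qed.

Lemma proj_law_cvg :
  (fun n => proj_law (PX n) (X n) (V n)) @ \oo --> (@gaussian_cV R k sd : M1 R k).
Proof.
apply/M1_cvgP; apply: (@cvg_from_trigonometric_integrals R k (fun n => law n) gauss).
- by move=> t c; exact: proj_law_cos_cvg.
- exact: proj_law_tight.
Qed.

End projections_cvg.

Theorem mainTheorem5 (R : realType) (p : R) (hp : 1 <= p) (hp2 : p != 2)
  (k : nat)
  (dX : nat -> measure_display) (TX : forall n : nat, measurableType (dX n))
  (PX : forall n : nat, probability (TX n) R)
  (X : forall n : nat, {mfun TX n >-> 'cV[R]_n})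
  (hX : forall n : nat, (k <= n)%N ->
    uniform_on [set (n%:R : R) `^ p^-1 *: x | x in @lp_ball R p n]
      (distribution (PX n) (X n)))
  (d : measure_display) (Omega : measurableType d) (P : probability Omega R)
  (V : forall n : nat, {mfun Omega >-> 'M[R]_(k, n)})
  (hV : forall n : nat, (k <= n)%N -> stiefel_uniform (distribution P (V n))) :
  {ae P, forall w : Omega,
    (fun n : nat => proj_law (PX n) (X n) (V n w)) @ \oo -->
      (@gaussian_cV R k (Num.sqrt (sigma2 p)) : M1 R k)}.
Proof.
apply: filterS (stiefel_entries_cvg0 hV) => w [VV V6].
exact: (proj_law_cvg hp hX VV V6).
Qed.
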